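(* Let $n\in\mathbb{N}$ and $0<\gamma<n$, and let $A$ be a Young function. Suppose first that $$\inf_{0<t<1}A(t)\,t^{-n/\gamma}>0,\qquad(\ast)$$ and let $A_{n/\gamma}$ be the associated Young function defined in the context. (a) If $i_{A_{n/\gamma}}>\frac{n}{n-\gamma}$, then $M_\gamma:L^A(\mathbb{R}^n)\to L^{A_{n/\gamma}}(\mathbb{R}^n)$, and $L^{A_{n/\gamma}}(\mathbb{R}^n)$ is the smallest among all Orlicz spaces $L^B(\mathbb{R}^n)$ for which $M_\gamma:L^A(\mathbb{R}^n)\to L^B(\mathbb{R}^n)$; that is, whenever $B$ is a Young function with $M_\gamma:L^A(\mathbb{R}^n)\to L^B(\mathbb{R}^n)$, one has $L^{A_{n/\gamma}}(\mathbb{R}^n)\to L^B(\mathbb{R}^n)$. (b) Conversely, if $i_{A_{n/\gamma}}>\frac{n}{n-\gamma}$ fails, then there is no optimal Orlicz target, in the sense that for every Young function $B$ with $M_\gamma:L^A(\mathbb{R}^n)\to L^B(\mathbb{R}^n)$ there exists a Young function $B_1$ such that $L^{B_1}(\mathbb{R}^n)\subsetneq L^B(\mathbb{R}^n)$ and $M_\gamma:L^A(\mathbb{R}^n)\to L^{B_1}(\mathbb{R}^n)$. (c) In particular, if $I_A<\frac{n}{\gamma}$, then the condition $i_{A_{n/\gamma}}>\frac{n}{n-\gamma}$ is equivalent to $i_A>1$, and $$A_{n/\gamma}^{-1}(t)\simeq A^{-1}(t)\,t^{-\gamma/n},\quad t>0.$$ (d) In addition, if $(\ast)$ is not satisfied,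 then there does not exist any Orlicz space $L^B(\mathbb{R}^n)$ for which $M_\gamma:L^A(\mathbb{R}^n)\to L^B(\mathbb{R}^n)$.
   Context: A Young function is a convex, left-continuous function $A:[0,\infty)\to[0,\infty]$ with $A(0)=0$ which is not constant on $(0,\infty)$ (i.e. neither identically $0$ nor identically $\infty$ there). For a nondecreasing $\Phi:[0,\infty)\to[0,\infty]$, $\Phi^{-1}(s)=\inf\{t\ge0:\Phi(t)>s\}$ (with $\inf\emptyset=\infty$) denotes its generalized right-continuous inverse. The Orlicz space $L^A(\mathbb{R}^n)$ consists of the measurable functions $f$ on $\mathbb{R}^n$ with $\int_{\mathbb{R}^n}A(|f(x)|/\lambda)\,dx<\infty$ for some $\lambda>0$, with the Luxemburg norm $\|f\|_{L^A(\mathbb{R}^n)}=\inf\{\lambda>0:\int_{\mathbb{R}^n}A(|f(x)|/\lambda)\,dx\le1\}$. An arrow $L^A(\mathbb{R}^n)\to L^B(\mathbb{R}^n)$ without an operator denotes continuous inclusion. The fractional maximal operator is $M_\gamma f(x)=\sup_{Q\ni x}|Q|^{\gamma/n-1}\int_Q|f(y)|\,dy$, $x\in\mathbb{R}^n$, for locally integrable $f$, the supremum being over all cubes $Q$ containing $x$ with sides parallel to the coordinate axes. The notation $M_\gamma:L^A(\mathbb{R}^n)\to L^B(\mathbb{R}^n)$ means that there is $C>0$ with $\|M_\gamma f\|_{L^B(\mathbb{R}^n)}\le C\|f\|_{L^A(\mathbb{R}^n)}$ for all $f\in L^A(\mathbb{R}^n)$. Construction of $A_{n/\gamma}$: if $\inf_{0<t<1}A(t)t^{-n/\gamma}>0$,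 set $G_{n/\gamma}(t)=\sup_{0<s\le t}A^{-1}(s)\,s^{-\gamma/n}$ for $t\ge0$ (with value $0$ at $t=0$), and $A_{n/\gamma}(t)=\int_0^t\frac{G_{n/\gamma}^{-1}(s)}{s}\,ds$ for $t\ge0$. This is a Young function. Boyd indices: for a Young function $A$, let $h_A(t)=\sup_{0<s<\infty}\frac{A^{-1}(st)}{A^{-1}(s)}$ for $t>0$. The lower and upper Boyd indices are $i_A=\sup_{1<t<\infty}\frac{\log t}{\log h_A(t)}$ and $I_A=\inf_{0<t<1}\frac{\log t}{\log h_A(t)}$, the quotient being read as $\infty$ when $h_A(t)=1$. One has $1\le i_A\le I_A\le\infty$. The relation $L\simeq R$ means that $L$ and $R$ bound each other up to positive multiplicative constants independent of $t$. *)

(* Defs.v *)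
From HB Require Import structures.
From mathcomp Require Import all_boot all_order all_algebra.
From mathcomp Require Import all_classical all_reals all_analysis.
From mathcomp Require Import measurable_realfun.

Set Implicit Arguments.
Unset Strict Implicit.
Unset Printing Implicit Defensive.

Import Order.TTheory GRing.Theory Num.Theory.
Import numFieldNormedType.Exports.

Local Open Scope classical_set_scope.
Local Open Scope ring_scope.
Local Open Scope ereal_scope.

(* The library has no Lebesgue measure on R^n. It is built here on n-tuples:
   the n-fold product of the one-dimensional Lebesgue measure is defined on the
   Borel sets, by transporting lebesgue_measure \x mu_n along the bijection
   R * R^n -> R^n.+1, and is then completed by Caratheodory's extension. *)

Section cons_measure.
Context d (T : measurableType d) {R : realType} (n : nat).
Variable m1 : {sigma_finite_measure set T -> \bar R}.
Variable m2 : {sigma_finite_measure set (n.-tuple T) -> \bar R}.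

Definition cons_pair (p : T * n.-tuple T) : n.+1.-tuple T :=
  [tuple of p.1 :: p.2].

Lemma measurable_cons_pair : measurable_fun [set: _] cons_pair.
Proof. by apply: measurable_cons; [exact: measurable_fst|exact: measurable_snd]. Qed.

Definition cons_measure : set (n.+1.-tuple T) -> \bar R :=
  pushforward (m1 \x m2) cons_pair.

Let cons_measure0 : cons_measure set0 = 0.
Proof. by rewrite /cons_measure /pushforward preimage_set0 measure0. Qed.

Let cons_measure_ge0 A : 0 <= cons_measure A.
Proof. by rewrite /cons_measure /pushforward; exact: measure_ge0. Qed.

Let cons_measure_sigma_additive : semi_sigma_additive cons_measure.
Proof.
move=> F mF tF mUF; rewrite /cons_measure /pushforward preimage_bigcup.
apply: measure_semi_sigma_additive.
- by move=> k; rewrite -[X in measurable X]setTI; exact: measurable_cons_pair.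
- apply/trivIsetP => /= i j _ _ ij; rewrite -preimage_setI.
  by move/trivIsetP : tF => /(_ _ _ _ _ ij) ->//; rewrite preimage_set0.
- rewrite -preimage_bigcup -[X in measurable X]setTI.
  exact: measurable_cons_pair.
Qed.

HB.instance Definition _ := isMeasure.Build _ _ _ cons_measure
  cons_measure0 cons_measure_ge0 cons_measure_sigma_additive.

Let cons_measure_sigma_finite : sigma_finite [set: _] cons_measure.
Proof.
have /sigma_finiteP[F [UF ndF Foo]] := sigma_finiteT m1.
have /sigma_finiteP[G [UG ndG Goo]] := sigma_finiteT m2.
pose g (x : n.+1.-tuple T) := (thead x, [tuple of behead x]).
have gK x : g (cons_pair x) = x by case: x => a b; congr pair; apply/val_inj.
have mg : measurable_fun [set: _] g.
  by apply: measurable_fun_pair; [exact: measurable_tnth|exact: measurable_behead].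
exists (fun k => g @^-1` (F k `*` G k)).
  apply/seteqP; split => // x _.
  have [i _ Fi] : (\bigcup_k F k) (g x).1 by rewrite -UF.
  have [j _ Gj] : (\bigcup_k G k) (g x).2 by rewrite -UG.
  exists (maxn i j) => //; split => /=.
  - by move: Fi; exact/subsetPset/ndF/leq_maxl.
  - by move: Gj; exact/subsetPset/ndG/leq_maxr.
move=> k; have [mF Fk] := Foo k; have [mG Gk] := Goo k; split.
  by rewrite -[X in measurable X]setTI; apply: mg => //; exact: measurableX.
rewrite /cons_measure /pushforward (_ : _ @^-1` _ = F k `*` G k).
  by rewrite product_measure1E// lte_mul_pinfty// ge0_fin_numE.
rewrite -comp_preimage (_ : g \o cons_pair = id) ?preimage_id//.
exact/funext.
Qed.

HB.instance Definition _ := Measure_isSigmaFinite.Build _ _ _ cons_measure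
  cons_measure_sigma_finite.

End cons_measure.

Fixpoint borel_lebesgue (R : realType) (n : nat) :
    {sigma_finite_measure set (n.-tuple (measurableTypeR R)) -> \bar R} :=
  match n with
  | 0%N => \d_([tuple] : 0.-tuple (measurableTypeR R))
  | k.+1 => cons_measure (@lebesgue_measure R) (borel_lebesgue R k)
  end.

(* R^n with its Lebesgue sigma-algebra. *)
Definition Rn (R : realType) (n : nat) : Type :=
  caratheodory_type ((borel_lebesgue R n)^*)%mu.
HB.instance Definition _ (R : realType) (n : nat) := Measurable.on (Rn R n).

Definition leb (R : realType) (n : nat) : set (Rn R n) -> \bar R :=
  completed_measure_extension (mu := borel_lebesgue R n).
Arguments leb : clear implicits.
HB.instance Definition _ (R : realType) (n : nat) := Measure.on (leb R n).
HB.instance Definition _ (R : realType) (n : nat) :=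
  @Measure_isSigmaFinite.Build _ _ _ (leb R n)
    (completed_measure_extension_sigma_finite (sigma_finiteT (borel_lebesgue R n))).

(* Functions [0, oo) -> [0, oo] are represented by A : R -> \bar R; the values
   of A on negative reals are irrelevant everywhere below. *)

Definition young (R : realType) (A : R -> \bar R) : Prop :=
  [/\ A 0%R = 0,
      forall t : R, (0 <= t)%R -> 0 <= A t,
      forall s t l : R, (0 <= s)%R -> (0 <= t)%R -> (0 <= l <= 1)%R ->
        A (l * s + (1 - l) * t)%R <= l%:E * A s + (1 - l)%:E * A t,
      forall t : R, (0 < t)%R -> A x @[x --> t^'-] --> A t &
      ~ exists c : \bar R, forall t : R, (0 < t)%R -> A t = c].

(* Generalized right-continuous inverse; ereal_inf set0 = +oo. *)
Definition ginv (R : realType) (Phi : R -> \bar R) (s : R) : \bar R :=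
  ereal_inf [set t%:E | t in [set t : R | (0 <= t)%R /\ s%:E < Phi t]].

(* M_gamma f takes values in [0, oo], so function spaces consist of extended
   real-valued functions, and A(oo) is read as oo, the limit of any Young
   function A at infinity. *)
Definition at_ereal (R : realType) (A : R -> \bar R) (x : \bar R) : \bar R :=
  if x is r%:E then A r else +oo.

Definition modular (R : realType) (n : nat) (A : R -> \bar R)
    (f : Rn R n -> \bar R) (lam : R) : \bar R :=
  \int[leb R n]_x at_ereal A (`|f x| / lam%:E).

Definition orlicz (R : realType) (n : nat) (A : R -> \bar R) :
    set (Rn R n -> \bar R) :=
  [set f : Rn R n -> \bar R | measurable_fun [set: Rn R n] f /\
           exists lam : R, (0 < lam)%R /\ modular A f lam < +oo].
Arguments orlicz {R} n A.

Definition luxemburg (R : realType) (n : nat) (A : R -> \bar R)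
    (f : Rn R n -> \bar R) : \bar R :=
  ereal_inf [set lam%:E | lam in [set lam : R | (0 < lam)%R /\
                                                modular A f lam <= 1]].

Definition orlicz_embeds (R : realType) (n : nat) (A B : R -> \bar R) : Prop :=
  exists C : R, (0 < C)%R /\
    forall f : Rn R n -> \bar R, orlicz n A f ->
      orlicz n B f /\ luxemburg B f <= C%:E * luxemburg A f.

Definition is_cube (R : realType) (n : nat) (Q : set (Rn R n)) : Prop :=
  exists (a : 'I_n -> R) (l : R), (0 < l)%R /\
    Q = [set y : Rn R n | forall i : 'I_n, (a i <= tnth y i <= a i + l)%R].

Definition frac_max (R : realType) (n : nat) (gamma : R)
    (f : Rn R n -> \bar R) (x : Rn R n) : \bar R :=
  ereal_sup [set leb R n Q `^ (gamma / n%:R - 1) * \int[leb R n]_(y in Q) `|f y|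
            | Q in [set Q | is_cube Q /\ Q x]].

Definition frac_max_bounded (R : realType) (n : nat) (gamma : R)
    (A B : R -> \bar R) : Prop :=
  exists C : R, (0 < C)%R /\
    forall f : Rn R n -> \bar R, orlicz n A f ->
      luxemburg B (frac_max gamma f) <= C%:E * luxemburg A f.

Definition growth_cond (R : realType) (n : nat) (gamma : R)
    (A : R -> \bar R) : Prop :=
  0 < ereal_inf [set A t * (t `^ (- (n%:R / gamma)))%:E | t in `]0%R, 1%R[].

(* The value at 0 is set explicitly since ereal_sup set0 = -oo. *)
Definition sobolev_G (R : realType) (n : nat) (gamma : R) (A : R -> \bar R)
    (t : R) : \bar R :=
  if (t <= 0)%R then 0 else
  ereal_sup [set ginv A s * (s `^ (- (gamma / n%:R)))%:E | s in `]0%R, t]].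

Definition sobolev_young (R : realType) (n : nat) (gamma : R) (A : R -> \bar R)
    (t : R) : \bar R :=
  \int[@lebesgue_measure R]_(s in `]0%R, t[) (ginv (sobolev_G n gamma A) s / s%:E).

Definition boyd_h (R : realType) (A : R -> \bar R) (t : R) : \bar R :=
  ereal_sup [set ginv A (s * t) / ginv A s | s in `]0%R, +oo[].

(* The case boyd_h A t = 1 is separate: x / 0 = x * +oo in \bar R, which is -oo
   for x = ln t with t < 1. *)
Definition boyd_quot (R : realType) (A : R -> \bar R) (t : R) : \bar R :=
  if boyd_h A t == 1 then +oo else (ln t)%:E / lne (boyd_h A t).

Definition boyd_lower (R : realType) (A : R -> \bar R) : \bar R :=
  ereal_sup [set boyd_quot A t | t in `]1%R, +oo[].

Definition boyd_upper (R : realType) (A : R -> \bar R) : \bar R :=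
  ereal_inf [set boyd_quot A t | t in `]0%R, 1%R[].

Definition simeq_pos (R : realType) (L K : R -> \bar R) : Prop :=
  exists c1 c2 : R, [/\ (0 < c1)%R, (0 < c2)%R &
    forall t : R, (0 < t)%R -> c1%:E * K t <= L t /\ L t <= c2%:E * K t].

(* Main.v *)
Require Import Defs.
From mathcomp Require Import all_boot all_order all_algebra.
From mathcomp Require Import all_classical all_reals all_analysis.
From mathcomp Require Import measurable_realfun.
From mathcomp Require Import ring lra.

Import Order.TTheory GRing.Theory Num.Theory.
Import numFieldNormedType.Exports.

Local Open Scope classical_set_scope.
Local Open Scope ring_scope.
Local Open Scope ereal_scope.

Set Implicit Arguments.
Unset Strict Implicit.
Unset Printing Implicit Defensive.

(** Write al = gamma/n, be = 1/(1 - al), psi(s) = A^{-1}(s) s^{-al}, and let G be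
    the running supremum of psi. Since A^{-1}(s)/s is nonincreasing,
    G(k s) <= k^{1-al} G(s) for k >= 1; hence A_{n/gamma}(t) <= G^{-1}(t) <=
    A_{n/gamma}(2 t), and the condition on the lower Boyd index says exactly that
    G(k s) <= th G(s) for all s, for some k > 1 and some th < k^{1-al}.

    Level sets. If the modular of f is at most 1 and lam > psi on ]0, tau], a cube
    Q with |Q|^{al-1} int_Q |f| > 2 lam has |Q| < 1/tau, and the mean of |f| on Q
    exceeds 2 eta, where eta = tau^al lam. Vitali's covering lemma then bounds
    |{M_gamma f > 2 lam}| by a multiple of (1/eta) int_{|f| > eta} |f|, hence of
    1/tau since A(eta) >= tau. Under the strict dilation inequality for G the first
    bound, taken at tau = k^j for all integers j, sums geometrically and gives (a).

    Necessity. If M_gamma maps L^A to L^B, multiples of indicators of cubes give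
    sum_j 2^j B(r^j x / K) <= 2 G^{-1}(x) with r = 2^{al-1}. The term j = 0 is the
    optimality in (a) and, when G is infinite, yields (d). If the strict dilation
    inequality fails, G^{-1}(x) behaves like x^be on arbitrarily long ranges, so
    the sum can stay bounded only if B(J t) <= eps G^{-1}(t) for some t, whatever
    J and eps. Adding to B the hinges 2^{-j} G^{-1}(t_j) max(0, t - t_j)/t_j at
    such points t_j gives a strictly smaller target, which is still admissible by
    the 1/tau bound; this is (b).

    If I_A < n/gamma then psi(s t) <= d psi(s) for some t, d < 1, so psi and its
    running supremum G are equivalent; this transfers the dilation inequality
    between A^{-1} and G and gives (c). *)

(** * Cubes and their Lebesgue measure *)

Section cubes.
Context {R : realType}.

Definition cube (n : nat) (a : 'I_n -> R) (l : R) : set (Rn R n) :=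
  [set y : Rn R n | forall i : 'I_n, (a i <= tnth y i <= a i + l)%R].

Lemma cons_pair_cube n (a : 'I_n.+1 -> R) (l : R) :
  @cons_pair _ (measurableTypeR R) n @^-1` (cube a l) =
  `[a ord0, (a ord0 + l)%R] `*` (cube (fun i => a (lift ord0 i)) l : set (n.-tuple R)).
Proof.
apply/seteqP; split=> -[x y] /=.
  move=> H; split => /=; first by have := H ord0; rewrite in_itv /= tnth0.
  by move=> i; have := H (lift ord0 i); rewrite tnthS.
move=> [/= H1 H2] i; case: (unliftP ord0 i) => [j ->|->]; rewrite ?tnthS ?tnth0.
  exact: H2.
by move: H1; rewrite in_itv.
Qed.

Lemma measurable_cube_borel n (a : 'I_n -> R) (l : R) :
  measurable (cube a l : set (n.-tuple (measurableTypeR R))).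
Proof.
rewrite [X in measurable X](_ : _ = \bigcap_(i in [set: 'I_n])
   ((fun y : n.-tuple (measurableTypeR R) => tnth y i) @^-1` `[a i, (a i + l)%R])).
  apply: fin_bigcap_measurable; first exact: finite_finset.
  move=> i _; rewrite -[X in measurable X]setTI.
  exact: measurable_tnth.
apply/seteqP; split=> y /= H i; first by move=> _ /=; rewrite in_itv /=; exact: H.
by have := H i I; rewrite /= in_itv.
Qed.

Lemma borel_cube n (a : 'I_n -> R) (l : R) : (0 <= l)%R ->
  borel_lebesgue R n (cube a l : set (n.-tuple (measurableTypeR R))) = (l ^+ n)%:E.
Proof.
move=> l0; elim: n a => [|n IH] a.
  rewrite /= diracE expr0 mem_set //.
  by case.
rewrite /= /cons_measure /pushforward cons_pair_cube.
rewrite product_measure1E //=; last exact: measurable_cube_borel.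
rewrite IH lebesgue_measure_itv /= lte_fin ltrDl -EFinD addrAC subrr add0r exprS EFinM.
case: ltP => // l0'; have -> : l = 0%R by apply/eqP; rewrite eq_le l0 l0'.
by rewrite mul0e.
Qed.

Lemma measurable_cube n (a : 'I_n -> R) (l : R) : measurable (cube a l).
Proof.
by apply: caratheodory_measurable_mu_ext; exact: measurable_cube_borel.
Qed.

Lemma leb_cube n (a : 'I_n -> R) (l : R) : (0 <= l)%R ->
  leb R n (cube a l) = (l ^+ n)%:E.
Proof.
move=> l0; rewrite -(borel_cube a l0).
by rewrite /leb /completed_measure_extension measurable_mu_extE //; exact: measurable_cube_borel.
Qed.

End cubes.

(** * Weak type estimate for families of cubes *)

Lemma measurable_gt d (T : measurableType d) (R : realType) (f : T -> \bar R) c :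
  measurable_fun [set: T] f -> measurable [set x | c < f x].
Proof.
move=> mf; rewrite -[X in measurable X]setTI.
by apply: emeasurable_fun_o_infty; [exact: measurableT|exact: mf].
Qed.

Section integral_monotone.
Context d (T : measurableType d) (R : realType) (mu : {measure set T -> \bar R}).

(** The integral of a nonnegative function is the supremum of the integrals of the simple functions
    below it, and this supremum grows with the integrand, measurable or not. *)
Lemma nneg_le_integral (D : set T) (f g : T -> \bar R) :
  (forall x, D x -> 0 <= f x) -> (forall x, D x -> f x <= g x) ->
  \int[mu]_(x in D) f x <= \int[mu]_(x in D) g x.
Proof.
move=> f0 fg.
have g0 x : D x -> 0 <= g x by move=> Dx; exact: le_trans (f0 _ Dx) (fg _ Dx).
rewrite !ge0_integralE//; apply: ereal_sup_le => _ [h hf <-].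
exists h => // x; apply: le_trans (hf x) _; rewrite /patch.
by case: ifPn => // /set_mem; exact: fg.
Qed.

Lemma nneg_le_integral_set (A B : set T) (f : T -> \bar R) :
  (forall x, 0 <= f x) -> A `<=` B ->
  \int[mu]_(x in A) f x <= \int[mu]_(x in B) f x.
Proof.
move=> f0 AB; rewrite [leLHS]integral_mkcond [leRHS]integral_mkcond.
apply: nneg_le_integral => x _; rewrite /patch; first by case: ifPn.
case: ifPn => [/set_mem Ax|_]; last by case: ifPn.
by rewrite mem_set//; exact: AB.
Qed.

End integral_monotone.

Section vitali.
Context {R : realType} (n : nat) (I : choiceType).
Variables (a : I -> 'I_n -> R) (l : I -> R).

Let Q i := cube (a i) (l i).
(** The cube with the same centre as [Q i] and three times its side. *)
Let Q3 i := cube (fun k => a i k - l i)%R (3 * l i)%R.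

Lemma cube_sub_triple i j : (l i <= l j)%R -> Q i `&` Q j !=set0 -> Q i `<=` Q3 j.
Proof.
move=> lij [y [yi yj]] x xi k.
move: (yi k) (yj k) (xi k) => /andP[? ?] /andP[? ?] /andP[? ?].
by apply/andP; split; lra.
Qed.

Lemma exists_max_side (s : seq I) : s != [::] ->
  exists2 j, j \in s & forall i, i \in s -> (l i <= l j)%R.
Proof.
elim: s => // x [|y s] IH _.
  by exists x; rewrite ?mem_head// => i; rewrite inE => /eqP->.
have [//|j js jmax] := IH.
have [h|h] := leP (l x) (l j).
  exists j; first by rewrite inE js orbT.
  by move=> i; rewrite inE => /orP[/eqP->//|]; exact: jmax.
exists x; first exact: mem_head.
move=> i; rewrite inE => /orP[/eqP->//|/jmax hi].
exact: le_trans hi (ltW h).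
Qed.

(** Greedy selection: a cube of largest side is kept, the cubes meeting it lie in its triple, and
    the recursion treats those disjoint from it. *)
Lemma finite_vitali_cubes (s : seq I) : (forall i, 0 < l i)%R ->
  exists t : seq I, [/\ uniq t, {subset t <= s}, trivIset [set` t] Q &
    forall i, i \in s -> exists2 j, j \in t & Q i `<=` Q3 j].
Proof.
move=> l0.
have [m] := ubnP (size s); elim: m s => // m IH s.
have [->|s0 ssz] := eqVneq s [::].
  by move=> _; exists [::]; split => //; rewrite set_nil; exact: trivIset_set0.
have [j js jmax] := exists_max_side s0.
pose s' := [seq i <- s | `[< Q i `&` Q j = set0 >]].
have Qj0 : Q j !=set0.
  exists [tuple a j k | k < n] => k; rewrite tnth_mktuple lexx/= lerDl ltW//.
(* The chosen cube is nonempty, hence meets itself and is itself discarded from [s']. *)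
have s'm : (size s' < m)%N.
  rewrite -ltnS; apply: leq_trans ssz; rewrite ltnS size_filter -(count_predC (fun i => `[< Q i `&` Q j = set0 >]) s).
  rewrite -[X in (X < _)%N]addn0 ltn_add2l -has_count; apply/hasP; exists j => //=.
  by apply/asboolPn; rewrite setIid; exact/eqP/set0P.
have [t [ut ts tt tc]] := IH _ s'm.
exists (j :: t); split.
- rewrite /= ut andbT; apply/negP => /ts; rewrite mem_filter => /andP[/asboolP + _].
  by rewrite setIid; exact/eqP/set0P.
- move=> i; rewrite inE => /orP[/eqP->//|/ts]; by rewrite mem_filter => /andP[].
- apply/trivIsetP => x y /=.
  have jt i : i \in t -> Q i `&` Q j = set0.
    by move/ts; rewrite mem_filter => /andP[/asboolP].
  rewrite !inE => /orP[/eqP->|xt] /orP[/eqP->|yt]; rewrite ?eqxx//.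
  + by rewrite setIC => _; exact: jt.
  + by move=> _; exact: jt.
  + by move: tt => /trivIsetP; apply.
- move=> i is_; have [i0|i0] := pselect (Q i `&` Q j = set0).
    have [|k kt ik] := tc i; first by rewrite mem_filter is_ andbT; exact/asboolP.
    by exists k => //; rewrite inE kt orbT.
  exists j; first exact: mem_head.
  by apply: cube_sub_triple; [exact: jmax|exact/set0P/eqP].
Qed.

End vitali.

Section weak_type.
Context {R : realType} (n : nat).
Variables (a : nat -> 'I_n -> R) (l : nat -> R).
Hypothesis l0 : forall i, (0 < l i)%R.

(** Among the first [N] cubes, the triples of a disjoint subfamily cover the union, at the cost of
    [3 ^+ n]. By disjointness the volumes of that subfamily add up to at most the integral of [g]
    divided by [eta]. Continuity of the measure from below then removes [N]. *)
Lemma weak_type_cubes (P : set nat) (g : Rn R n -> \bar R) (eta : R) :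
  (0 < eta)%R -> (forall x, 0 <= g x) -> measurable_fun [set: Rn R n] g ->
  (forall i, P i -> (eta * l i ^+ n)%:E <= \int[leb R n]_(x in cube (a i) (l i)) g x) ->
  leb R n (\bigcup_(i in P) cube (a i) (l i)) <=
    ((3 ^+ n) / eta)%:E * \int[leb R n]_x g x.
Proof.
move=> eta0 g0 mg Pg.
pose F N := \bigcup_(i in [set i | (i < N)%N /\ P i]) cube (a i) (l i).
have mF N : measurable (F N).
  by apply: bigcup_measurable => i _; exact: measurable_cube.
have FU : \bigcup_N F N = \bigcup_(i in P) cube (a i) (l i).
  apply/seteqP; split=> [x [N _ [i [_ Pi] xi]]|x [i Pi xi]]; first by exists i.
  by exists i.+1 => //; exists i.
have ndF : {homo F : n m / (n <= m)%N >-> (n <= m)%O}.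
  move=> i j ij; apply/subsetPset => x [k [ki Pk] xk]; exists k => //; split=> //.
  exact: leq_trans ki ij.
have FN N : leb R n (F N) <= ((3 ^+ n) / eta)%:E * \int[leb R n]_x g x.
  have [t [ut ts tt tc]] := finite_vitali_cubes a [seq i <- iota 0 N | `[<P i>]] l0.
  have sub : F N `<=` \big[setU/set0]_(j <- t) cube (fun k => a j k - l j)%R (3 * l j)%R.
    rewrite -bigcup_seq => x [i [iN Pi] xi].
    have [|j jt ij] := tc i; last by exists j => //; exact: ij.
    by rewrite mem_filter mem_iota/= add0n iN andbT; exact/asboolP.
  have mb j : measurable (cube (fun k => a j k - l j)%R (3 * l j)%R) by exact: measurable_cube.
  apply: le_trans (le_measure _ _ _ sub) _; rewrite ?inE//.
    exact: bigsetU_measurable.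
  have le1 : leb R n (\big[setU/set0]_(j <- t) cube (fun k => a j k - l j)%R (3 * l j)%R)
      <= \sum_(j <- t) ((3 ^+ n)%:E * (l j ^+ n)%:E).
    elim: (t) => [|j t' IH]; first by rewrite !big_nil measure0.
    rewrite !big_cons; set U := \big[_/_]_(_ <- _) _; set V := cube _ _.
    have U2 : leb R n (V `|` U) <= leb R n V + leb R n U.
      by apply: measureU2; [exact: mb|exact: bigsetU_measurable].
    apply: (le_trans U2); apply: leeD => //.
    rewrite leb_cube; first by rewrite exprMn EFinM.
    by rewrite mulr_ge0// ltW.
  apply: le_trans le1 _.
  rewrite EFinM -muleA -ge0_sume_distrr; last first.
    by move=> i _; rewrite lee_fin exprn_ge0// ltW.
  rewrite lee_pmul2l ?lte_fin ?exprn_gt0//.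
  rewrite -lee_pdivrMl ?invr_gt0// invrK ge0_sume_distrr; last first.
    by move=> i _; rewrite lee_fin exprn_ge0// ltW.
  apply: (@le_trans _ _ (\sum_(j <- t) \int[leb R n]_(x in cube (a j) (l j)) g x)).
    rewrite big_seq [leRHS]big_seq; apply: lee_sum => j /ts.
    by rewrite mem_filter => /andP[/asboolP /Pg]; rewrite EFinM.
  rewrite -ge0_integral_bigsetU//.
  - by apply: nneg_le_integral_set.
  - by move=> j; exact: measurable_cube.
  - by apply: measurable_funTS.
rewrite -FU; have cv := nondecreasing_cvg_mu (mu := leb R n) mF (bigcupT_measurable _ mF) ndF.
rewrite -(cvg_lim _ cv)//; apply: lime_le; first by apply/cvg_ex; eexists; exact: cv.
by apply: nearW => N; exact: FN.
Qed.

End weak_type.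

(** * The fractional maximal function *)

Section fractional_maximal.
Context {R : realType} (n : nat) (gamma : R).
Implicit Types (f : Rn R n -> \bar R) (a : 'I_n -> R) (l : R).

Definition cube_frac f a l : \bar R :=
  ((l ^+ n) `^ (gamma / n%:R - 1))%:E * \int[leb R n]_(x in cube a l) `|f x|.

Lemma cube_frac_ge0 f a l : 0 <= cube_frac f a l.
Proof.
by rewrite mule_ge0 ?lee_fin ?powR_ge0//; apply: integral_ge0.
Qed.

Lemma frac_max_ge f x a l : (0 < l)%R -> cube a l x ->
  cube_frac f a l <= frac_max gamma f x.
Proof.
move=> l0 ax; apply: ereal_sup_ubound; exists (cube a l).
  by split => //; exists a, l.
by rewrite leb_cube ?poweR_EFin// ltW.
Qed.

Lemma frac_max_gt f x c : c < frac_max gamma f x ->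
  exists a l, [/\ (0 < l)%R, cube a l x & c < cube_frac f a l].
Proof.
move=> /ereal_sup_gt[_ [Q [[a [l [l0 ->]]] Qx] <-]].
by rewrite leb_cube ?poweR_EFin ?ltW// => h; exists a, l.
Qed.

Lemma frac_max_ge0 f x : 0 <= frac_max gamma f x.
Proof.
apply: le_trans (@frac_max_ge f x (fun i => tnth x i) 1 ltr01 _).
  exact: cube_frac_ge0.
by move=> i; rewrite lexx lerDl ler01.
Qed.

(* Rational cubes thus suffice in the supremum, which makes [frac_max] measurable
   and its superlevel sets countable unions of cubes. *)
Lemma cube_frac_enlarge f a l c : (0 < l)%R -> c < cube_frac f a l ->
  exists2 d, (l < d)%R & forall a' l', (l < l' < d)%R ->
    cube a l `<=` cube a' l' -> c < cube_frac f a' l'.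
Proof.
move=> l0; rewrite /cube_frac; set I := \int[_]_(x in cube a l) _ => cI.
pose w (t : R) := ((t ^+ n) `^ (gamma / n%:R - 1))%R.
have I0 : 0 <= I by apply: integral_ge0.
suff [d ld H] : exists2 d, (l < d)%R & forall l', (l < l' < d)%R -> c < (w l')%:E * I.
  exists d; [exact: ld|move=> a' l' ll' aa']; apply: lt_le_trans (H _ ll') _.
  by rewrite lee_pmul2l ?lte_fin ?powR_gt0 ?exprn_gt0//; [exact: nneg_le_integral_set|by case/andP: ll' => ll' _; exact: lt_trans ll'].
(* An infinite integral makes the product infinite for every side. For a finite one, the continuity
   of the weight [w] at [l] leaves room for a slightly larger side. *)
move: I I0 cI => [r|_|//]; last first.
  move=> cI; exists (l + 1)%R; first by rewrite ltrDl.
  move=> l' /andP[ll' _]; rewrite gt0_muley ?lte_fin ?powR_gt0 ?exprn_gt0//; last exact: lt_trans ll'.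
  by apply: lt_le_trans cI _; rewrite leey.
move=> r0; case: c => [c||]; last 2 first.
- by rewrite ltNge leey.
- move=> _; exists (l + 1)%R; first by rewrite ltrDl.
  by move=> l' _; rewrite -EFinM ltNyr.
rewrite -EFinM lte_fin => cl.
have cw0 : {for l, continuous w}.
  apply: (@continuous_comp R R R (fun t => t ^+ n)%R (fun t => t `^ (gamma / n%:R - 1))%R).
    exact: (@exprn_continuous R n).
  apply: differentiable_continuous; apply/derivable1_diffP/derivable_powR.
  by rewrite in_itv/= andbT exprn_gt0.
have cw : {for l, continuous (fun t => w t * r)%R} by apply: cvgM => //; exact: cvg_cst.
have /cvgrPdist_lt /(_ (w l * r - c)%R) := cw; rewrite subr_gt0 => /(_ cl) [e /= e0 He].
exists (l + e)%R; first by rewrite ltrDl.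
move=> l' /andP[ll' l'e]; rewrite -EFinM lte_fin.
have : (`|w l * r - w l' * r| < w l * r - c)%R.
  by apply: He => /=; rewrite ltr_distl; apply/andP; split; lra.
by rewrite ltr_distl => /andP[? ?]; lra.
Qed.

Definition qcorner (q : {ffun 'I_n -> rat} * rat) : 'I_n -> R := fun i => ratr (q.1 i).
Definition qside (q : {ffun 'I_n -> rat} * rat) : R := ratr q.2.

Lemma frac_max_gt_rat f x c : c < frac_max gamma f x ->
  exists q, [/\ (0 < qside q)%R, cube (qcorner q) (qside q) x &
                c < cube_frac f (qcorner q) (qside q)].
Proof.
move=> /frac_max_gt[a [l [l0 ax cl]]].
have [d ld H] := cube_frac_enlarge l0 cl.
have [q] := @rat_in_itvoo R _ _ (midf_lt ld).1; rewrite in_itv/= => /andP[lq qm].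
have qd := lt_trans qm (midf_lt ld).2.
(* Each coordinate of the corner may move down by less than the excess [ratr q - l] of the side, and
   the new cube still contains the old one. *)
have /choice[b bP] : forall i, exists q' : rat, (a i - (ratr q - l) < ratr q' < a i)%R.
  move=> i; have [|q'] := @rat_in_itvoo R (a i - (ratr q - l))%R (a i).
    by rewrite ltrBlDr ltrDl subr_gt0.
  by rewrite in_itv; exists q'.
have sub : cube a l `<=` cube (qcorner (finfun b, q)) (ratr q).
  move=> y ay i; rewrite /qcorner /= ffunE.
  by move: (ay i) (bP i) => /andP[? ?] /andP[? ?]; apply/andP; split; lra.
exists (finfun b, q); rewrite /qside /=; split.
- exact: lt_trans l0 lq.
- exact: sub.
- by apply: H => //; rewrite lq qd.
Qed.

Lemma frac_max_gt_bigcup f c : [set x | c < frac_max gamma f x] =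
  \bigcup_(q in [set q | (0 < qside q)%R /\ c < cube_frac f (qcorner q) (qside q)])
    cube (qcorner q) (qside q).
Proof.
apply/seteqP; split=> [x /frac_max_gt_rat[q [q0 qx cq]]|x [q [q0 cq] qx]] /=.
  by exists q.
exact: lt_le_trans cq (frac_max_ge f q0 qx).
Qed.

Lemma measurable_frac_max f : measurable_fun [set: Rn R n] (frac_max gamma f).
Proof.
apply: (measurability _ (ErealGenOInfty.measurableE R)) => _ [_ [r ->] <-].
rewrite setTI.
rewrite [X in measurable X](_ : _ = [set x | r%:E < frac_max gamma f x]); last first.
  by apply/seteqP; split => x /=; rewrite in_itv/= ?andbT.
rewrite frac_max_gt_bigcup bigcup_mkcond; apply: countable_bigcupT_measurable.
  exact: countableP.
by move=> q; case: ifPn => _ //; exact: measurable_cube.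
Qed.

End fractional_maximal.

(** * Young functions and generalized inverses *)

Section at_ereal.
Context {R : realType}.
Implicit Types (B : R -> \bar R).

Definition ndecr B := forall s t : R, (0 <= s)%R -> (s <= t)%R -> B s <= B t.
Definition nneg B := forall t : R, (0 <= t)%R -> 0 <= B t.

Lemma le_at_ereal B (x y : \bar R) : ndecr B -> 0 <= x -> x <= y -> at_ereal B x <= at_ereal B y.
Proof.
move: x y => [x||] [y||] ndB //= x0; rewrite ?lee_fin ?leey//.
by move=> xy; apply: ndB.
Qed.

Lemma at_ereal_ge0 B (x : \bar R) : nneg B -> 0 <= x -> 0 <= at_ereal B x.
Proof. by move: x => [x||] //= B0 x0; exact: B0. Qed.

Lemma abse_div_ge0 (x : \bar R) (l : R) : (0 < l)%R -> 0 <= `|x| / l%:E.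
Proof. by move=> l0; rewrite mule_ge0// inve_ge0 lee_fin ltW. Qed.

(** Monotonicity makes each superlevel set in the variable [y >= 0] a half-line, closed or open
    according to whether it contains its infimum. The preimage under [h] is then a superlevel set of
    [h]. *)
Lemma measurable_at_ereal d (T : measurableType d) B (h : T -> \bar R) :
  ndecr B -> (forall x, 0 <= h x) -> measurable_fun [set: T] h ->
  measurable_fun [set: T] (fun x => at_ereal B (h x)).
Proof.
move=> ndB h0 mh.
apply: (measurability _ (ErealGenOInfty.measurableE R)) => _ [_ [r ->] <-].
rewrite setTI.
rewrite [X in measurable X](_ : _ = [set x | r%:E < at_ereal B (h x)]); last first.
  by apply/seteqP; split => x /=; rewrite in_itv/= ?andbT.
pose U := [set y | 0 <= y /\ r%:E < at_ereal B y].
have Uup y z : U y -> y <= z -> U z.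
  by move=> [y0 ry] yz; split; [exact: le_trans yz|exact: lt_le_trans ry (le_at_ereal _ _ _)].
have [Ui|Ui] := pselect (U (ereal_inf U)).
  rewrite [X in measurable X](_ : _ = [set x | ereal_inf U <= h x]).
    rewrite -[X in measurable X]setTI; exact: emeasurable_fun_c_infty.
  apply/seteqP; split => x /= hx; last by have [] := Uup _ _ Ui hx.
  exact: ereal_inf_lbound.
rewrite [X in measurable X](_ : _ = [set x | ereal_inf U < h x]).
  exact: measurable_gt.
apply/seteqP; split => x /= hx.
  rewrite lt_neqAle; apply/andP; split; last exact: ereal_inf_lbound.
  by apply/eqP => Uh; apply: Ui; rewrite Uh.
by have [y Uy /ltW yh] := ereal_inf_lt hx; have [] := Uup _ _ Uy yh.
Qed.

End at_ereal.

Section generalized_inverse.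
Context {R : realType}.
Implicit Types (Phi : R -> \bar R) (s t : R).

Lemma ginv_ge0 Phi s : 0 <= ginv Phi s.
Proof. by apply: le_ereal_inf_tmp => _ [t [t0 _] <-]; rewrite lee_fin. Qed.

Lemma ginv_le Phi s t : (0 <= t)%R -> s%:E < Phi t -> ginv Phi s <= t%:E.
Proof. by move=> t0 st; apply: ereal_inf_lbound; exists t. Qed.

Lemma lt_ginv Phi s t : (0 <= t)%R -> t%:E < ginv Phi s -> Phi t <= s%:E.
Proof. by move=> t0; rewrite !leNgt; apply: contraTN => /(ginv_le t0); rewrite -leNgt. Qed.

Lemma ginv_lt Phi s c : ginv Phi s < c ->
  exists t, [/\ (0 <= t)%R, s%:E < Phi t & t%:E < c].
Proof. by move=> /ereal_inf_lt[_ [t [t0 st] <-] tc]; exists t. Qed.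

Lemma le_ginv Phi s t : ndecr Phi -> Phi t <= s%:E -> t%:E <= ginv Phi s.
Proof.
move=> ndP ts; apply: le_ereal_inf_tmp => _ [u [u0 su] <-]; rewrite lee_fin.
rewrite leNgt; apply/negP => ut.
have := lt_le_trans su (le_trans (ndP _ _ u0 (ltW ut)) ts).
by rewrite ltxx.
Qed.

Lemma ginv_nd Phi s t : (s <= t)%R -> ginv Phi s <= ginv Phi t.
Proof.
move=> st; apply: le_ereal_inf_tmp => _ [u [u0 tu] <-].
by apply: ginv_le => //; apply: le_lt_trans tu; rewrite lee_fin.
Qed.

End generalized_inverse.

Section young.
Context {R : realType} (A : R -> \bar R).
Hypothesis yA : young A.

Lemma young0 : A 0%R = 0. Proof. by case: yA. Qed.

Lemma young_nneg : nneg A. Proof. by case: yA. Qed.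

Lemma young_scale l t : (0 <= l <= 1)%R -> (0 <= t)%R -> A (l * t)%R <= l%:E * A t.
Proof.
move=> l01 t0; case: yA => A0 _ cvA _ _.
by have := cvA t 0%R l t0 (lexx _) l01; rewrite mulr0 addr0 A0 mule0 adde0.
Qed.

Lemma young_ndecr : ndecr A.
Proof.
move=> s t s0 st; have [t0|t0] := eqVneq t 0%R.
  by rewrite (_ : s = t)//; apply/eqP; rewrite eq_le st t0.
have tp : (0 < t)%R by rewrite lt_neqAle eq_sym t0 (le_trans s0).
rewrite -[s](divfK t0); apply: le_trans (young_scale _ (ltW tp)) _.
  by rewrite (divr_ge0 s0 (ltW tp))/= ler_pdivrMr// mul1r.
rewrite -[leRHS]mul1e; apply: lee_wpmul2r; first exact: young_nneg (ltW tp).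
by rewrite lee_fin ler_pdivrMr// mul1r.
Qed.

(** Convexity together with [A 0 = 0] makes [A u / u] nondecreasing. The product form also covers
    [A u = +oo]. *)
Lemma young_lin a u tau : (0 < a)%R -> (a <= u)%R -> tau%:E <= A a ->
  (tau * u)%:E <= a%:E * A u.
Proof.
move=> a0 au ta; have u0 := lt_le_trans a0 au.
have un0 : u != 0%R by rewrite gt_eqF.
have : A a <= (a / u)%:E * A u.
  rewrite -[X in A X <= _](divfK un0); apply: young_scale (ltW u0).
  by rewrite (divr_ge0 (ltW a0) (ltW u0))/= ler_pdivrMr// mul1r.
move=> /(le_trans ta).
have := young_nneg (ltW u0); case: (A u) => [v v0|_ _|//].
  rewrite -!EFinM !lee_fin => h.
  have -> : (a * v = (a / u * v) * u)%R by field.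
  by rewrite ler_pM2r.
by rewrite gt0_muley ?lte_fin// ?leey.
Qed.

Lemma young_lin_ereal a (u : \bar R) tau : (0 < a)%R -> a%:E <= u -> tau%:E <= A a ->
  tau%:E * u <= a%:E * at_ereal A u.
Proof.
move=> a0; case: u => [u||] //=.
  by rewrite lee_fin -EFinM; exact: young_lin.
by move=> _ _; rewrite [leRHS]gt0_muley ?lte_fin// leey.
Qed.

Lemma young_pos : exists2 t, (0 < t)%R & 0 < A t.
Proof.
apply: contrapT => H; case: yA => _ _ _ _; apply; exists 0 => t t0.
apply/eqP; rewrite eq_le (young_nneg (ltW t0)) andbT leNgt; apply/negP => At.
by apply: H; exists t.
Qed.

Lemma young_fin : exists2 t, (0 < t)%R & A t < +oo.
Proof.
apply: contrapT => H; case: yA => _ _ _ _; apply; exists +oo => t t0.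
apply/eqP; rewrite eq_le leey leNgt/=; apply/negP => At.
by apply: H; exists t.
Qed.

Lemma young_unbounded (M : R) : exists2 t, (0 < t)%R & M%:E < A t.
Proof.
have [t t0 At0] := young_pos.
have [h|h] := ltP (M%:E) (A t); first by exists t.
have Af : A t \is a fin_num by rewrite ge0_fin_numE ?ltW// (le_lt_trans h)// ltry.
have a0 : (0 < fine (A t))%R by rewrite fine_gt0// At0 /= ltey_eq Af.
pose K := (`|M| / fine (A t) + 1)%R.
have K1 : (1 <= K)%R by rewrite lerDr divr_ge0// ltW.
exists (K * t)%R; first by rewrite mulr_gt0// (lt_le_trans _ K1).
have := @young_lin t (K * t)%R (fine (A t)) t0 (ler_peMl (ltW t0) K1) _.
rewrite fineK// => /(_ (lexx _)).
case: (A (K * t)%R) => [v||]; rewrite ?ltry//; last by rewrite gt0_muleNy ?lte_fin// leeNy_eq.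
rewrite -EFinM lee_fin lte_fin mulrA (mulrC t) ler_pM2r//.
rewrite /K mulrDr mulr1 mulrC divfK ?gt_eqF//.
by have := ler_norm M; lra.
Qed.

Lemma young_small (e : R) : (0 < e)%R -> exists2 t, (0 < t)%R & A t < e%:E.
Proof.
move=> e0; have [t t0 At] := young_fin.
have Af : A t \is a fin_num by rewrite ge0_fin_numE ?(young_nneg (ltW t0)).
have a0 : (0 <= fine (A t))%R by rewrite fine_ge0// (young_nneg (ltW t0)).
pose l := (e / (e + fine (A t) + fine (A t)))%R.
have d0 : (0 < e + fine (A t) + fine (A t))%R by lra.
have l0 : (0 < l)%R by rewrite divr_gt0.
have l1 : (l <= 1)%R by rewrite ler_pdivrMr// mul1r; lra.
exists (l / 2 * t)%R; first by rewrite mulr_gt0// divr_gt0.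
apply: le_lt_trans (young_scale _ (ltW t0)) _; first by lra.
rewrite -(fineK Af) -EFinM lte_fin.
have -> : (l / 2 * fine (A t))%R = (e * fine (A t) / (2 * (e + fine (A t) + fine (A t))))%R.
  by rewrite /l; field; rewrite gt_eqF.
rewrite ltr_pdivrMr ?mulr_gt0// ltr_pM2l//; lra.
Qed.

Lemma young_ginv_fin s : ginv A s \is a fin_num.
Proof.
rewrite ge0_fin_numE ?ginv_ge0//; have [t t0 st] := young_unbounded s.
by apply: le_lt_trans (ginv_le (ltW t0) st) _; rewrite ltry.
Qed.

Definition yinv s := fine (ginv A s).

Lemma yinvE s : ginv A s = (yinv s)%:E.
Proof. by rewrite fineK// young_ginv_fin. Qed.

Lemma yinv_gt0 s : (0 < s)%R -> (0 < yinv s)%R.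
Proof.
move=> s0; have [t t0 ts] := young_small s0.
rewrite -lte_fin -yinvE; apply: lt_le_trans (le_ginv young_ndecr (ltW ts)).
by rewrite lte_fin.
Qed.

Lemma yinv_nd s t : (s <= t)%R -> (yinv s <= yinv t)%R.
Proof. by move=> st; rewrite -lee_fin -!yinvE; exact: ginv_nd. Qed.

(** That is, [A^{-1}(s) / s] is nonincreasing, because [A t <= A (t * k) / k] by convexity. *)
Lemma yinv_scale k s : (1 <= k)%R -> (0 <= s)%R -> (yinv (k * s) <= k * yinv s)%R.
Proof.
move=> k1 s0; have k0 : (0 < k)%R by lra.
rewrite [leRHS]mulrC -ler_pdivrMr// -lee_fin -yinvE.
apply: le_ereal_inf_tmp => _ [t [t0 st] <-]; rewrite lee_fin ler_pdivrMr//.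
rewrite -lee_fin -yinvE; apply: ginv_le; first by rewrite mulr_ge0// ltW.
have tp : (0 < t)%R.
  rewrite lt_neqAle t0 andbT; apply/eqP => t00; move: st; rewrite -t00 young0 lte_fin.
  by rewrite ltNge s0.
have : A t <= k^-1%:E * A (t * k)%R.
  have := @young_scale (k^-1)%R (t * k)%R; rewrite mulrCA mulVf ?gt_eqF// mulr1; apply.
    by rewrite invr_ge0 (ltW k0) invf_le1.
  by rewrite mulr_ge0// ltW.
move=> /(lt_le_trans st).
case: (A (t * k)%R) => [v||]; rewrite ?ltry//.
  by rewrite -EFinM !lte_fin ltr_pdivlMl.
by rewrite gt0_muleNy ?lte_fin ?invr_gt0.
Qed.

End young.

(** * Modular inequalities and level sets of the maximal function *)

Section modular_bound.
Context {R : realType} (n : nat) (gamma : R).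

Lemma divEFin (x : \bar R) (l : R) : (0 < l)%R -> x / l%:E = l^-1%:E * x.
Proof. by move=> l0; rewrite inver gt_eqF// muleC. Qed.

Lemma cube_frac_div (f : Rn R n -> \bar R) (lam : R) a l : (0 < lam)%R ->
  measurable_fun [set: Rn R n] f ->
  cube_frac gamma (fun y => f y / lam%:E) a l = lam^-1%:E * cube_frac gamma f a l.
Proof.
move=> lam0 mf; rewrite /cube_frac muleCA; congr (_ * _).
rewrite -ge0_integralZl; last 4 first.
- exact: measurable_cube.
- by apply: measurableT_comp => //; exact: measurable_funTS.
- by move=> x _; exact: abse_ge0.
- by rewrite lee_fin invr_ge0 ltW.
by apply: eq_integral => x _; rewrite divEFin// abseM gee0_abs// lee_fin invr_ge0 ltW.
Qed.

Lemma frac_max_div (f : Rn R n -> \bar R) (lam : R) x : (0 < lam)%R ->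
  measurable_fun [set: Rn R n] f ->
  frac_max gamma f x / lam%:E <= frac_max gamma (fun y => f y / lam%:E) x.
Proof.
move=> lam0 mf; rewrite divEFin// lee_pdivrMl//.
rewrite leNgt; apply/negP => /frac_max_gt[a [l [l0 ax]]].
have := frac_max_ge gamma (fun y => f y / lam%:E) l0 ax.
by rewrite cube_frac_div// lee_pdivrMl// leNgt => /negP.
Qed.

(** The maximal operator is homogeneous, so boundedness in the Luxemburg norms amounts, up to the
    constant, to this inequality between modulars. The next two lemmas give the two directions. *)
Definition modular_bounded (A B : R -> \bar R) (K : R) :=
  forall f : Rn R n -> \bar R, measurable_fun [set: Rn R n] f ->
    \int[leb R n]_x at_ereal A `|f x| <= 1 ->
    \int[leb R n]_x at_ereal B (frac_max gamma f x / K%:E) <= 1.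

Lemma modular_bounded_frac_max A B K : nneg B -> ndecr B -> (0 < K)%R ->
  modular_bounded A B K -> frac_max_bounded n gamma A B.
Proof.
move=> B0 ndB K0 H; exists K; split => // f [mf _].
rewrite -lee_pdivrMl//; apply: le_ereal_inf_tmp => _ [lam [lam0 Af] <-].
rewrite lee_pdivrMl// -EFinM; apply: ereal_inf_lbound.
exists (K * lam)%R => //; split; first by rewrite mulr_gt0.
pose g y := f y / lam%:E.
have mg : measurable_fun [set: Rn R n] g.
  rewrite (_ : g = fun y => lam^-1%:E * f y).
    exact: measurable_funeM.
  by apply/funext => y; rewrite /g divEFin.
apply: le_trans (H g mg _); last first.
  rewrite (eq_integral (fun x => at_ereal A (`|f x| / lam%:E)))// => x _.
  by rewrite /g !divEFin// abseM gee0_abs// lee_fin invr_ge0 ltW.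
apply: nneg_le_integral => x _.
  by apply: at_ereal_ge0 => //; rewrite abse_div_ge0// mulr_gt0.
apply: le_at_ereal => //; first by rewrite abse_div_ge0// mulr_gt0.
rewrite gee0_abs; last exact: frac_max_ge0.
rewrite divEFin; last exact: mulr_gt0.
rewrite divEFin; last exact: K0.
rewrite invfM EFinM -muleA lee_pmul2l ?lte_fin ?invr_gt0; [|by []|exact: K0].
by rewrite -divEFin; [exact: frac_max_div|exact: lam0].
Qed.

Lemma frac_max_bounded_modular A B : nneg B -> ndecr B ->
  frac_max_bounded n gamma A B ->
  exists2 K, (0 < K)%R & modular_bounded A B K.
Proof.
(* The infimum defining the norm may fail to be attained. The factor 2 puts it strictly below
   [2 * C], so some admissible [lam] lies below [2 * C] as well. *)
move=> B0 ndB [C [C0 H]]; exists (2 * C)%R; first by rewrite mulr_gt0.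
move=> f mf Af.
have A1 : modular A f 1 <= 1.
  rewrite /modular (eq_integral (fun x => at_ereal A `|f x|))// => x _.
  by rewrite divEFin// invr1 mul1e.
have lA : luxemburg A f <= 1 by apply: ereal_inf_lbound; exists 1%R.
have fA : orlicz n A f.
  by split => //; exists 1%R; split => //; apply: le_lt_trans A1 _; rewrite ltry.
have : luxemburg B (frac_max gamma f) < (2 * C)%:E.
  apply: le_lt_trans (H f fA) _; apply: (@le_lt_trans _ _ (C%:E * 1)).
    by rewrite lee_pmul2l.
  by rewrite mule1 lte_fin; lra.
move=> /ereal_inf_lt[_ [lam [lam0 Bl] <-]]; rewrite lte_fin => lC.
apply: le_trans Bl; have C2 : (0 < 2 * C)%R by rewrite mulr_gt0.
apply: nneg_le_integral => x _.
  by apply: at_ereal_ge0 => //; rewrite -[X in X / _]gee0_abs ?frac_max_ge0// abse_div_ge0.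
apply: le_at_ereal => //.
  by rewrite -[X in X / _]gee0_abs ?frac_max_ge0// abse_div_ge0.
rewrite gee0_abs ?frac_max_ge0// !divEFin//.
by apply: lee_wpmul2r; rewrite ?frac_max_ge0// lee_fin lef_pV2 ?posrE// ltW.
Qed.

End modular_bound.

Section level_sets.
Context {R : realType} (n : nat) (gamma : R) (A : R -> \bar R).
Hypothesis gamma_gt0 : (0 < gamma)%R.
Hypothesis gamma_lt : (gamma < n%:R)%R.
Hypothesis yA : young A.
Let al := (gamma / n%:R)%R.

Lemma dim_gt0 : (0 < n%:R :> R)%R. Proof. exact: lt_trans gamma_lt. Qed.

Lemma al_gt0 : (0 < al)%R. Proof. by rewrite divr_gt0// dim_gt0. Qed.

Lemma al_lt1 : (al < 1)%R. Proof. by rewrite ltr_pdivrMr ?dim_gt0// mul1r. Qed.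

(* The supremum of [psi] over ]0, t] is G_{n/gamma}(t). *)
Definition psi (s : R) := (yinv A s * s `^ (- al))%R.

Variable f : Rn R n -> \bar R.
Hypothesis mf : measurable_fun [set: Rn R n] f.
Hypothesis Af : \int[leb R n]_x at_ereal A `|f x| <= 1.

Let mAf : measurable_fun [set: Rn R n] (fun x => at_ereal A `|f x|).
Proof.
apply: measurable_at_ereal; [exact: young_ndecr|by []|].
exact: measurableT_comp.
Qed.

Let Af0 x : 0 <= at_ereal A `|f x|.
Proof. by apply: at_ereal_ge0 => //; exact: young_nneg. Qed.

Lemma integral_cube_cst (a : 'I_n -> R) l (b : R) : (0 <= l)%R ->
  \int[leb R n]_(x in cube a l) b%:E = (b * l ^+ n)%:E.
Proof.
move=> l0; transitivity (b%:E * leb R n (cube a l)); last by rewrite leb_cube.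
by apply: integral_cst; exact: measurable_cube.
Qed.

(* Replaces Jensen's inequality, at the cost of the factor 2: above the height b
   the function is dominated by [l ^+ n * b * A(|f|)]. *)
Lemma integral_cube_le a l (b : R) : (0 < l)%R -> (0 < b)%R ->
  (l ^+ n)^-1%:E <= A b ->
  \int[leb R n]_(x in cube a l) `|f x| <= (2 * (l ^+ n * b))%:E.
Proof.
move=> l0 b0 bA; have v0 : (0 < l ^+ n)%R by rewrite exprn_gt0.
have mc : measurable (cube a l) by exact: measurable_cube.
apply: (@le_trans _ _ (\int[leb R n]_(x in cube a l)
   (b%:E + (l ^+ n * b)%:E * at_ereal A `|f x|))).
  apply: nneg_le_integral => x _ //.
  have [fb|/ltW fb] := leP `|f x| b%:E.
    by apply: le_trans fb _; rewrite leeDl// mule_ge0// lee_fin mulr_ge0 ?ltW.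
  apply: (@le_trans _ _ ((l ^+ n * b)%:E * at_ereal A `|f x|)).
    have := young_lin_ereal yA b0 fb bA.
    by rewrite lee_pdivrMl// EFinM muleA.
  by rewrite leeDr// lee_fin ltW.
rewrite ge0_integralD; last 5 first.
- exact: mc.
- by move=> x _; rewrite lee_fin ltW.
- exact: measurable_cst.
- by move=> x _; rewrite mule_ge0// lee_fin mulr_ge0// ltW.
- by apply: measurable_funeM; exact: measurable_funTS.
rewrite (integral_cube_cst a b (ltW l0)) ge0_integralZl; last 4 first.
- exact: mc.
- exact: measurable_funTS.
- by move=> x _; exact: Af0.
- by rewrite lee_fin mulr_ge0// ltW.
rewrite mulr_natl mulr2n EFinD (mulrC b); apply: leeD => //.
rewrite -[leRHS]mule1; apply: lee_wpmul2l; first by rewrite lee_fin mulr_ge0// ltW.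
by apply: le_trans Af; exact: nneg_le_integral_set.
Qed.

Lemma lt_yinv_le (s a : R) : (yinv A s < a)%R -> s%:E <= A a.
Proof.
rewrite -lte_fin -yinvE// => /ginv_lt[t [t0 st ta]].
apply: ltW; apply: lt_le_trans st _; apply: young_ndecr => //.
by rewrite ltW// -lte_fin.
Qed.

(** With [s = 1/|Q|], any height [b] just above [A^{-1}(s)] satisfies [A b >= s], so the integral
    over [Q] is at most [2 |Q| b]. Multiplying by [|Q|^{al-1}] turns this into [2 b s^{-al}]. *)
Lemma cube_frac_le_psi a l : (0 < l)%R ->
  cube_frac gamma f a l <= (2 * psi (l ^+ n)^-1)%:E.
Proof.
move=> l0; have v0 : (0 < l ^+ n)%R by rewrite exprn_gt0.
apply/lee_addgt0Pr => e e0.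
have s0 : (0 < (l ^+ n)^-1)%R by rewrite invr_gt0.
set s := (l ^+ n)^-1%R in s0 *.
have sv : (l ^+ n = s^-1)%R by rewrite /s invrK.
(* The excess of [b] over [A^{-1}(s)], chosen so that [2 d s^{-al} = e]. *)
pose d := (e / 2 * s `^ al)%R.
have d0 : (0 < d)%R by rewrite mulr_gt0 ?powR_gt0// divr_gt0.
have yd : (yinv A s < yinv A s + d)%R by rewrite ltrDl.
have b0 : (0 < yinv A s + d)%R by rewrite addr_gt0// yinv_gt0.
have := integral_cube_le a l0 b0 (lt_yinv_le yd).
rewrite /cube_frac -/al sv => h.
apply: (@le_trans _ _ (((s^-1) `^ (al - 1))%:E * (2 * (s^-1 * (yinv A s + d)))%:E)).
  by rewrite lee_pmul2l ?lte_fin ?powR_gt0 ?invr_gt0.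
have -> : ((s^-1) `^ (al - 1) = s * s `^ (- al))%R.
  rewrite -powR_inv1 ?ltW// -powRrM mulN1r opprB powRD ?(gt_eqF s0) ?implybT//.
  by rewrite powRr1// ltW.
rewrite -EFinM -EFinD lee_fin /psi /d.
have -> : (s * s `^ (- al) * (2 * (s^-1 * (yinv A s + e / 2 * s `^ al))) =
   2 * (yinv A s * s `^ (- al)) + e * (s `^ (- al) * s `^ al))%R.
  by field; rewrite gt_eqF.
by rewrite powRN mulVf ?mulr1// gt_eqF// powR_gt0.
Qed.

Variables (tau lam : R).
Hypothesis tau0 : (0 < tau)%R.
Hypothesis psi_lt : forall s, (0 < s)%R -> (s <= tau)%R -> (psi s < lam)%R.
Let eta := (tau `^ al * lam)%R.

Lemma psi_gt0 s : (0 < s)%R -> (0 < psi s)%R.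
Proof. by move=> s0; rewrite mulr_gt0 ?powR_gt0// yinv_gt0. Qed.

Lemma lam_gt0 : (0 < lam)%R.
Proof. exact: lt_trans (psi_gt0 tau0) (psi_lt tau0 (lexx _)). Qed.

Lemma eta_gt0 : (0 < eta)%R.
Proof. by rewrite mulr_gt0 ?lam_gt0// powR_gt0. Qed.

(** The inequality [psi tau < lam] reads [A^{-1}(tau) < eta]. *)
Lemma tau_le_A_eta : tau%:E <= A eta.
Proof.
apply: lt_yinv_le; have := psi_lt tau0 (lexx _).
by rewrite /psi powRN ltr_pdivrMr ?powR_gt0// mulrC.
Qed.

(** By [cube_frac_le_psi] a bad cube has volume below [1/tau], which turns the lower bound on its
    fractional mean into an integral above [2 eta |Q|]. The points where [|f| <= eta] contribute at
    most [eta |Q|], so the remaining points carry the rest. *)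
Lemma bad_cube_mean a l : (0 < l)%R -> (2 * lam)%:E < cube_frac gamma f a l ->
  (eta * l ^+ n)%:E <=
  \int[leb R n]_(x in cube a l `&` [set x | eta%:E < `|f x|]) `|f x|.
Proof.
move=> l0; have v0 : (0 < l ^+ n)%R by rewrite exprn_gt0.
move=> bad; have mc : measurable (cube a l) by exact: measurable_cube.
have vtau : (tau < (l ^+ n)^-1)%R.
  rewrite ltNge; apply/negP => h.
  have := lt_le_trans bad (cube_frac_le_psi a l0).
  rewrite lte_fin ltr_pM2l// ltNge => /negP; apply.
  by apply/ltW/psi_lt => //; rewrite invr_gt0.
have mfc : measurable_fun (cube a l) (fun x => `|f x|).
  by apply: measurableT_comp => //; exact: measurable_funTS.
have mS : measurable [set x | eta%:E < `|f x|].
  by apply: measurable_gt; exact: measurableT_comp.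
have I2 : (2 * (eta * l ^+ n))%:E < \int[leb R n]_(x in cube a l) `|f x|.
  move: bad; rewrite /cube_frac -/al.
  set I := \int[_]_(x in _) _ => bad.
  have w0 : (0 < (l ^+ n) `^ (al - 1))%R by rewrite powR_gt0.
  rewrite -(@lte_pmul2l _ ((l ^+ n) `^ (al - 1))%:E)//; apply: le_lt_trans bad.
  rewrite -EFinM lee_fin /eta.
  have -> : ((l ^+ n) `^ (al - 1) * (2 * (tau `^ al * lam * l ^+ n)) =
     2 * lam * ((tau * l ^+ n) `^ al))%R.
    have v1 : ((l ^+ n) `^ (al - 1) = (l ^+ n) `^ al / l ^+ n)%R.
      rewrite powRD ?(gt_eqF v0) ?implybT// powR_inv1//.
      exact: ltW.
    rewrite v1 (powRM _ (ltW tau0) (ltW v0)).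
    by field; rewrite gt_eqF.
  rewrite ger_pMr ?mulr_gt0 ?lam_gt0//.
  have h1 : (tau * l ^+ n <= 1)%R by rewrite -ler_pdivlMr// div1r ltW.
  have h0 : (0 <= tau * l ^+ n)%R by rewrite mulr_ge0// ltW.
  have h2 : (1 `^ al = 1 :> R)%R by rewrite powR1.
  by rewrite -h2; apply: ge0_ler_powR; rewrite ?nnegrE//; exact/ltW/al_gt0.
have : \int[leb R n]_(x in cube a l) `|f x| <= (eta * l ^+ n)%:E +
    \int[leb R n]_(x in cube a l `&` [set x | eta%:E < `|f x|]) `|f x|.
  rewrite [X in _ + X]integral_mkcondr.
  rewrite -(integral_cube_cst a _ (ltW l0)) -ge0_integralD; last 5 first.
  - exact: mc.
  - by move=> x _; rewrite lee_fin ltW// eta_gt0.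
  - exact: measurable_cst.
  - by move=> x _; rewrite /patch; case: ifPn.
  - apply/(measurable_restrict _ mS mc).1; apply: (measurable_funS mc) mfc.
    exact: subIsetl.
  apply: nneg_le_integral => // x _; rewrite /patch.
  case: ifPn; first by rewrite leeDr// lee_fin ltW// eta_gt0.
  by rewrite notin_setE/= => /negP; rewrite -leNgt adde0.
move=> /(lt_le_trans I2); set J := \int[_]_(x in _ `&` _) _.
case: J => [r|_|]; rewrite ?leey// -EFinD ?lte_fin ?lee_fin; lra.
Qed.

Lemma level_set_frac_max :
  leb R n [set x | (2 * lam)%:E < frac_max gamma f x] <=
  (3 ^+ n / eta)%:E * \int[leb R n]_(x in [set x | eta%:E < `|f x|]) `|f x|.
Proof.
rewrite frac_max_gt_bigcup.
have mS : measurable [set x | eta%:E < `|f x|].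
  by apply: measurable_gt; exact: measurableT_comp.
set P := [set q | _].
(* [weak_type_cubes] takes cubes indexed by natural numbers with positive sides. Indices are decoded
   into rational cubes, and the default side 1 keeps [l] positive everywhere without affecting the
   indices in [P]. *)
pose q i := odflt ([ffun=> 0%R], 1%R) (@unpickle ({ffun 'I_n -> rat} * rat)%type i).
pose l i := if (0 < @qside R n (q i))%R then @qside R n (q i) else 1%R.
have l0 i : (0 < l i)%R by rewrite /l; case: ifPn.
have qE i : P (q i) -> l i = @qside R n (q i) by rewrite /l => -[->].
have -> : \bigcup_(q in P) cube (qcorner q) (@qside R n q) =
    \bigcup_(i in [set i | P (q i)]) cube (qcorner (q i)) (l i).
  apply/seteqP; split=> [x [k Pk xk]|x [i Pi xi]].
    have qk : q (pickle k) = k by rewrite /q pickleK.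
    by exists (pickle k); rewrite /= ?qE ?qk.
  by exists (q i) => //; rewrite -qE.
pose g := (fun x => `|f x|) \_ [set x | eta%:E < `|f x|].
rewrite integral_mkcond -/g.
apply: weak_type_cubes; [exact: l0|exact: eta_gt0|..].
- by move=> x; rewrite /g /patch; case: ifPn.
- by apply/(measurable_restrictT _ mS).1; apply: measurable_funTS; apply: measurableT_comp.
- move=> i Pi; rewrite /g -integral_mkcondr; apply: bad_cube_mean => //.
  by rewrite qE//; case: Pi.
Qed.

Lemma abs_level_le x : eta%:E < `|f x| -> `|f x| <= (eta / tau)%:E * at_ereal A `|f x|.
Proof.
move=> /ltW h; have := young_lin_ereal yA eta_gt0 h tau_le_A_eta.
by rewrite -lee_pdivlMl// muleA -EFinM mulrC.
Qed.

(** Where [|f| > eta], convexity and [A eta >= tau] give [|f| <= (eta / tau) A(|f|)], whose integral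
    is at most [eta / tau]. *)
Lemma weak_frac_max :
  leb R n [set x | (2 * lam)%:E < frac_max gamma f x] <= (3 ^+ n / tau)%:E.
Proof.
apply: le_trans level_set_frac_max _.
have -> : (3 ^+ n / tau = (3 ^+ n / eta) * (eta / tau))%R.
  by field; rewrite !gt_eqF// eta_gt0.
rewrite [leRHS]EFinM lee_pmul2l ?lte_fin ?divr_gt0 ?exprn_gt0 ?eta_gt0//.
rewrite -[leRHS]mule1; apply: (@le_trans _ _ (\int[leb R n]_x ((eta / tau)%:E * at_ereal A `|f x|))).
  rewrite integral_mkcond; apply: nneg_le_integral => x _; rewrite /patch.
    by case: ifPn.
  case: ifPn => [/set_mem/abs_level_le//|_].
  by rewrite mule_ge0// lee_fin divr_ge0// ltW// eta_gt0.
have et : (0 <= (eta / tau)%:E) by rewrite lee_fin divr_ge0// ltW// eta_gt0.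
rewrite ge0_integralZl; last 4 first.
- exact: measurableT.
- exact: mAf.
- by move=> x _; exact: Af0.
- exact: et.
by apply: lee_wpmul2l; [exact: et|exact: Af].
Qed.

End level_sets.

(** * The Sobolev conjugate *)

Lemma integral_itv_oo_cst {R : realType} (a b : R) (c : \bar R) : (a < b)%R ->
  \int[@lebesgue_measure R]_(s in `]a, b[) c = c * (b - a)%:E.
Proof.
move=> ab; transitivity (c * @lebesgue_measure R `]a, b[).
  exact: integral_cst.
by rewrite lebesgue_measure_itv/= lte_fin ab.
Qed.

Section sobolev_conjugate.
Context {R : realType} (n : nat) (gamma : R) (A : R -> \bar R).
Hypothesis gamma_gt0 : (0 < gamma)%R.
Hypothesis gamma_lt : (gamma < n%:R)%R.
Hypothesis yA : young A.
Let al := (gamma / n%:R)%R.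
Let al0 : (0 < al)%R := al_gt0 gamma_gt0 gamma_lt.
Let al1 : (al < 1)%R := al_lt1 gamma_gt0 gamma_lt.
Local Notation psi := (psi n gamma A).

Lemma growth_lower_bound : growth_cond n gamma A ->
  exists2 c : R, (0 < c)%R &
    forall t, (0 < t < 1)%R -> (c * t `^ al^-1)%:E <= A t.
Proof.
rewrite /growth_cond; set S := [set _ | _ in _] => infS.
(* The infimum is [+oo] when [A] is infinite on []0, 1[]; any constant then serves. *)
have [c c0 cS] : exists2 c : R, (0 < c)%R & c%:E <= ereal_inf S.
  move: infS; case: (ereal_inf S) => [r r0|_|//]; first by exists r.
  by exists 1%R; rewrite ?leey.
exists c => // t t01; have t0 : (0 < t)%R by case/andP: t01.
have : c%:E <= A t * (t `^ (- (n%:R / gamma)))%:E.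
  apply: le_trans cS _; apply: ereal_inf_lbound; by exists t.
have -> : (n%:R / gamma = al^-1)%R by rewrite /al invf_div.
by rewrite powRN muleC lee_pdivlMl ?powR_gt0// -EFinM mulrC.
Qed.

Hypothesis growth : growth_cond n gamma A.

(** For small [s] the growth condition gives [A^{-1}(s) <= 2 (s/c)^{al}], hence
    [psi s <= 2 c^{-al}]. For the other [s] the factor [s^{-al}] is at most [2 c^{-al}], and
    [A^{-1}(s) <= A^{-1}(tau)]. *)
Lemma psi_bounded (tau : R) : exists M, forall s, (0 < s)%R -> (s <= tau)%R -> (psi s <= M)%R.
Proof.
have [c c0 cA] := growth_lower_bound growth.
exists (2 * c `^ (- al) * (1 + yinv A tau))%R => s s0 stau.
have y0 : (0 < yinv A tau)%R by rewrite yinv_gt0// (lt_le_trans s0).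
have cp (x : R) : (0 < c `^ x)%R by rewrite powR_gt0.
have sp (x : R) : (0 < s `^ x)%R by rewrite powR_gt0.
(* Twice the solution of [c t^{1/al} = s]. The factor 2 yields the strict inequality [A t > s] that
   bounds the generalized inverse. *)
pose t := (2 * (c `^ (- al) * s `^ al))%R.
have t0 : (0 < t)%R by rewrite !mulr_gt0.
have ss : (s `^ al * s `^ (- al) = 1)%R by rewrite powRN mulfV// gt_eqF.
have [t1|t1] := ltP t 1%R.
  have yt : (yinv A s <= t)%R.
    rewrite -lee_fin -yinvE//; apply: ginv_le; first exact: ltW.
    apply: lt_le_trans (cA t _); last by rewrite t0.
    have -> : (t `^ al^-1 = 2 `^ al^-1 * (c^-1 * s))%R.
      rewrite /t powRM// ?mulr_ge0 ?powR_ge0// powRM ?powR_ge0// -!powRrM.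
      by rewrite mulNr divff ?gt_eqF// powRN !powRr1// ltW.
    have -> : (c * (2 `^ al^-1 * (c^-1 * s)) = 2 `^ al^-1 * s)%R.
      by field; rewrite gt_eqF.
    rewrite lte_fin.
    rewrite -[ltLHS]mul1r ltr_pM2r//.
    apply: (@lt_le_trans _ _ 2%R); first by rewrite ltr1n.
    by rewrite le1r_powR ?ler1n// ltW// invf_gt1.
  apply: (@le_trans _ _ (2 * c `^ (- al))%R).
    rewrite /psi -/al; apply: (@le_trans _ _ (t * s `^ (- al))%R).
      by rewrite ler_pM2r.
    by rewrite /t -mulrA -(mulrA (c `^ _)%R) ss mulr1.
  by rewrite ler_peMr ?mulr_ge0 ?powR_ge0//; lra.
rewrite /psi -/al.
have h : (s `^ (- al) <= 2 * c `^ (- al))%R.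
  rewrite -[leLHS]mul1r; apply: (@le_trans _ _ (t * s `^ (- al))%R).
    by rewrite ler_pM2r.
  by rewrite /t -mulrA -(mulrA (c `^ _)%R) ss mulr1.
rewrite mulrC; apply: ler_pM => //; first exact: ltW.
  exact/ltW/yinv_gt0.
by have := yinv_nd yA stau; lra.
Qed.

(* The real value of G_{n/gamma}, which is finite under the growth condition;
   [Gi] below is its generalized inverse. *)
Definition Gr (t : R) := fine (sobolev_G n gamma A t).

Lemma sobolev_G_sup t : (0 < t)%R ->
  sobolev_G n gamma A t = ereal_sup [set (psi s)%:E | s in `]0%R, t]].
Proof.
move=> t0; rewrite /sobolev_G leNgt t0/=; congr ereal_sup.
by apply: eq_imagel => s _; rewrite yinvE// -EFinM.
Qed.

Lemma sobolev_GE t : (0 < t)%R -> sobolev_G n gamma A t = (Gr t)%:E.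
Proof.
move=> t0; rewrite /Gr fineK// sobolev_G_sup//.
have [M HM] := psi_bounded t.
rewrite fin_numE; apply/andP; split.
  rewrite gt_eqF//; apply: (@lt_le_trans _ _ (psi t)%:E); first exact: ltNyr.
  by apply: ereal_sup_ubound; exists t; rewrite //= in_itv/= t0 lexx.
rewrite lt_eqF//; apply: (@le_lt_trans _ _ M%:E); last exact: ltry.
apply: ge_ereal_sup => y [s /=]; rewrite in_itv/= => /andP[s0 st] <-.
by rewrite lee_fin; exact: HM.
Qed.

Lemma psi_le_G s t : (0 < s)%R -> (s <= t)%R -> (psi s <= Gr t)%R.
Proof.
move=> s0 st; have t0 := lt_le_trans s0 st.
rewrite -lee_fin -sobolev_GE// sobolev_G_sup//.
by apply: ereal_sup_ubound; exists s; rewrite //= in_itv/= s0.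
Qed.

Lemma G_gt x t : (0 < t)%R -> (x < Gr t)%R ->
  exists s, [/\ (0 < s)%R, (s <= t)%R & (x < psi s)%R].
Proof.
move=> t0; rewrite -lte_fin -sobolev_GE// sobolev_G_sup//.
move=> /ereal_sup_gt[y [s /=]]; rewrite in_itv/= => /andP[s0 st] <-.
by rewrite lte_fin; exists s.
Qed.

Lemma G_le M t : (0 < t)%R -> (forall s, (0 < s)%R -> (s <= t)%R -> (psi s <= M)%R) ->
  (Gr t <= M)%R.
Proof.
by move=> t0 H; rewrite leNgt; apply/negP => /(G_gt t0)[s [s0 /(H _ s0)]]; rewrite leNgt => /negP.
Qed.

Lemma G_gt0 t : (0 < t)%R -> (0 < Gr t)%R.
Proof. by move=> t0; apply: lt_le_trans (psi_le_G t0 (lexx _)); exact: psi_gt0. Qed.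

Lemma G_nd s t : (0 < s)%R -> (s <= t)%R -> (Gr s <= Gr t)%R.
Proof.
by move=> s0 st; apply: G_le => // r r0 rs; apply: psi_le_G => //; exact: le_trans st.
Qed.

Lemma G_scale k t : (1 <= k)%R -> (0 < t)%R -> (Gr (k * t) <= k `^ (1 - al) * Gr t)%R.
Proof.
move=> k1 t0; have k0 : (0 < k)%R by lra.
apply: G_le => [|s s0 st]; first by rewrite mulr_gt0.
have sk0 : (0 < s / k)%R by rewrite divr_gt0.
have skt : (s / k <= t)%R by rewrite ler_pdivrMr// mulrC.
apply: le_trans (_ : k `^ (1 - al) * psi (s / k) <= _)%R; last first.
  by rewrite ler_pM2l ?powR_gt0//; exact: psi_le_G.
rewrite /psi -/al.
have sE : (s = k * (s / k))%R by field; rewrite gt_eqF.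
have -> : (k `^ (1 - al) * (yinv A (s / k) * (s / k) `^ (- al)) =
    (k * yinv A (s / k)) * s `^ (- al))%R.
  rewrite [X in (_ = _ * X `^ _)%R]sE (powRM _ (ltW k0) (ltW sk0)).
  rewrite powRD ?(gt_eqF k0) ?implybT// powRr1 ?ltW//.
  ring.
rewrite ler_pM2r ?powR_gt0//.
have := yinv_scale yA k1 (ltW sk0).
by rewrite mulrCA mulfV ?gt_eqF// mulr1.
Qed.

Lemma sobolev_G_ndecr : ndecr (sobolev_G n gamma A).
Proof.
move=> s t s0 st; have [s0'|s0'] := ltP 0%R s.
  by rewrite !sobolev_GE ?(lt_le_trans s0')// lee_fin G_nd.
rewrite {1}/sobolev_G s0'; have [t0|t0] := ltP 0%R t.
  by rewrite sobolev_GE// lee_fin ltW// G_gt0.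
by rewrite /sobolev_G t0.
Qed.

Definition Gi s := ginv (sobolev_G n gamma A) s.

Lemma Gi_ge0 s : 0 <= Gi s. Proof. exact: ginv_ge0. Qed.

Lemma Gi_nd s t : (s <= t)%R -> Gi s <= Gi t. Proof. exact: ginv_nd. Qed.

Lemma Gi_le s t : (0 < t)%R -> (s < Gr t)%R -> Gi s <= t%:E.
Proof. by move=> t0 st; apply: ginv_le; rewrite ?ltW// sobolev_GE// lte_fin. Qed.

Lemma le_Gi s t : (0 < t)%R -> (Gr t <= s)%R -> t%:E <= Gi s.
Proof.
by move=> t0 st; apply: le_ginv; [exact: sobolev_G_ndecr|rewrite sobolev_GE// lee_fin].
Qed.

Lemma lt_Gi s t : (0 < t)%R -> t%:E < Gi s -> (Gr t <= s)%R.
Proof.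
by move=> t0 st; rewrite -lee_fin -sobolev_GE//; apply: lt_ginv => //; exact: ltW.
Qed.

Definition beta : R := (1 - al)^-1.

Lemma al1_gt0 : (0 < 1 - al)%R. Proof. by rewrite subr_gt0. Qed.

Lemma beta_gt1 : (1 < beta)%R.
Proof. by rewrite /beta invf_gt1 ?al1_gt0// gtrBl. Qed.

Lemma beta_gt0 : (0 < beta)%R. Proof. by rewrite invr_gt0 al1_gt0. Qed.

(** The inverse form of [G_scale]: dividing the argument of [G] by [k^beta] divides its value by at
    most [k]. Since [beta > 1], it also shows that [Gi s / s] is nondecreasing. *)
Lemma Gi_scale k s : (1 <= k)%R -> (0 < s)%R -> (k `^ beta)%:E * Gi s <= Gi (k * s).
Proof.
move=> k1 s0; have k0 : (0 < k)%R by lra.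
have K0 : (0 < k `^ beta)%R by rewrite powR_gt0.
apply: le_ereal_inf_tmp => _ [u [u0 su] <-].
have up : (0 < u)%R.
  rewrite ltNge; apply/negP => u0'; move: su; rewrite /sobolev_G u0' lte_fin.
  by rewrite ltNge mulr_ge0// ltW.
rewrite -lee_pdivlMl// -EFinM; apply: Gi_le; first by rewrite mulr_gt0 ?invr_gt0.
move: su; rewrite sobolev_GE// lte_fin => su.
have := @G_scale (k `^ beta)%R ((k `^ beta)^-1 * u)%R _ _.
rewrite mulrA mulfV ?gt_eqF// mul1r -powRrM /beta mulVf ?gt_eqF ?al1_gt0//.
rewrite (powRr1 (ltW k0)) => h; rewrite -(ltr_pM2l k0); apply: lt_le_trans su (h _ _).
  by rewrite -[leLHS](powRr0 k) ler_powR// ltW// invr_gt0 al1_gt0.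
by rewrite mulr_gt0 ?invr_gt0.
Qed.

Lemma Gi_scale1 k s : (1 <= k)%R -> (0 < s)%R -> k%:E * Gi s <= Gi (k * s).
Proof.
move=> k1 s0; apply: le_trans (Gi_scale k1 s0).
apply: lee_wpmul2r; first exact: Gi_ge0.
rewrite lee_fin -[leLHS]powRr1 ?(le_trans ler01)//.
by rewrite ler_powR// ltW// beta_gt1.
Qed.

Let An := sobolev_young n gamma A.

Lemma An_integrand_ge0 s : (0 < s)%R -> 0 <= Gi s / s%:E.
Proof. by move=> s0; rewrite mule_ge0 ?Gi_ge0// inve_ge0 lee_fin ltW. Qed.

Lemma An_nneg : nneg An.
Proof.
move=> t _; apply: integral_ge0 => s /=; rewrite in_itv/= => /andP[s0 _].
exact: An_integrand_ge0.
Qed.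

Lemma An_le0 t : (t <= 0)%R -> An t = 0.
Proof. by move=> t0; rewrite /An /sobolev_young set_itv_ge ?integral_set0// bnd_simp -leNgt. Qed.

(** On []0, t[] the integrand [Gi s / s] is at most [Gi t / t], and the interval has length [t]. *)
Lemma An_le_Gi t : (0 < t)%R -> An t <= Gi t.
Proof.
move=> t0; apply: (@le_trans _ _ (\int[@lebesgue_measure R]_(s in `]0%R, t[) (t^-1%:E * Gi t))).
  apply: nneg_le_integral => s /=; rewrite in_itv/= => /andP[s0 st].
    exact: An_integrand_ge0.
  rewrite divEFin// lee_pdivrMl// muleA -EFinM.
  rewrite -lee_pdivrMl ?divr_gt0// invf_div.
  have := @Gi_scale1 (t / s)%R s _ s0; rewrite divfK ?gt_eqF//; apply.
  by rewrite ler_pdivlMr// mul1r ltW.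
rewrite integral_itv_oo_cst// subr0.
by rewrite muleAC -EFinM mulVf ?gt_eqF// mul1e.
Qed.

(** On []t, 2 t[] alone, an interval of length [t], the integrand is at least [Gi t / t]. *)
Lemma Gi_le_An t : (0 < t)%R -> Gi t <= An (2 * t).
Proof.
move=> t0; apply: (@le_trans _ _ (\int[@lebesgue_measure R]_(s in `]t, (2 * t)%R[) (t^-1%:E * Gi t))).
  rewrite integral_itv_oo_cst ?ltr_pMl// ?ltr1n//.
  have -> : (2 * t - t = t)%R by ring.
  by rewrite muleAC -EFinM mulVf ?gt_eqF// mul1e.
apply: (@le_trans _ _ (\int[@lebesgue_measure R]_(s in `]t, (2 * t)%R[) (Gi s / s%:E))).
  apply: nneg_le_integral => s /=; rewrite in_itv/= => /andP[ts _].
    by rewrite mule_ge0 ?Gi_ge0// lee_fin invr_ge0 ltW.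
  have s0 := lt_trans t0 ts.
  rewrite divEFin// lee_pdivrMl// muleA -EFinM.
  rewrite -lee_pdivrMl ?divr_gt0// invf_div.
  have := @Gi_scale1 (s / t)%R t _ t0; rewrite divfK ?gt_eqF//; apply.
  by rewrite ler_pdivlMr// mul1r ltW.
rewrite [leLHS]integral_mkcond [leRHS]integral_mkcond; apply: nneg_le_integral => s _.
  rewrite /patch; case: ifPn => // /set_mem/=; rewrite in_itv/= => /andP[ts _].
  by apply: An_integrand_ge0; exact: lt_trans ts.
rewrite /patch; case: ifPn => [/set_mem/=|_].
  rewrite in_itv/= => /andP[ts st]; rewrite mem_set//= in_itv/= st.
  by rewrite (lt_trans t0 ts).
case: ifPn => // /set_mem/=; rewrite in_itv/= => /andP[s0 _].
exact: An_integrand_ge0.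
Qed.

Lemma An_ndecr : ndecr An.
Proof.
move=> s t s0 st; rewrite /An /sobolev_young.
rewrite [leLHS]integral_mkcond [leRHS]integral_mkcond; apply: nneg_le_integral => x _.
  rewrite /patch; case: ifPn => // /set_mem/=; rewrite in_itv/= => /andP[xs _].
  exact: An_integrand_ge0.
rewrite /patch; case: ifPn => [/set_mem/=|_].
  rewrite in_itv/= => /andP[x0 xs]; rewrite mem_set//= in_itv/= x0.
  by rewrite (lt_le_trans xs st).
case: ifPn => // /set_mem/=; rewrite in_itv/= => /andP[x0 _].
exact: An_integrand_ge0.
Qed.

Lemma G_le_ginv_An t : (0 < t)%R -> (Gr t)%:E <= ginv An t.
Proof.
move=> t0; apply: le_ereal_inf_tmp => _ [u [u0 tu] <-]; rewrite lee_fin.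
have up : (0 < u)%R.
  rewrite ltNge; apply/negP => u0'; move: tu; rewrite An_le0// lte_fin.
  by rewrite ltNge ltW.
rewrite leNgt; apply/negP => uG.
have := lt_le_trans tu (le_trans (An_le_Gi up) (Gi_le t0 uG)).
by rewrite ltxx.
Qed.

(** At the point [2 G(2 t)] the conjugate is at least [Gi (G(2 t)) >= 2 t > t]. One factor 2 of the
    constant comes from this point, the other from [G(2 t) <= 2^{1-al} G(t) <= 2 G(t)]. *)
Lemma ginv_An_le_G t : (0 < t)%R -> ginv An t <= (4 * Gr t)%:E.
Proof.
move=> t0; have t20 : (0 < 2 * t)%R by rewrite mulr_gt0.
apply: (@le_trans _ _ (2 * Gr (2 * t))%:E).
  apply: ginv_le; first by rewrite mulr_ge0// ltW// G_gt0.
  apply: lt_le_trans (Gi_le_An (G_gt0 t20)); apply: lt_le_trans (le_Gi t20 (lexx _)).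
  by rewrite lte_fin; lra.
have h1 : (Gr (2 * t) <= 2 `^ (1 - al) * Gr t)%R by apply: G_scale => //; rewrite ler1n.
have h2 : (2 `^ (1 - al) <= 2 :> R)%R.
  by rewrite ler1_powR// ?ler1n// gerBl ltW.
have h3 : (2 `^ (1 - al) * Gr t <= 2 * Gr t)%R by rewrite ler_pM2r ?G_gt0.
by rewrite lee_fin; have g0 := G_gt0 t0; lra.
Qed.

End sobolev_conjugate.

(** * Necessary conditions on a target *)

Section cube_tests.
Context {R : realType} (n : nat).
Hypothesis n0 : (0 < n)%N.

Definition side (v : R) : R := v `^ n%:R^-1.

Lemma side_gt0 v : (0 < v)%R -> (0 < side v)%R.
Proof. exact: powR_gt0. Qed.

Lemma sideX v : (0 < v)%R -> (side v ^+ n)%R = v.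
Proof.
move=> v0; rewrite -powR_mulrn ?powR_ge0// -powRrM mulVf ?powRr1 ?ltW//.
by rewrite pnatr_eq0 -lt0n.
Qed.

Lemma side_le u v : (0 < u)%R -> (u <= v)%R -> (side u <= side v)%R.
Proof.
by move=> u0 uv; apply: ge0_ler_powR; rewrite ?nnegrE ?invr_ge0// ltW// (lt_le_trans u0).
Qed.

Definition vcube (v : R) : set (Rn R n) := cube (fun=> 0%R) (side v).

Lemma measurable_vcube v : measurable (vcube v).
Proof. exact: measurable_cube. Qed.

Lemma leb_vcube v : (0 < v)%R -> leb R n (vcube v) = v%:E.
Proof. by move=> v0; rewrite leb_cube ?sideX// ltW// side_gt0. Qed.

Lemma vcube_sub u v : (0 < u)%R -> (u <= v)%R -> vcube u `<=` vcube v.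
Proof.
move=> u0 uv x xu i; have /andP[-> h] := xu i.
by apply: le_trans h _; rewrite lerD2l side_le.
Qed.

Lemma leb_vcubeD u v : (0 < u)%R -> (u <= v)%R ->
  leb R n (vcube v `\` vcube u) = (v - u)%:E.
Proof.
move=> u0 uv; have v0 := lt_le_trans u0 uv.
transitivity (leb R n (vcube v) - leb R n (vcube v `&` vcube u)).
  apply: measureD; [exact: measurable_vcube|exact: measurable_vcube|].
  by rewrite [X in X < _](leb_vcube v0) ltry.
by rewrite (setIidr (vcube_sub u0 uv)) !leb_vcube.
Qed.

Lemma integral_leb_cst (D : set (Rn R n)) (c : \bar R) : measurable D ->
  \int[leb R n]_(x in D) c = c * leb R n D.
Proof. by move=> mD; exact: integral_cst. Qed.

End cube_tests.

Section necessity.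
Context {R : realType} (n : nat) (gamma : R) (A B : R -> \bar R) (K : R).
Hypothesis gamma_gt0 : (0 < gamma)%R.
Hypothesis gamma_lt : (gamma < n%:R)%R.
Hypothesis yA : young A.
Hypothesis yB : young B.
Hypothesis K0 : (0 < K)%R.
Hypothesis bddAB : modular_bounded n gamma A B K.
Let al := (gamma / n%:R)%R.
Let r : R := (2 `^ (al - 1))%R.

Lemma n_gt0 : (0 < n)%N.
Proof. by rewrite -(ltr0n R); exact: lt_trans gamma_lt. Qed.

(* Tests the indicator of a cube of volume 1/s: on the cube of volume 2^j/s with
   the same corner, half of which lies outside the previous one, the maximal
   function is at least [r ^+ j * (a * s `^ (- al))]. *)
Lemma test_cube_sum (a s : R) N : (0 < a)%R -> (0 < s)%R -> A a <= s%:E ->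
  \sum_(0 <= j < N) (2 ^+ j)%:E * B (r ^+ j * (a * s `^ (- al)) / K)%R <= (2 * s)%:E.
Proof.
move=> a0 s0 As.
pose Q j := @vcube R n (2 ^+ j / s).
have v0 j : (0 < 2 ^+ j / s)%R by rewrite divr_gt0// exprn_gt0.
have leQ j : leb R n (Q j) = (2 ^+ j / s)%:E by apply: leb_vcube => //; exact: n_gt0.
have mQ j : measurable (Q j) by exact: measurable_vcube.
have QS j : Q j `<=` Q j.+1.
  apply: vcube_sub => //; rewrite ler_pM2r ?invr_gt0//.
  by rewrite exprS ler_peMl ?exprn_ge0// ler1n.
have Q0 j : Q 0%N `<=` Q j by elim: j => // j IH; exact: subset_trans (QS j).
pose f : Rn R n -> \bar R := (cst a%:E) \_ (Q 0%N).
have mf : measurable_fun [set: Rn R n] f by apply/(measurable_restrictT _ (mQ 0%N)).1.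
have fE x : `|f x| = f x.
  by rewrite gee0_abs// /f /patch; case: ifPn => // _; rewrite lee_fin ltW.
have Af : \int[leb R n]_x at_ereal A `|f x| <= 1.
  have -> : \int[leb R n]_x at_ereal A `|f x| = \int[leb R n]_(x in Q 0%N) A a.
    rewrite [RHS]integral_mkcond; apply: eq_integral => x _.
    by rewrite fE /f /patch; case: ifPn => //= _; rewrite young0.
  rewrite integral_leb_cst// leQ expr0 div1r.
  by rewrite muleC lee_pdivrMl// mule1.
have bdd := bddAB mf Af.
pose y j := (r ^+ j * (a * s `^ (- al)))%R.
pose F x := at_ereal B (frac_max gamma f x / K%:E).
have Mge j x : Q j x -> (y j)%:E <= frac_max gamma f x.
  move=> Qx; apply: le_trans (frac_max_ge gamma f (@side_gt0 R n _ (v0 j)) Qx).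
  rewrite /cube_frac sideX ?n_gt0// -/al.
  have -> : y j = ((2 ^+ j / s) `^ (al - 1) * (a / s))%R.
    have h1 : (r ^+ j = (2 ^+ j) `^ (al - 1))%R.
      by rewrite /r -(powR_mulrn j (powR_ge0 _ _)) powRAC powR_mulrn.
    have h2 : ((s^-1) `^ (al - 1) = s * s `^ (- al))%R.
      rewrite -powR_inv1 ?ltW// -powRrM mulN1r opprB powRD ?(gt_eqF s0) ?implybT//.
      by rewrite powRr1// ltW.
    rewrite /y h1 powRM ?exprn_ge0 ?invr_ge0 ?(ltW s0)// h2.
    by field; rewrite gt_eqF.
  rewrite EFinM lee_pmul2l ?lte_fin ?powR_gt0//.
  apply: le_trans (nneg_le_integral_set _ (fun x => abse_ge0 (f x)) (Q0 j)).
  have -> : \int[leb R n]_(x in Q 0%N) `|f x| = \int[leb R n]_(x in Q 0%N) a%:E.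
    by apply: eq_integral => z zQ; rewrite fE /f /patch zQ.
  by rewrite integral_leb_cst// leQ expr0 div1r.
have y0 j : (0 < y j)%R by rewrite /y !mulr_gt0 ?exprn_gt0 ?powR_gt0.
have F0 x : 0 <= F x.
  by apply: at_ereal_ge0; [exact: young_nneg|rewrite mule_ge0 ?frac_max_ge0// inve_ge0 lee_fin ltW].
have Fge j x : Q j x -> B (y j / K)%R <= F x.
  move=> /Mge yx; rewrite /F -[B _]/(at_ereal B (y j / K)%:E); apply: le_at_ereal.
  - exact: young_ndecr.
  - by rewrite lee_fin divr_ge0// ltW.
  - by rewrite divEFin// mulrC EFinM lee_pmul2l ?lte_fin ?invr_gt0.
have mF : measurable_fun [set: Rn R n] F.
  apply: measurable_at_ereal; first exact: young_ndecr.
    by move=> x; rewrite mule_ge0 ?frac_max_ge0// inve_ge0 lee_fin ltW.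
  rewrite (_ : (fun x => _) = (fun x => (K^-1)%:E * frac_max gamma f x)).
    by apply: measurable_funeM; exact: measurable_frac_max.
  by apply/funext => x; rewrite divEFin.
pose J j := \int[leb R n]_(x in Q j) F x.
have B0 j : 0 <= B (y j / K)%R by apply: (young_nneg yB); rewrite divr_ge0// ltW.
(* The integral grows from [J j] to [J j.+1] by its part over the shell between the two cubes. That
   shell has volume [2 ^+ j / s], half the volume of [Q j.+1], which explains the factor 2 in
   [2 * s] and accounts for the term of index [j.+1]. *)
have key j : \sum_(0 <= i < j.+1) (2 ^+ i)%:E * B (y i / K)%R <= (2 * s)%:E * J j.
  elim: j => [|j IH].
    rewrite big_nat1 expr0 mul1e.
    apply: (@le_trans _ _ (s%:E * J 0%N)).
      rewrite -lee_pdivrMl//; apply: (@le_trans _ _ (\int[leb R n]_(x in Q 0%N) B (y 0%N / K)%R)).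
        by rewrite integral_leb_cst// leQ expr0 div1r muleC.
      by apply: nneg_le_integral => // x; exact: Fge.
    apply: lee_wpmul2r; first exact: integral_ge0.
    by rewrite lee_fin; lra.
  rewrite big_nat_recr; last by []. set S := \sum_(0 <= i < j.+1) _ in IH *.
  have -> : J j.+1 = J j + \int[leb R n]_(x in Q j.+1 `\` Q j) F x.
    rewrite /J -{1}(setDUK (QS j)) ge0_integral_setU//.
    - exact: measurableD.
    - by rewrite setDUK//; apply: measurable_funTS.
    - by rewrite disj_set2E setDIK.
  rewrite ge0_muleDr//; last 2 first.
  - by apply: integral_ge0.
  - by apply: integral_ge0.
  apply: leeD => //.
  apply: (@le_trans _ _ ((2 * s)%:E * \int[leb R n]_(x in Q j.+1 `\` Q j) B (y j.+1 / K)%R)).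
    rewrite integral_leb_cst; last exact: measurableD.
    rewrite leb_vcubeD ?n_gt0//; last first.
      rewrite ler_pM2r ?invr_gt0// exprS ler_peMl ?exprn_ge0// ler1n//.
    rewrite muleCA muleC -EFinM.
    have -> : (2 * s * (2 ^+ j.+1 / s - 2 ^+ j / s) = 2 ^+ j.+1)%R.
      by rewrite exprS; field; rewrite gt_eqF.
    by [].
  rewrite lee_pmul2l ?lte_fin ?mulr_gt0//; apply: nneg_le_integral => // x [Qx _].
  exact: Fge.
case: N => [|N]; first by rewrite big_geq// lee_fin mulr_ge0// ltW.
apply: le_trans (key N) _; rewrite -[leRHS]mule1; apply: lee_wpmul2l.
  by rewrite lee_fin mulr_ge0// ltW.
by apply: le_trans bdd; exact: nneg_le_integral_set.
Qed.

(** If the conjugate supremum at [u] exceeds [x], some [s <= u] has [psi s > x]. The height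
    [x s^{al}] is then below [A^{-1}(s)], so it is admissible on a cube of volume [1/s], and
    [test_cube_sum] bounds the sum by [2 s <= 2 u]. The infimum over [u] is the claim. *)
Lemma necessity_sum (growth : growth_cond n gamma A) (x : R) N : (0 < x)%R ->
  \sum_(0 <= j < N) (2 ^+ j)%:E * B (r ^+ j * x / K)%R <= 2%:E * Gi n gamma A x.
Proof.
move=> x0; rewrite -lee_pdivrMl//; apply: le_ereal_inf_tmp => _ [u [u0 xu] <-].
have up : (0 < u)%R.
  rewrite ltNge; apply/negP => u0'; move: xu; rewrite /sobolev_G u0' lte_fin.
  by rewrite ltNge ltW.
move: xu; rewrite sobolev_GE// lte_fin => /(G_gt gamma_gt0 gamma_lt yA growth up)[s [s0 su xs]].
have a0 : (0 < x * s `^ al)%R by rewrite mulr_gt0// powR_gt0.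
have Aa : A (x * s `^ al)%R <= s%:E.
  apply: lt_ginv; first exact: ltW.
  rewrite yinvE// lte_fin; move: xs; rewrite /psi -/al powRN.
  by rewrite ltr_pdivlMr// powR_gt0.
have := test_cube_sum N a0 s0 Aa.
have -> : (x * s `^ al * s `^ (- al) = x)%R.
  by rewrite powRN mulfK// gt_eqF// powR_gt0.
move=> h; rewrite lee_pdivrMl//; apply: le_trans h _.
by rewrite -EFinM lee_fin ler_pM2l.
Qed.

(** If the growth condition fails, every [ep > 0] admits [t] in []0, 1[] with [A t < ep t^{1/al}].
    Testing with height [t] and volume [1/s], [s = ep t^{1/al}], gives
    [B(ep^{-al} / K) <= 2 s <= 2 ep], which forces [B] to vanish at every positive [x]. *)
Lemma no_growth_no_target : ~ growth_cond n gamma A -> False.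
Proof.
move=> ng; have [x x0 Bx] := young_pos yB.
suff : B x <= 0 by rewrite leNgt Bx.
apply/lee_addgt0Pr => e e0; rewrite add0e.
have al0 : (0 < al)%R by exact: al_gt0.
(* The first bound gives [2 ep <= e], the second gives [ep^{-al} >= x K]. *)
pose ep := (Num.min (e / 2) ((x * K) `^ (- al^-1)))%R.
have ep0 : (0 < ep)%R.
  by rewrite lt_min divr_gt0//= powR_gt0// mulr_gt0.
have /ereal_inf_lt[yy [t /=]] : ereal_inf [set A t * (t `^ (- (n%:R / gamma)))%:E | t in `]0%R, 1%R[] < ep%:E.
  by apply: le_lt_trans (_ : 0 < _); [rewrite leNgt; apply/negP|rewrite lte_fin].
rewrite in_itv/= => /andP[t0 t1] <- At.
have pE : (n%:R / gamma = al^-1)%R by rewrite /al invf_div.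
pose s := (ep * t `^ al^-1)%R.
have tp : (0 < t `^ al^-1)%R by rewrite powR_gt0.
have s0 : (0 < s)%R by rewrite mulr_gt0.
have As : A t <= s%:E.
  move: At; rewrite pE powRN muleC => /ltW; rewrite lee_pdivrMl//.
  by rewrite -EFinM mulrC.
have sE : (t * s `^ (- al) = ep `^ (- al))%R.
  rewrite /s powRM ?(ltW ep0) ?(ltW tp)// -powRrM mulrN mulVf ?gt_eqF// powR_inv1 ?(ltW t0)//.
  by rewrite mulrCA mulfV ?mulr1// gt_eqF.
have := test_cube_sum 1 t0 s0 As.
rewrite big_nat1 !expr0 mul1e mul1r sE => h.
have xB : (x <= ep `^ (- al) / K)%R.
  rewrite ler_pdivlMr//.
  have h1 : (ep <= ((x * K) `^ al^-1)^-1)%R by rewrite -powRN ge_min lexx orbT.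
  have xK0 : (0 < x * K)%R by rewrite mulr_gt0.
  rewrite powRN -[leLHS]invrK lef_pV2 ?posrE ?invr_gt0 ?powR_gt0//.
  have : (ep `^ al <= ((x * K) `^ al^-1)^-1 `^ al)%R.
    by apply: ge0_ler_powR => //; rewrite ?nnegrE ?invr_ge0 ?powR_ge0// ltW.
  by rewrite -powRN -powRrM mulNr mulVf ?gt_eqF// powR_inv1// (ltW xK0).
apply: le_trans (young_ndecr yB (ltW x0) xB) _; apply: le_trans h _.
rewrite lee_fin.
have : (s <= ep)%R.
  have one : (1 `^ al^-1 = 1 :> R)%R by rewrite powR1.
  by rewrite /s ger_pMr// -one; apply: ge0_ler_powR; rewrite ?nnegrE ?invr_ge0// ltW.
have : (ep <= e / 2)%R by rewrite ge_min lexx.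
lra.
Qed.

End necessity.

(** * Boundedness into the Sobolev conjugate *)

Section series.
Context {R : realType}.
Implicit Types (u : nat -> \bar R).

Lemma nneseries_ub u (M : \bar R) : (forall j, 0 <= u j) ->
  (forall N, \sum_(0 <= j < N) u j <= M) -> \sum_(0 <= j <oo) u j <= M.
Proof.
move=> u0 H; apply: lime_le; first exact: is_cvg_nneseries.
exact: nearW.
Qed.

Lemma nneseries_term u k : (forall j, 0 <= u j) -> u k <= \sum_(0 <= j <oo) u j.
Proof.
move=> u0; apply: le_trans (nneseries_lim_ge k.+1 _); last by [].
rewrite big_nat_recr; last by [].
by rewrite leeDr//; apply: sume_ge0.
Qed.

Lemma exp_unbounded (k x : R) : (1 < k)%R -> exists N, (x < k ^+ N)%R.
Proof.
move=> k1; have h N : (1 + N%:R * (k - 1) <= k ^+ N)%R.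
  elim: N => [|N IH]; first by rewrite mul0r addr0 expr0.
  rewrite exprS; apply: (@le_trans _ _ (k * (1 + N%:R * (k - 1)))%R); last first.
    by rewrite ler_pM2l//; lra.
  have N0 : (0 <= N%:R :> R)%R by rewrite ler0n.
  rewrite -natr1 -subr_ge0.
  rewrite (_ : _ - _ = N%:R * ((k - 1) * (k - 1)))%R; last by ring.
  by rewrite !mulr_ge0//; lra.
have kp : (0 < k - 1)%R by lra.
exists (Num.truncn (`|x| / (k - 1))).+1; apply: lt_le_trans (h _).
apply: le_lt_trans (ler_norm x) _.
rewrite -ltrBlDl -ltr_pdivrMr//; apply: le_lt_trans (truncnS_gt _).
by rewrite ler_pM2r ?invr_gt0//; lra.
Qed.

Lemma exp_bracket_ge1 (k u : R) : (1 < k)%R -> (1 < u)%R ->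
  exists j, (k ^+ j < u <= k ^+ j.+1)%R.
Proof.
move=> k1 u1; have ex : exists N, (u <= k ^+ N)%R.
  by have [N /ltW h] := exp_unbounded u k1; exists N.
case: (ex_minnP ex) => -[|N] uN minN.
  by move: uN; rewrite expr0 leNgt u1.
exists N; rewrite uN andbT ltNge; apply/negP => /minN.
by rewrite ltnn.
Qed.

Lemma exp_bracket_le1 (k u : R) : (1 < k)%R -> (0 < u <= 1)%R ->
  exists j, ((k ^+ j.+1)^-1 < u <= (k ^+ j)^-1)%R.
Proof.
move=> k1 /andP[u0 u1]; have ex := exp_unbounded u^-1 k1.
have kp N : (0 < k ^+ N)%R by rewrite exprn_gt0//; lra.
case: (ex_minnP ex) => -[|N] uN minN.
  by move: uN; rewrite expr0 ltNge invf_ge1// u1.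
exists N; apply/andP; split.
  by rewrite -[ltRHS]invrK ltf_pV2// posrE// invr_gt0.
rewrite -[leLHS]invrK lef_pV2 ?posrE ?invr_gt0// leNgt.
by apply/negP => /minN; rewrite ltnn.
Qed.

(* Once nonzero, the terms grow at least like [d ^- i], so every partial sum is
   comparable to its last term. *)
Lemma geometric_layers (z : nat -> \bar R) (a : \bar R) (d : R) : (0 <= d < 1)%R ->
  (forall i, 0 <= z i) -> (forall i, z i <= a) ->
  (forall i, z i = 0 -> z i.+1 = 0) ->
  (forall i, z i.+1 != 0 -> z i <= d%:E * z i.+1) ->
  forall J, \sum_(0 <= i < J) z i <= (1 - d)^-1%:E * a.
Proof.
move=> /andP[d0 d1] z0 za zz zd.
have p0 : (0 < 1 - d)%R by lra.
have claim J : z J != 0 -> \sum_(0 <= i < J.+1) z i <= (1 - d)^-1%:E * z J.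
  elim: J => [|J IH] zJ.
    rewrite big_nat1 -[leLHS]mul1e; apply: lee_wpmul2r => //.
    by rewrite lee_fin invf_ge1//; lra.
  rewrite big_nat_recr; last by [].
  have zJ0 : z J != 0 by apply: contra zJ => /eqP/zz->.
  apply: (@le_trans _ _ ((1 - d)^-1%:E * (d%:E * z J.+1) + z J.+1)).
    apply: leeD; last exact: lexx.
    apply: le_trans (IH zJ0) _; apply: lee_wpmul2l; last exact: zd.
    by rewrite lee_fin invr_ge0 ltW.
  rewrite muleA -EFinM -[X in _ + X]mul1e -ge0_muleDl ?lee_fin//; last first.
    by rewrite mulr_ge0// invr_ge0 ltW.
  rewrite -EFinD (_ : (1 - d)^-1 * d + 1 = (1 - d)^-1)%R; first exact: lexx.
  by field; lra.
have c0 : 0 <= (1 - d)^-1%:E by rewrite lee_fin invr_ge0 ltW.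
elim=> [|J IH]; first by rewrite big_geq// mule_ge0// (le_trans (z0 0%N)).
have [zJ|zJ] := eqVneq (z J) 0; last first.
  by apply: le_trans (claim J zJ) _; apply: lee_wpmul2l.
by rewrite big_nat_recr; [rewrite zJ; move: IH; rewrite -[X in X <= _ -> _]adde0|].
Qed.

End series.

Section layers.
Context {R : realType} (n : nat).

Lemma measurable_layers (c lam : nat -> R) (M : Rn R n -> \bar R) :
  (forall j, 0 <= c j)%R -> measurable_fun [set: Rn R n] M ->
  measurable_fun [set: Rn R n]
    (fun x => \sum_(0 <= j <oo) (if (lam j)%:E < M x then (c j)%:E else 0)).
Proof.
move=> c0 mM; apply: (ge0_emeasurable_sum (P := xpredT)).
  by move=> j x _ _; case: ifPn; rewrite ?lee_fin.
move=> j _; have mS : measurable [set x | (lam j)%:E < M x].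
  exact: measurable_gt.
rewrite (_ : (fun x => _) = (cst (c j)%:E) \_ [set x | (lam j)%:E < M x]).
  exact/(measurable_restrictT _ mS).1.
by apply/funext => x; rewrite /patch mem_setE.
Qed.

Lemma integral_layers (c lam : nat -> R) (M : Rn R n -> \bar R) :
  (forall j, 0 <= c j)%R -> measurable_fun [set: Rn R n] M ->
  \int[leb R n]_x (\sum_(0 <= j <oo) (if (lam j)%:E < M x then (c j)%:E else 0)) =
  \sum_(0 <= j <oo) ((c j)%:E * leb R n [set x | (lam j)%:E < M x]).
Proof.
move=> c0 mM.
have mS j : measurable [set x | (lam j)%:E < M x].
  exact: measurable_gt.
have pE j : (fun x => if (lam j)%:E < M x then (c j)%:E else 0) =
    (cst (c j)%:E) \_ [set x | (lam j)%:E < M x].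
  by apply/funext => x; rewrite /patch mem_setE.
rewrite integral_nneseries; last 3 first.
- exact: measurableT.
- by move=> j; rewrite pE; apply/(measurable_restrictT _ (mS j)).1.
- by move=> j x _; case: ifPn; rewrite ?lee_fin.
apply: eq_eseriesr => j _; rewrite -integral_leb_cst; last exact: mS.
by rewrite [RHS]integral_mkcond; apply: eq_integral => x _; rewrite -pE.
Qed.

End layers.

(** A strict improvement on the dilation exponent [e] at a single factor [k]. It is applied to [G]
    with [e = 1 - al] and to [A^{-1}] with [e = 1]; by [boyd_lowerP] it expresses that a lower Boyd
    index exceeds [1/e]. *)
Definition dilation_gain {R : realType} (e : R) (F : R -> R) :=
  exists k th : R, [/\ (1 < k)%R, (th < k `^ e)%R &
    forall s, (0 < s)%R -> (F (k * s) <= th * F s)%R].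

Section sufficiency.
Context {R : realType} (n : nat) (gamma : R) (A : R -> \bar R).
Hypothesis gamma_gt0 : (0 < gamma)%R.
Hypothesis gamma_lt : (gamma < n%:R)%R.
Hypothesis yA : young A.
Hypothesis growth : growth_cond n gamma A.
Let al := (gamma / n%:R)%R.
Local Notation G := (Gr n gamma A).
Let GP := G_gt0 gamma_gt0 gamma_lt yA growth.

(** The height [eta] of the level-set estimate for [lam = 2 * G tau]; the factor 2 makes [psi < lam]
    strict on []0, tau]]. *)
Definition level_height (tau : R) : R := (tau `^ al * (2 * G tau))%R.

Lemma level_height_gt0 tau : (0 < tau)%R -> (0 < level_height tau)%R.
Proof. by move=> t0; rewrite mulr_gt0 ?powR_gt0// mulr_gt0// GP. Qed.

Lemma psi_lt_2G tau s : (0 < tau)%R -> (0 < s)%R -> (s <= tau)%R ->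
  (psi n gamma A s < 2 * G tau)%R.
Proof.
move=> t0 s0 st; apply: le_lt_trans (psi_le_G gamma_gt0 gamma_lt yA growth s0 st) _.
by have := GP t0; lra.
Qed.

(** With [u = |f|], up to constants this is the integrand that bounds [tau] times the measure of a
    level set of the maximal function. Convexity keeps it below [A u]. *)
Definition layer (tau : R) (u : \bar R) : \bar R :=
  if (level_height tau)%:E < u then (tau / level_height tau)%:E * u else 0.

Variables (kap th : R).
Hypothesis kap1 : (1 < kap)%R.
Hypothesis th_lt : (th < kap `^ (1 - al))%R.
Hypothesis G_kap : forall s, (0 < s)%R -> (G (kap * s) <= th * G s)%R.

Let kap0 : (0 < kap)%R. Proof. exact: lt_trans kap1. Qed.

Lemma th_ge1 : (1 <= th)%R.
Proof.
rewrite -(ler_pM2r (GP ltr01)) mul1r; apply: le_trans (G_kap ltr01).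
by apply: (G_nd gamma_gt0) => //; rewrite mulr1 ltW.
Qed.

Let d : R := (th / kap `^ (1 - al))%R.

Lemma d_ge0_lt1 : (0 <= d < 1)%R.
Proof.
have h := th_ge1; apply/andP; split; first by rewrite divr_ge0 ?powR_ge0//; lra.
by rewrite ltr_pdivrMr ?powR_gt0// mul1r.
Qed.

Lemma level_height_kap tau : (0 < tau)%R -> (level_height tau <= level_height (kap * tau))%R.
Proof.
move=> t0; apply: ler_pM; rewrite ?powR_ge0//.
- by rewrite mulr_ge0// ltW// GP.
- apply: ge0_ler_powR; rewrite ?nnegrE; first exact/ltW/(al_gt0 gamma_gt0 gamma_lt).
  + exact: ltW.
  + by rewrite mulr_ge0// ltW.
  + by rewrite ler_peMl// ltW.
- rewrite ler_pM2l//; apply: (G_nd gamma_gt0) => //.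
  by rewrite ler_peMl// ltW.
Qed.

(** The weight equals [tau^{1-al} / (2 G tau)]. Passing to [kap * tau] multiplies it by at least
    [kap^{1-al} / th = 1/d]; this is where the strict dilation inequality enters. *)
Lemma layer_weight_kap tau : (0 < tau)%R ->
  (tau / level_height tau <= d * (kap * tau / level_height (kap * tau)))%R.
Proof.
move=> t0; have kt0 : (0 < kap * tau)%R by rewrite mulr_gt0.
have g0 := GP t0; have gk0 := GP kt0.
rewrite ler_pdivrMr ?level_height_gt0// mulrA mulrAC ler_pdivlMr ?level_height_gt0//.
rewrite -mulrA.
rewrite /level_height (powRM _ (ltW kap0) (ltW t0)).
have kE : (kap `^ al * kap `^ (1 - al) = kap)%R.
  by rewrite -powRD ?(gt_eqF kap0) ?implybT// addrC subrK powRr1// ltW.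
have -> : (d * (kap * tau * (tau `^ al * (2 * G tau))) =
   (tau * tau `^ al * 2 * kap `^ al) * (th * G tau))%R.
  rewrite /d -{2}kE; field; by rewrite gt_eqF// powR_gt0.
have -> : (tau * (kap `^ al * tau `^ al * (2 * G (kap * tau))) =
  (tau * tau `^ al * 2 * kap `^ al) * G (kap * tau))%R by ring.
by rewrite ler_pM2l ?G_kap// !mulr_gt0 ?powR_gt0.
Qed.

Lemma layer_ge0 tau u : (0 < tau)%R -> 0 <= u -> 0 <= layer tau u.
Proof.
move=> t0 u0; rewrite /layer; case: ifPn => // _.
by rewrite mule_ge0// lee_fin divr_ge0// ltW// level_height_gt0.
Qed.

Lemma layer_le tau u : (0 < tau)%R -> 0 <= u -> layer tau u <= at_ereal A u.
Proof.
move=> t0 u0; rewrite /layer; case: ifPn => [/ltW h|_]; last first.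
  by apply: at_ereal_ge0 => //; exact: young_nneg.
have := young_lin_ereal yA (level_height_gt0 t0) h
  (tau_le_A_eta yA t0 (fun s s0 st => psi_lt_2G t0 s0 st)).
by rewrite -lee_pdivrMl ?level_height_gt0// muleA -EFinM mulrC.
Qed.

(** The heights increase with [i], so the nonzero layers come first. They grow at least at the rate
    [1/d] by [layer_weight_kap], and each lies below [A u]. *)
Lemma layer_sum (tau : R) (u : \bar R) J : (0 < tau)%R -> 0 <= u ->
  \sum_(0 <= i < J) layer (kap ^+ i * tau) u <= (1 - d)^-1%:E * at_ereal A u.
Proof.
move=> t0 u0; have ti i : (0 < kap ^+ i * tau)%R by rewrite mulr_gt0// exprn_gt0.
have lt0 i : layer (kap ^+ i * tau) u != 0 -> (level_height (kap ^+ i * tau))%:E < u.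
  by rewrite /layer; case: ifPn => // _; rewrite eqxx.
have lw i : (0 < kap ^+ i * tau / level_height (kap ^+ i * tau))%R.
  by rewrite divr_gt0 ?level_height_gt0.
have step i : (level_height (kap ^+ i * tau) <= level_height (kap ^+ i.+1 * tau))%R.
  by rewrite exprS -mulrA; exact: level_height_kap.
apply: geometric_layers; first exact: d_ge0_lt1.
- by move=> i; apply: layer_ge0.
- by move=> i; apply: layer_le.
- move=> i li0; apply/eqP; apply: contraT => /lt0 h.
  move: li0; rewrite /layer (le_lt_trans _ h) ?lee_fin//.
  move/eqP; rewrite gt_eqF// mule_gt0 ?lte_fin//.
  by apply: le_lt_trans h; rewrite lee_fin ltW// level_height_gt0.
- move=> i li; have h := lt0 _ li; rewrite /layer h (le_lt_trans _ h) ?lee_fin//.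
  rewrite muleA -EFinM; apply: lee_wpmul2r => //.
  rewrite lee_fin (_ : kap ^+ i.+1 * tau = kap * (kap ^+ i * tau))%R.
    exact: layer_weight_kap.
  by rewrite exprS mulrA.
Qed.

Section one_family.
Variables (tau : nat -> R) (f : Rn R n -> \bar R).
Hypothesis tau0 : forall j, (0 < tau j)%R.
Hypothesis tau_sum : forall u J, 0 <= u ->
  \sum_(0 <= i < J) layer (tau i) u <= (1 - d)^-1%:E * at_ereal A u.
Hypothesis mf : measurable_fun [set: Rn R n] f.
Hypothesis Af : \int[leb R n]_x at_ereal A `|f x| <= 1.

(* For [tau] running over the powers [kap ^ j] with j >= 0 and over those with
   j < 0, the two majorants add up to a bound for G^{-1}(y/8). *)
Definition layer_majorant (y : \bar R) : \bar R :=
  \sum_(0 <= j <oo) (if (4 * G (tau j))%:E < y then (kap * tau j)%:E else 0).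

(** Each term is [kap * tau j] times the measure of a level set, which [level_set_frac_max] bounds
    by [3 ^+ n * kap] times the integral of the [j]-th layer of [|f|]. The layers are then summed
    under the integral by [tau_sum]. *)
Lemma integral_layer_majorant :
  \int[leb R n]_x layer_majorant (frac_max gamma f x) <=
  (3 ^+ n * kap / (1 - d))%:E.
Proof.
rewrite /layer_majorant integral_layers; last 2 first.
- by move=> j; rewrite mulr_ge0// ltW.
- exact: measurable_frac_max.
have mabs : measurable_fun [set: Rn R n] (fun x => `|f x|) by exact: measurableT_comp.
have mlayer j : measurable_fun [set: Rn R n] (fun x => layer (tau j) `|f x|).
  have mS : measurable [set x | (level_height (tau j))%:E < `|f x|].
    exact: measurable_gt.
  rewrite (_ : (fun x => _) = (fun x => (tau j / level_height (tau j))%:E * `|f x|)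
      \_ [set x | (level_height (tau j))%:E < `|f x|]).
    apply/(measurable_restrictT _ mS).1; apply: measurable_funTS.
    exact: measurable_funeM.
  by apply/funext => x; rewrite /layer /patch mem_setE.
apply: (@le_trans _ _ (\sum_(0 <= j <oo) ((3 ^+ n * kap)%:E *
    \int[leb R n]_x layer (tau j) `|f x|))).
  apply: lee_nneseries => [j _ _|j _].
    by rewrite mule_ge0// lee_fin mulr_ge0// ltW.
  have hj := level_height_gt0 (tau0 j).
  have := level_set_frac_max gamma_gt0 gamma_lt yA mf Af (tau0 j)
    (fun s s0 st => psi_lt_2G (tau0 j) s0 st).
  rewrite mulrA -natrM -/al -/(level_height (tau j)) => h.
  have ktj : (0 < kap * tau j)%R by rewrite mulr_gt0.
  apply: (le_trans (lee_wpmul2l _ h)); first by rewrite lee_fin ltW.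
  rewrite muleA -EFinM.
  have -> : \int[leb R n]_x layer (tau j) `|f x| = (tau j / level_height (tau j))%:E *
     \int[leb R n]_(x in [set x | (level_height (tau j))%:E < `|f x|]) `|f x|.
    have mS : measurable [set x | (level_height (tau j))%:E < `|f x|].
      exact: measurable_gt.
    rewrite -ge0_integralZl; last 4 first.
    - exact: mS.
    - exact: measurable_funTS.
    - by move=> x _; exact: abse_ge0.
    - by rewrite lee_fin divr_ge0// ltW.
    rewrite [RHS]integral_mkcond; apply: eq_integral => x _.
    by rewrite /layer /patch mem_setE.
  rewrite muleA -EFinM.
  rewrite (_ : kap * tau j * (3 ^+ n / level_height (tau j)) =
    3 ^+ n * kap * (tau j / level_height (tau j)))%R; first exact: lexx.
  by ring.
have c0 : (0 <= 3 ^+ n * kap)%R by rewrite mulr_ge0 ?exprn_ge0// ltW.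
rewrite nneseriesZl; last by move=> j _; apply: integral_ge0 => x _; exact: layer_ge0.
rewrite -integral_nneseries; last 3 first.
- exact: measurableT.
- exact: mlayer.
- by move=> j x _; exact: layer_ge0.
rewrite [leRHS]EFinM; apply: lee_wpmul2l; first by rewrite lee_fin.
have d1 : (0 <= (1 - d)^-1)%R by case/andP: d_ge0_lt1 => _ ?; rewrite invr_ge0; lra.
apply: (@le_trans _ _ (\int[leb R n]_x ((1 - d)^-1%:E * at_ereal A `|f x|))).
  apply: nneg_le_integral => x _.
    by apply: nneseries_ge0 => j _ _; exact: layer_ge0.
  apply: nneseries_ub => [j|N]; first exact: layer_ge0.
  exact: tau_sum.
have mA : measurable_fun [set: Rn R n] (fun x => at_ereal A `|f x|).
  by apply: measurable_at_ereal => //; exact: young_ndecr.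
rewrite ge0_integralZl; last 4 first.
- exact: measurableT.
- exact: mA.
- by move=> x _; apply: at_ereal_ge0 => //; exact: young_nneg.
- by rewrite lee_fin.
by rewrite (le_trans (lee_wpmul2l _ Af)) ?mule1 ?lexx// lee_fin.
Qed.

End one_family.

End sufficiency.

Section boundedness.
Context {R : realType} (n : nat) (gamma : R) (A : R -> \bar R).
Hypothesis gamma_gt0 : (0 < gamma)%R.
Hypothesis gamma_lt : (gamma < n%:R)%R.
Hypothesis yA : young A.
Hypothesis growth : growth_cond n gamma A.
Let al := (gamma / n%:R)%R.
Local Notation G := (Gr n gamma A).
Local Notation An := (sobolev_young n gamma A).
Let GP := G_gt0 gamma_gt0 gamma_lt yA growth.

Lemma layer_majorant_pinfty (kap : R) y : (1 < kap)%R ->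
  (forall j, (4 * G (kap ^+ j))%:E < y) ->
  layer_majorant n gamma A kap (fun j => kap ^+ j)%R y = +oo.
Proof.
move=> k1 H; have k0 : (0 < kap)%R by exact: lt_trans k1.
apply/eqyP => M M0; have [N MN] := exp_unbounded M k1.
apply: le_trans (nneseries_term N _); last first.
  by move=> j; case: ifPn; rewrite // lee_fin mulr_ge0 ?exprn_ge0// ltW.
rewrite H lee_fin; apply: le_trans (ltW MN) _.
by rewrite ler_peMl ?exprn_ge0// ltW.
Qed.

Lemma layer_majorant_ge (kap : R) (tau : nat -> R) y j : (0 < kap)%R ->
  (forall j, 0 < tau j)%R -> (4 * G (tau j))%:E < y ->
  (kap * tau j)%:E <= layer_majorant n gamma A kap tau y.
Proof.
move=> k0 t0 jy; apply: le_trans (nneseries_term j _).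
  by rewrite jy.
by move=> i; case: ifPn; rewrite // lee_fin mulr_ge0// ltW.
Qed.

Lemma layer_majorant_ge0 (kap : R) (tau : nat -> R) y : (0 < kap)%R ->
  (forall j, 0 < tau j)%R -> 0 <= layer_majorant n gamma A kap tau y.
Proof.
move=> k0 t0; apply: nneseries_ge0 => j _ _.
by case: ifPn; rewrite // lee_fin mulr_ge0// ltW.
Qed.

(** Let [g = Gi (y / 8)]; the left side is at most [g / D]. If [tau < g], then [G tau <= y / 8], so
    the level [4 * G tau] lies below [y]. Taking for [tau] the power of [kap] with
    [tau < g <= kap * tau], a single term of a majorant is at least [g]. The two families serve
    [g > 1] and [g <= 1]. *)
Lemma sobolev_young_le_layers (kap D : R) (y : \bar R) : (1 < kap)%R -> (1 <= D)%R -> 0 <= y ->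
  at_ereal An (y / (8 * D)%:E) <=
  D^-1%:E * (layer_majorant n gamma A kap (fun j => kap ^+ j)%R y +
             layer_majorant n gamma A kap (fun j => (kap ^+ j.+1)^-1)%R y).
Proof.
move=> k1 D1 y0; have k0 : (0 < kap)%R by exact: lt_trans k1.
have D0 : (0 < D)%R by exact: lt_le_trans D1.
have kj j : (0 < kap ^+ j)%R by rewrite exprn_gt0.
have kj' j : (0 < (kap ^+ j.+1)^-1)%R by rewrite invr_gt0 exprn_gt0.
have D8 : (0 < 8 * D)%R by rewrite mulr_gt0.
set T1 := layer_majorant _ _ _ _ _ y; set T2 := layer_majorant _ _ _ _ _ y.
have T10 : 0 <= T1 by apply: layer_majorant_ge0.
have T20 : 0 <= T2 by apply: layer_majorant_ge0.
have infty : T1 = +oo -> D^-1%:E * (T1 + T2) = +oo.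
  move=> ->; rewrite addye ?gt0_muley ?lte_fin ?invr_gt0//.
  by rewrite gt_eqF// (lt_le_trans _ T20)// ltNy0.
case: y y0 @T1 T10 @T2 T20 infty => [r||] //; last first.
  move=> _ T1 T10 T2 T20 infty; rewrite infty ?leey//.
  by apply: layer_majorant_pinfty => // j; rewrite ltry.
rewrite lee_fin le_eqVlt => /orP[/eqP <-|r0] T1 T10 T2 T20 infty.
  rewrite mul0e /= An_le0// mule_ge0 ?adde_ge0// lee_fin invr_ge0 ltW//.
rewrite divEFin// -EFinM mulrC /=.
have r8 : (0 < r / 8)%R by rewrite divr_gt0.
have rD : (0 < r / (8 * D))%R by rewrite divr_gt0.
apply: le_trans (An_le_Gi gamma_gt0 gamma_lt yA growth rD) _.
rewrite lee_pdivlMl//.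
apply: le_trans (Gi_scale1 gamma_gt0 gamma_lt yA growth D1 rD) _.
have -> : (D * (r / (8 * D)) = r / 8)%R by field; rewrite gt_eqF.
have G4 t : (0 < t)%R -> t%:E < Gi n gamma A (r / 8) -> (4 * G t)%:E < r%:E.
  move=> t0 tG; have := lt_Gi gamma_gt0 gamma_lt yA growth t0 tG.
  by rewrite lte_fin; lra.
case E : (Gi n gamma A (r / 8)) => [g||]; last 2 first.
- have T1oo : T1 = +oo.
    by apply: layer_majorant_pinfty => // j; apply: G4 => //; rewrite E ltry.
  rewrite T1oo addye ?leey//.
  by rewrite gt_eqF// (lt_le_trans _ T20)// ltNy0.
- by rewrite leNye.
have [g0|g0] := leP g 0%R; first by apply: (@le_trans _ _ 0); rewrite ?lee_fin ?adde_ge0.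
have [g1|g1] := ltP 1%R g.
  have [j /andP[jg gj]] := exp_bracket_ge1 k1 g1.
  apply: (@le_trans _ _ T1); last by rewrite leeDl.
  apply: le_trans (layer_majorant_ge (j := j) k0 kj _).
    by rewrite -exprS lee_fin.
  by apply: G4 => //; rewrite E lte_fin.
have [|j /andP[jg gj]] := @exp_bracket_le1 _ kap g k1; first by rewrite g0.
apply: (@le_trans _ _ T2); last by rewrite leeDr.
apply: le_trans (layer_majorant_ge (j := j) k0 kj' _).
  by rewrite exprS invfM mulrA mulfV ?gt_eqF// mul1r lee_fin.
by apply: G4 => //; rewrite E lte_fin.
Qed.

Lemma dilation_gain_bounded : dilation_gain (1 - al) G ->
  frac_max_bounded n gamma A An.
Proof.
move=> [kap [th [k1 thk GK]]]; have k0 : (0 < kap)%R by exact: lt_trans k1.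
have kj j : (0 < kap ^+ j)%R by rewrite exprn_gt0.
have kj' j : (0 < (kap ^+ j.+1)^-1)%R by rewrite invr_gt0 exprn_gt0.
pose d := (th / kap `^ (1 - al))%R.
have /andP[d0 d1] : (0 <= d < 1)%R by exact: (d_ge0_lt1 gamma_gt0 gamma_lt yA growth k1 thk GK).
pose D0 := (3 ^+ n * kap / (1 - d))%R.
have D00 : (0 <= D0)%R.
  by apply: divr_ge0; [rewrite mulr_ge0 ?exprn_ge0 ?(ltW k0)|rewrite subr_ge0 ltW].
(* Each of the two majorants has integral at most [D0], so dividing by [D] brings the modular below
   1. The summand 1 ensures [D >= 1], which [sobolev_young_le_layers] requires. *)
pose D := (1 + D0 + D0)%R.
have D1 : (1 <= D)%R by rewrite /D; lra.
have Dp : (0 < D)%R by exact: lt_le_trans D1.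
apply: (@modular_bounded_frac_max _ _ _ A An (8 * D)%R).
- exact: An_nneg.
- exact: An_ndecr.
- by rewrite mulr_gt0.
move=> f mf Af.
have mM := measurable_frac_max gamma f.
have S1 : \int[leb R n]_x layer_majorant n gamma A kap (fun j => kap ^+ j)%R (frac_max gamma f x) <= D0%:E.
  apply: (integral_layer_majorant gamma_gt0 gamma_lt yA growth k1 thk GK) => // u J u0.
  have := layer_sum gamma_gt0 gamma_lt yA growth k1 thk GK J ltr01 u0.
  by under eq_bigr do rewrite mulr1.
have S2 : \int[leb R n]_x layer_majorant n gamma A kap (fun j => (kap ^+ j.+1)^-1)%R (frac_max gamma f x) <= D0%:E.
  apply: (integral_layer_majorant gamma_gt0 gamma_lt yA growth k1 thk GK) => // u J u0.
  have kJ : (0 < (kap ^+ J)^-1)%R by rewrite invr_gt0.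
  have := layer_sum gamma_gt0 gamma_lt yA growth k1 thk GK J kJ u0.
  (* Read backwards, the first [J] negative powers are increasing powers starting at [kap^{-J}], as
     [layer_sum] expects. *)
  rewrite big_nat_rev; apply: le_trans; rewrite [leLHS]big_nat [leRHS]big_nat.
  apply: lee_sum => i /andP[_ iJ]; rewrite add0n.
  rewrite (_ : (kap ^+ i.+1)^-1 = kap ^+ (J - i.+1) * (kap ^+ J)^-1)%R ?lexx//.
  by rewrite -[X in (_ * (_ ^+ X)^-1)%R](subnK iJ) exprD; field; rewrite !gt_eqF.
pose H x := layer_majorant n gamma A kap (fun j => kap ^+ j)%R (frac_max gamma f x) +
   layer_majorant n gamma A kap (fun j => (kap ^+ j.+1)^-1)%R (frac_max gamma f x).
have m1 : measurable_fun [set: Rn R n] (fun x => layer_majorant n gamma A kap (fun j => kap ^+ j)%R (frac_max gamma f x)).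
  by apply: measurable_layers => // j; rewrite mulr_ge0// ltW.
have m2 : measurable_fun [set: Rn R n] (fun x => layer_majorant n gamma A kap (fun j => (kap ^+ j.+1)^-1)%R (frac_max gamma f x)).
  by apply: measurable_layers => // j; rewrite mulr_ge0// ltW.
apply: (@le_trans _ _ (\int[leb R n]_x (D^-1%:E * H x))).
  apply: nneg_le_integral => x _.
    apply: at_ereal_ge0; first exact: An_nneg.
    by rewrite mule_ge0 ?frac_max_ge0// inve_ge0 lee_fin mulr_ge0// ltW.
  by apply: sobolev_young_le_layers => //; exact: frac_max_ge0.
have H0 x : 0 <= H x by apply: adde_ge0; exact: layer_majorant_ge0.
rewrite ge0_integralZl; last 4 first.
- exact: measurableT.
- exact: emeasurable_funD.
- by move=> x _; exact: H0.
- by rewrite lee_fin invr_ge0 ltW.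
rewrite lee_pdivrMl// mule1 /H ge0_integralD; last 5 first.
- exact: measurableT.
- by move=> x _; exact: layer_majorant_ge0.
- exact: m1.
- by move=> x _; exact: layer_majorant_ge0.
- exact: m2.
by apply: le_trans (leeD S1 S2) _; rewrite -EFinD lee_fin /D; lra.
Qed.

(** The first term of [necessity_sum] gives [B(x / K) <= 2 Gi x <= Gi (2 x) <= An (4 x)]. With
    [x = t / 4] this is a pointwise domination of [B] by [An] after scaling, which passes to
    modulars and norms. *)
Lemma bounded_embeds (B : R -> \bar R) : young B -> frac_max_bounded n gamma A B ->
  orlicz_embeds n An B.
Proof.
move=> yB bdd.
have [K K0 bK] := frac_max_bounded_modular (young_nneg yB) (young_ndecr yB) bdd.
have le t : (0 <= t)%R -> B (t / (4 * K))%R <= An t.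
  rewrite le_eqVlt => /orP[/eqP<-|t0].
    by rewrite mul0r young0// An_nneg.
  have t4 : (0 < t / 4)%R by rewrite divr_gt0.
  have t2 : (0 < t / 2)%R by rewrite divr_gt0.
  have := necessity_sum gamma_gt0 gamma_lt yA yB K0 bK growth 1 t4.
  rewrite big_nat1 !expr0 mul1e mul1r => h.
  rewrite invfM mulrA; apply: le_trans h _.
  have h2 : (1 <= 2 :> R)%R by rewrite ler1n.
  apply: le_trans (Gi_scale1 gamma_gt0 gamma_lt yA growth h2 t4) _.
  rewrite (_ : 2 * (t / 4) = t / 2)%R; last by field.
  apply: le_trans (Gi_le_An gamma_gt0 gamma_lt yA growth t2) _.
  by rewrite (_ : 2 * (t / 2) = t)%R; [exact: lexx|field].
have K4 : (0 < 4 * K)%R by rewrite mulr_gt0.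
have lee x : 0 <= x -> at_ereal B (x / (4 * K)%:E) <= at_ereal An x.
  case: x => [r||] //; last by move=> _; rewrite leey.
  by rewrite lee_fin => r0; rewrite divEFin// -EFinM /= [X in B X]mulrC; exact: le.
have mod_le (f : Rn R n -> \bar R) lam : (0 < lam)%R ->
    modular B f (4 * K * lam)%R <= modular An f lam.
  move=> l0; apply: nneg_le_integral => x _.
    by apply: at_ereal_ge0; [exact: young_nneg|rewrite abse_div_ge0// mulr_gt0].
  have -> : `|f x| / (4 * K * lam)%:E = `|f x| / lam%:E / (4 * K)%:E.
    by rewrite !divEFin ?mulr_gt0// muleA -EFinM -invfM.
  exact: lee _ (abse_div_ge0 (f x) l0).
exists (4 * K)%R; split; [exact: K4|]; move=> f [mf [lam [l0 lf]]]; split.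
  split=> //; exists (4 * K * lam)%R; split; first by rewrite mulr_gt0.
  by apply: le_lt_trans lf; exact: mod_le.
rewrite -lee_pdivrMl//; apply: le_ereal_inf_tmp => _ [mu [mu0 muf] <-].
rewrite lee_pdivrMl// -EFinM; apply: ereal_inf_lbound.
exists (4 * K * mu)%R => //; split; first by rewrite mulr_gt0.
by apply: le_trans muf; exact: mod_le.
Qed.

End boundedness.

(** * Absence of an optimal target *)

Section small_ratio.
Context {R : realType} (n : nat) (gamma : R) (A B : R -> \bar R) (K : R).
Hypothesis gamma_gt0 : (0 < gamma)%R.
Hypothesis gamma_lt : (gamma < n%:R)%R.
Hypothesis yA : young A.
Hypothesis growth : growth_cond n gamma A.
Hypothesis yB : young B.
Hypothesis K0 : (0 < K)%R.
Hypothesis bddAB : modular_bounded n gamma A B K.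
Let al := (gamma / n%:R)%R.
Let be := beta n gamma.
Local Notation G := (Gr n gamma A).
Local Notation Gi := (Gi n gamma A).
Let GP := G_gt0 gamma_gt0 gamma_lt yA growth.
Hypothesis no_gain : ~ dilation_gain (1 - al) G.

(* Feeding this ratio into [necessity_sum] at [mu], each of the N terms is of the
   order of G^{-1}(mu) if [B (J * t)] is never small. *)
Lemma no_gain_ratio (k : R) : (1 < k)%R ->
  exists2 s, (0 < s)%R & (k `^ (1 - al) / 2 * G s < G (k * s))%R.
Proof.
move=> k1; apply: contrapT => H; apply: no_gain.
exists k, (k `^ (1 - al) / 2)%R; split => //.
  by rewrite ltr_pdivrMr// ltr_pMr ?powR_gt0 ?ltr1n// (lt_trans _ k1).
move=> s s0; rewrite leNgt; apply/negP => h; apply: H; by exists s.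
Qed.

(** Suppose [B (J t) > eps * Gi t] whenever [Gi t] is positive and finite. Take [k^{1-al} = W rho^N]
    with [rho = 2^{1-al}], then [s] from [no_gain_ratio] and [mu = W rho^N G(s) / 2]. Each of the
    first [N] terms of [necessity_sum] at [mu] is at least [eps 2^N s], since [Gi] is at least
    [2^{N-i} s] at [x i]. The sum is at most [2 Gi mu <= 2 W^{be} 2^N s], a contradiction once
    [N eps > 2 W^{be}]. *)
Lemma small_ratio_large (J eps : R) : (1 <= K * J)%R -> (0 < eps)%R ->
  exists t, [/\ (0 < t)%R, 0 < Gi t, Gi t < +oo & B (J * t)%R <= eps%:E * Gi t].
Proof.
move=> KJ e0; have KJ0 : (0 < K * J)%R by exact: lt_le_trans KJ.
have J0 : (0 < J)%R by rewrite -(pmulr_rgt0 _ K0).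
apply: contrapT => H.
have HB t : (0 < t)%R -> 0 < Gi t -> Gi t < +oo -> eps%:E * Gi t < B (J * t)%R.
  by move=> t0 g0 goo; rewrite ltNge; apply/negP => h; apply: H; exists t.
have al1 : (0 < 1 - al)%R by exact: al1_gt0.
have be0 : (0 < be)%R by exact: beta_gt0.
have be1 : ((1 - al) * be = 1)%R by rewrite /be /beta mulfV ?gt_eqF.
(* With this constant [mu / (K * J)] equals [rho^N * (2 * G s)], and [Gi (2 * G s) >= s]. *)
pose W := (4 * (K * J))%R.
have W0 : (0 < W)%R by rewrite mulr_gt0.
pose rho : R := (2 `^ (1 - al))%R.
have rho1 : (1 < rho)%R.
  have one : (1 `^ (1 - al) = 1 :> R)%R by rewrite powR1.
  by rewrite /rho -[ltLHS]one; apply: gt0_ltr_powR; rewrite ?nnegrE ?ltr1n.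
have rho0 : (0 < rho)%R by exact: lt_trans rho1.
have rhoX i : ((rho ^+ i) `^ be = 2 ^+ i)%R.
  rewrite -powR_mulrn ?(ltW rho0)// -powRrM mulrC powRrM -(powRrM 2) be1.
  by rewrite powRr1// powR_mulrn.
have rE : ((2 : R) `^ (al - 1) = rho^-1)%R by rewrite /rho -powRN opprB.
have [N NW] : exists N : nat, (2 * W `^ be < N%:R * eps)%R.
  by exists (Num.truncn (2 * W `^ be / eps)).+1; rewrite -ltr_pdivrMr//; exact: truncnS_gt.
pose k := ((W * rho ^+ N) `^ be)%R.
have rN1 : (1 <= rho ^+ N)%R by rewrite exprn_ege1// ltW.
have WN1 : (1 < W * rho ^+ N)%R.
  apply: (@lt_le_trans _ _ W); first by rewrite /W; lra.
  by rewrite ler_peMr// ltW.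
have k1 : (1 < k)%R.
  have one : (1 `^ be = 1 :> R)%R by rewrite powR1.
  rewrite /k -[ltLHS]one; apply: gt0_ltr_powR; rewrite ?nnegrE//.
  by rewrite ltW// (lt_trans _ WN1).
have kE : (k `^ (1 - al) = W * rho ^+ N)%R.
  by rewrite /k -powRrM (mulrC be) be1 powRr1// ltW// (lt_trans _ WN1).
have kE' : (k = W `^ be * 2 ^+ N)%R.
  by rewrite /k powRM ?(ltW W0) ?exprn_ge0 ?(ltW rho0)// rhoX.
have [s s0] := no_gain_ratio k1; rewrite kE.
have g0 := GP s0; set g := G s in g0 *; move=> ks.
have k0 : (0 < k)%R by exact: lt_trans k1.
have ks0 : (0 < k * s)%R by rewrite mulr_gt0.
pose mu := (W * rho ^+ N / 2 * g)%R.
have mu0 : (0 < mu)%R by rewrite !mulr_gt0 ?invr_gt0 ?exprn_gt0.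
have Gimu : Gi mu <= (k * s)%:E by apply: Gi_le.
have Gis : s%:E <= Gi (2 * g)%R.
  apply: le_Gi => //; rewrite -/g; lra.
pose x i := (rho^-1 ^+ i * mu / (K * J))%R.
have xE i : (i <= N)%N -> x i = (rho ^+ (N - i) * (2 * g))%R.
  move=> iN; rewrite /x /mu /W -{1}(subnK iN) exprD exprVn.
  by field; rewrite (gt_eqF K0) (gt_eqF J0) expf_neq0// gt_eqF.
have lowB i : (i < N)%N -> (eps * (2 ^+ N * s))%:E <=
    (2 ^+ i)%:E * B (rho^-1 ^+ i * mu / K)%R.
  move=> /ltnW iN.
  have ri1 : (1 <= rho ^+ (N - i))%R by rewrite exprn_ege1// ltW.
  have x0 : (0 < x i)%R by rewrite xE// !mulr_gt0// exprn_gt0.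
  have Gix : (2 ^+ (N - i) * s)%:E <= Gi (x i).
    rewrite xE// EFinM -rhoX.
    apply: le_trans (Gi_scale gamma_gt0 gamma_lt yA growth ri1 _); last by rewrite mulr_gt0.
    by apply: lee_wpmul2l => //; rewrite lee_fin powR_ge0.
  have Gixoo : Gi (x i) < +oo.
    apply: le_lt_trans (ltry (k * s)); apply: le_trans Gimu; apply: Gi_nd.
    rewrite /x ler_pdivrMr//; apply: (@le_trans _ _ mu).
      rewrite ler_piMl ?(ltW mu0)// exprn_ile1 ?invr_ge0 ?(ltW rho0)//.
      by rewrite invf_le1// ltW.
    by rewrite ler_peMr// ltW.
  have Gix0 : 0 < Gi (x i) by apply: lt_le_trans Gix; rewrite lte_fin mulr_gt0// exprn_gt0.
  have := HB _ x0 Gix0 Gixoo.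
  have -> : (J * x i = rho^-1 ^+ i * mu / K)%R.
    by rewrite /x; field; rewrite (gt_eqF K0) (gt_eqF J0).
  move=> /ltW h; rewrite -lee_pdivrMl ?exprn_gt0//; apply: le_trans h.
  rewrite -EFinM.
  have -> : ((2 ^+ i)^-1 * (eps * (2 ^+ N * s)) = eps * (2 ^+ (N - i) * s))%R.
    by rewrite -{1}(subnK iN) exprD; field; rewrite expf_neq0.
  by rewrite EFinM; apply: lee_wpmul2l => //; rewrite lee_fin ltW.
have S : \sum_(0 <= j < N) (2 ^+ j)%:E * B (rho^-1 ^+ j * mu / K)%R <= 2%:E * (k * s)%:E.
  have := necessity_sum gamma_gt0 gamma_lt yA yB K0 bddAB growth N mu0.
  by rewrite -/al rE => h; apply: (le_trans h); apply: lee_wpmul2l.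
have : (N%:R * (eps * (2 ^+ N * s)))%:E <= 2%:E * (k * s)%:E.
  apply: le_trans S; rewrite (_ : (_ * _)%:E = \sum_(0 <= i < N) (eps * (2 ^+ N * s))%:E).
    by rewrite big_nat [leRHS]big_nat; apply: lee_sum => i /andP[_]; exact: lowB.
  by rewrite sumEFin sumr_const_nat subn0 mulr_natl.
rewrite -EFinM lee_fin kE' leNgt => /negP; apply.
have p0 : (0 < 2 ^+ N * s)%R by rewrite mulr_gt0// exprn_gt0.
move: NW; rewrite -(ltr_pM2r p0); set P := (2 ^+ N)%R; lra.
Qed.

(** Enlarging [J] only increases [B (J * t)]; adding [K^-1] to it secures [1 <= K * J]. *)
Lemma small_ratio (J eps : R) : (0 <= J)%R -> (0 < eps)%R ->
  exists t, [/\ (0 < t)%R, 0 < Gi t, Gi t < +oo & B (J * t)%R <= eps%:E * Gi t].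
Proof.
move=> J0 e0.
have [|t [t0 g0 goo Bt]] := @small_ratio_large (`|J| + K^-1)%R eps _ e0.
  by rewrite mulrDr mulfV ?gt_eqF// lerDr mulr_ge0// ltW.
exists t; split => //; apply: le_trans Bt; apply: (young_ndecr yB).
  by rewrite mulr_ge0// ltW.
by rewrite ler_pM2r// (le_trans (ler_norm _))// lerDl invr_ge0 ltW.
Qed.

End small_ratio.

(** * Series of hinge functions *)

Section hinge_series.
Context {R : realType} (c t : nat -> R).
Hypothesis c0 : forall j, (0 <= c j)%R.
Hypothesis t0 : forall j, (0 < t j)%R.

Definition hinge (j : nat) (u : R) : R := (c j * Num.max 0 (u - t j))%R.

Definition hinges (u : R) : \bar R := \sum_(0 <= j <oo) (hinge j u)%:E.

Lemma hinge_ge0 j u : (0 <= hinge j u)%R.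
Proof. by rewrite mulr_ge0// le_max lexx. Qed.

Lemma hinge_nd j u v : (u <= v)%R -> (hinge j u <= hinge j v)%R.
Proof.
move=> uv; apply: ler_wpM2l => //; rewrite ge_max le_max lexx/=.
by rewrite le_max lerD2r uv orbT.
Qed.

Lemma hinge0 j u : (u <= t j)%R -> hinge j u = 0%R.
Proof. by move=> ut; rewrite /hinge max_l ?mulr0// subr_le0. Qed.

Lemma hinge_convex j u v l : (0 <= l <= 1)%R ->
  (hinge j (l * u + (1 - l) * v) <= l * hinge j u + (1 - l) * hinge j v)%R.
Proof.
move=> /andP[l0 l1]; rewrite /hinge mulrCA (mulrCA (1 - l)%R) -mulrDr.
apply: ler_wpM2l => //; have l2 : (0 <= 1 - l)%R by rewrite subr_ge0.
have h w : (0 <= Num.max 0 (w - t j))%R by rewrite le_max lexx.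
have h' w : (w - t j <= Num.max 0 (w - t j))%R by rewrite le_max lexx orbT.
rewrite ge_max; apply/andP; split; first by rewrite addr_ge0// mulr_ge0.
apply: (@le_trans _ _ (l * (u - t j) + (1 - l) * (v - t j))%R); first by lra.
by apply: lerD; apply: ler_wpM2l.
Qed.

Lemma hinge_lipschitz j u v : (u <= v)%R -> (hinge j v <= hinge j u + c j * (v - u))%R.
Proof.
move=> uv; rewrite /hinge -mulrDr; apply: ler_wpM2l => //.
have h : (0 <= Num.max 0 (u - t j))%R by rewrite le_max lexx.
have h' : (u - t j <= Num.max 0 (u - t j))%R by rewrite le_max lexx orbT.
by rewrite ge_max; apply/andP; split; lra.
Qed.

Lemma hinges_ge0 u : 0 <= hinges u.
Proof. by apply: nneseries_ge0 => j _ _; rewrite lee_fin hinge_ge0. Qed.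

Lemma hinges_nd u v : (u <= v)%R -> hinges u <= hinges v.
Proof.
move=> uv; apply: lee_nneseries => [j _ _|j _]; rewrite lee_fin ?hinge_ge0//.
exact: hinge_nd.
Qed.

Lemma hinges0 : hinges 0%R = 0.
Proof. by apply: eseries0 => j _ _; rewrite hinge0// ltW. Qed.

Lemma hinges_convex u v l : (0 <= l <= 1)%R ->
  hinges (l * u + (1 - l) * v)%R <= l%:E * hinges u + (1 - l)%:E * hinges v.
Proof.
move=> l01; have /andP[l0 l1] := l01.
have l2 : (0 <= 1 - l)%R by rewrite subr_ge0.
rewrite /hinges -!nneseriesZl; last 2 first.
- by move=> j _; rewrite lee_fin hinge_ge0.
- by move=> j _; rewrite lee_fin hinge_ge0.
rewrite -nneseriesD; last 2 first.
- by move=> j _ _; rewrite mule_ge0// lee_fin ?hinge_ge0.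
- by move=> j _ _; rewrite mule_ge0// lee_fin ?hinge_ge0.
apply: lee_nneseries => [j _ _|j _]; first by rewrite lee_fin hinge_ge0.
by rewrite -!EFinM -EFinD lee_fin hinge_convex.
Qed.

(** Some partial sum already exceeds [M] at [u], and it is Lipschitz with constant the sum of its
    slopes. *)
Lemma hinges_gt_left (M u : R) : M%:E < hinges u ->
  exists2 e, (0 < e)%R & forall v, (u - e < v < u)%R -> M%:E < hinges v.
Proof.
move=> Mu; have [N MN] : exists N, M%:E < \sum_(0 <= j < N) (hinge j u)%:E.
  apply: contrapT => H; suff : hinges u <= M%:E by rewrite leNgt Mu.
  apply: nneseries_ub => [j|N]; first by rewrite lee_fin hinge_ge0.
  by rewrite leNgt; apply/negP => h; apply: H; exists N.
move: MN; rewrite sumEFin lte_fin => MN.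
pose C := (\sum_(0 <= j < N) c j)%R.
have C0 : (0 <= C)%R by apply: sumr_ge0.
pose e := ((\sum_(0 <= j < N) hinge j u - M) / (C + 1))%R.
have C1 : (0 < C + 1)%R by lra.
have e0 : (0 < e)%R by rewrite divr_gt0// subr_gt0.
exists e => // v /andP[ev vu].
apply: lt_le_trans (nneseries_lim_ge N _); last by move=> j _ _; rewrite lee_fin hinge_ge0.
rewrite sumEFin lte_fin.
have : (\sum_(0 <= j < N) hinge j u <= \sum_(0 <= j < N) hinge j v + C * (u - v))%R.
  rewrite /C mulr_suml -big_split/=; apply: ler_sum => j _.
  by apply: hinge_lipschitz; exact: ltW.
have : (C * (u - v) <= C * e)%R by apply: ler_wpM2l => //; lra.
have : ((C + 1) * e = \sum_(0 <= j < N) hinge j u - M)%R.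
  by rewrite mulrC divfK// gt_eqF.
rewrite mulrDl mul1r; set s1 := (\sum_(_ <= _ < _) hinge _ u)%R.
set s2 := (\sum_(_ <= _ < _) hinge _ v)%R; lra.
Qed.

(** Monotonicity bounds the values from above and [hinges_gt_left] bounds them from below; at an
    infinite value the latter alone suffices. *)
Lemma hinges_left_continuous u : hinges x @[x --> u^'-] --> hinges u.
Proof.
have lt_near e : (0 < e)%R -> \forall x \near u^'-, (u - e < x < u)%R.
  move=> e0; near=> x; apply/andP; split; near: x.
    by apply: nbhs_left_gt; rewrite ltrBlDr ltrDl.
  exact: nbhs_left_lt.
case E : (hinges u) => [s||]; last 2 first.
- apply/cvgeyPgt => M.
  have [|e e0 He] := @hinges_gt_left M u; first by rewrite E ltry.
  by apply: filterS (lt_near _ e0) => x; exact: He.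
- by have := hinges_ge0 u; rewrite E.
have fin x : (x < u)%R -> hinges x \is a fin_num.
  move=> xu; rewrite ge0_fin_numE ?hinges_ge0//.
  by apply: le_lt_trans (hinges_nd (ltW xu)) _; rewrite E ltry.
apply/fine_cvgP; split.
  by apply: filterS (lt_near _ ltr01) => x /andP[_ /fin].
apply/cvgrPdist_lt => e e0.
have [|d d0 Hd] := @hinges_gt_left (s - e)%R u; first by rewrite E lte_fin; lra.
apply: filterS (lt_near _ d0) => x xd; have /andP[_ xu] := xd.
have := Hd x xd; have := hinges_nd (ltW xu); rewrite E /=.
rewrite -(fineK (fin x xu)) lte_fin lee_fin => h1 h2.
by rewrite ger0_norm ?subr_ge0//; move: h2; rewrite /=; lra.
Unshelve. all: by end_near. Qed.

Lemma young_add_hinges (B : R -> \bar R) : young B ->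
  (exists2 u, (0 < u)%R & hinges u < +oo) ->
  young (fun u => B u + hinges u).
Proof.
move=> yB [u0 u00 Su0]; have [B0 Bp Bc Bl _] := yB; split.
- by rewrite B0 hinges0 adde0.
- by move=> u u0'; rewrite adde_ge0 ?Bp// hinges_ge0.
- move=> u v l pu pv l01; have /andP[l0 l1] := l01.
  rewrite !ge0_muleDr ?hinges_ge0 ?Bp//.
  rewrite addeACA; apply: leeD; [exact: Bc|exact: hinges_convex].
- move=> u pu; apply: cvgeD; last exact: hinges_left_continuous.
    by rewrite ge0_adde_def// inE ?Bp ?hinges_ge0// ltW.
  exact: Bl.
(* A constant value [k] would be finite, by evaluation near 0, and positive, because [B] is positive
   somewhere. Convexity at half the argument then gives [k <= k / 2]. *)
- move=> [k Hk]; have [v v0 Bv] := young_fin yB.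
  pose w := Num.min u0 v.
  have w0 : (0 < w)%R by rewrite lt_min u00 v0.
  have kw := Hk _ w0; have kw2 := Hk (w / 2)%R (divr_gt0 w0 (ltr0n _ 2)).
  have kfin : k < +oo.
    rewrite -kw lte_add_pinfty//.
      by apply: le_lt_trans Bv; apply: (young_ndecr yB); rewrite ?(ltW w0)// ge_min lexx orbT.
    by apply: le_lt_trans Su0; apply: hinges_nd; rewrite ge_min lexx.
  have k0 : 0 <= k by rewrite -kw adde_ge0 ?hinges_ge0// Bp// ltW.
  have [x x0 Bx] := young_pos yB.
  have kp : 0 < k by rewrite -(Hk x x0) (lt_le_trans Bx)// leeDl// hinges_ge0.
  have h1 : B (w / 2)%R <= 2^-1%:E * B w.
    rewrite mulrC; apply: (young_scale yB); last exact: ltW.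
    by rewrite invr_ge0 ler0n/= invf_le1// ler1n.
  have h2 : hinges (w / 2)%R <= 2^-1%:E * hinges w.
    have := @hinges_convex w 0%R 2^-1%R; rewrite mulr0 addr0 hinges0 mule0 adde0.
    by rewrite mulrC; apply; rewrite invr_ge0 ler0n/= invf_le1// ler1n.
  have : k <= 2^-1%:E * k.
    by rewrite -{1}kw2 -kw ge0_muleDr ?hinges_ge0 ?Bp ?(ltW w0)// leeD.
  move: kfin k0 kp; case: (k) => [r||]// _ _; rewrite lte_fin => r0.
  by rewrite -EFinM lee_fin; lra.
Qed.

End hinge_series.

Section series_bounds.
Context {R : realType}.

Lemma sum_halves N : (\sum_(0 <= j < N) (2 ^+ j)^-1 <= 2 :> R)%R.
Proof.
suff : (\sum_(0 <= j < N) (2 ^+ j)^-1 = 2 - 2 / 2 ^+ N :> R)%R.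
  by move=> ->; rewrite gerBl divr_ge0// exprn_ge0.
elim: N => [|N IH]; first by rewrite big_geq// expr0 divr1 subrr.
rewrite big_nat_recr//= IH exprS; field.
by rewrite expf_neq0.
Qed.

Lemma nneseries_halves (m : R) : (0 <= m)%R ->
  \sum_(0 <= j <oo) ((2 ^+ j)^-1 * m)%:E <= (2 * m)%:E.
Proof.
move=> m0; apply: nneseries_ub => [j|N].
  by rewrite lee_fin mulr_ge0// invr_ge0 exprn_ge0.
by rewrite sumEFin lee_fin -mulr_suml; apply: ler_wpM2r => //; exact: sum_halves.
Qed.

Lemma nneseries_geometric (q m : R) : (0 <= q < 1)%R -> (0 <= m)%R ->
  \sum_(0 <= j <oo) (m * q ^+ j)%:E <= (m / (1 - q))%:E.
Proof.
move=> /andP[q0 q1] m0; have q' : (0 < 1 - q)%R by rewrite subr_gt0.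
apply: nneseries_ub => [j|N]; first by rewrite lee_fin mulr_ge0// exprn_ge0.
rewrite sumEFin lee_fin -mulr_sumr; apply: ler_wpM2l => //.
rewrite -[leRHS]mul1r ler_pdivlMr//.
suff -> : ((\sum_(0 <= j < N) q ^+ j) * (1 - q) = 1 - q ^+ N)%R.
  by rewrite gerBl exprn_ge0.
elim: N => [|N IH]; first by rewrite big_geq// mul0r expr0 subrr.
by rewrite big_nat_recr//= mulrDl IH exprS; ring.
Qed.

End series_bounds.

(** * Adding hinges to an admissible target *)

Section smaller_target.
Context {R : realType} (n : nat) (gamma : R) (A B : R -> \bar R).
Hypothesis gamma_gt0 : (0 < gamma)%R.
Hypothesis gamma_lt : (gamma < n%:R)%R.
Hypothesis yA : young A.
Hypothesis growth : growth_cond n gamma A.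
Hypothesis yB : young B.
Let al := (gamma / n%:R)%R.
Let be := beta n gamma.
Local Notation G := (Gr n gamma A).
Local Notation Gi := (Gi n gamma A).
Let GP := G_gt0 gamma_gt0 gamma_lt yA growth.

Variables (t g : nat -> R).
Hypothesis t0 : forall j, (0 < t j)%R.
Hypothesis g0 : forall j, (0 < g j)%R.
Hypothesis gE : forall j, Gi (t j) = (g j)%:E.
Hypothesis small : forall j, B (2 * j.+1%:R * t j)%R <= ((4 ^+ j)^-1 * g j)%:E.

(** Chosen so that the [j]-th hinge reaches [2^{-j} Gi (t j)] at the point [2 * t j]. *)
Definition slope (j : nat) : R := ((2 ^+ j)^-1 * g j / t j)%R.

Lemma slope_ge0 j : (0 <= slope j)%R.
Proof. by rewrite divr_ge0 ?mulr_ge0 ?invr_ge0 ?exprn_ge0// ltW. Qed.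

Definition target (u : R) : \bar R := B u + hinges slope t u.

(** Beyond [t j] the hinge is at most [2^{-j} (u / t j) Gi (t j)], and [Gi u / u] is nondecreasing.
    Hence the series of hinges is finite wherever [Gi] is. *)
Lemma hinge_le_Gi j u m : (0 < u)%R -> Gi u <= m%:E -> (hinge slope t j u <= (2 ^+ j)^-1 * m)%R.
Proof.
move=> u0 um; have p2 : (0 < 2 ^+ j :> R)%R by rewrite exprn_gt0.
have m0 : (0 <= m)%R by rewrite -lee_fin (le_trans _ um)// Gi_ge0.
have [ut|tu] := leP u (t j).
  by rewrite hinge0// mulr_ge0// invr_ge0 ltW.
rewrite /hinge max_r ?subr_ge0 ?(ltW tu)//.
have h : (u / t j * g j <= m)%R.
  rewrite -lee_fin; apply: le_trans um; rewrite EFinM -gE.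
  have := @Gi_scale1 _ _ _ _ gamma_gt0 gamma_lt yA growth (u / t j)%R (t j) _ (t0 j).
  by rewrite divfK ?gt_eqF//; apply; rewrite ler_pdivlMr// mul1r ltW.
apply: (@le_trans _ _ ((2 ^+ j)^-1 * (u / t j * g j))%R); last first.
  by apply: ler_wpM2l => //; rewrite invr_ge0 ltW.
rewrite /slope; have -> : ((2 ^+ j)^-1 * g j / t j * (u - t j) =
  (2 ^+ j)^-1 * (u / t j * g j) - (2 ^+ j)^-1 * g j)%R.
  by field; rewrite !gt_eqF.
by rewrite gerBl mulr_ge0// ?invr_ge0 ltW.
Qed.

Lemma young_target : young target.
Proof.
apply: young_add_hinges => //; first exact: slope_ge0.
have u0 : (0 < G 1 / 2)%R by rewrite divr_gt0// GP.
exists (G 1 / 2)%R => //.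
have G1 : Gi (G 1 / 2)%R <= 1%:E.
  by apply: Gi_le => //; have := GP ltr01; lra.
apply: (@le_lt_trans _ _ (2 * 1)%:E); last exact: ltry.
apply: le_trans (nneseries_halves ler01).
apply: lee_nneseries => [j _ _|j _]; rewrite lee_fin.
  by apply: hinge_ge0; exact: slope_ge0.
exact: hinge_le_Gi.
Qed.

Lemma target_ge u : B u <= target u.
Proof. by rewrite leeDl// hinges_ge0// => j; exact: slope_ge0. Qed.

(** A dyadic majorant of the [j]-th hinge at [y / 4]: for arguments between [2^i t j] and
    [2^{i+1} t j] the hinge is at most the weight of index [i]. The factor 4 in the levels matches
    [weak_hinge]. *)
Definition hinge_layers (j : nat) (y : \bar R) : \bar R :=
  \sum_(0 <= i <oo) (if (4 * (2 ^+ i * t j))%:E < y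
     then (2 ^+ i.+1 * ((2 ^+ j)^-1 * g j))%:E else 0).

Let wj0 j : (0 <= (2 ^+ j)^-1 * g j)%R.
Proof. by rewrite mulr_ge0// ?invr_ge0 ?exprn_ge0// ltW. Qed.

Let ci0 i j : (0 <= 2 ^+ i.+1 * ((2 ^+ j)^-1 * g j))%R.
Proof. by rewrite mulr_ge0// exprn_ge0. Qed.

Lemma hinge_layers_ge0 j y : 0 <= hinge_layers j y.
Proof. by apply: nneseries_ge0 => i _ _; case: ifPn; rewrite // lee_fin. Qed.

Lemma hinge_le_layers j (y K : R) : (4 <= K)%R -> (0 <= y)%R ->
  (hinge slope t j (y / K))%:E <= hinge_layers j y%:E.
Proof.
move=> K4 y0; have K0 : (0 < K)%R by exact: lt_le_trans K4.
have [ut|tu] := leP (y / K)%R (t j).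
  by rewrite hinge0// hinge_layers_ge0.
have k2 : (1 < 2 :> R)%R by rewrite ltr1n.
have u1 : (1 < y / K / t j)%R by rewrite ltr_pdivlMr// mul1r.
have [i /andP[iu ui]] := exp_bracket_ge1 k2 u1.
apply: le_trans (nneseries_term i _); last by move=> k; case: ifPn; rewrite // lee_fin.
rewrite ifT; last first.
  rewrite lte_fin; move: iu; rewrite ltr_pdivlMr// ltr_pdivlMr// => iu.
  have p : (0 < 2 ^+ i * t j)%R by rewrite mulr_gt0// exprn_gt0.
  apply: le_lt_trans iu; rewrite mulrC; apply: ler_wpM2l => //; exact: ltW.
rewrite lee_fin /hinge max_r ?subr_ge0 ?(ltW tu)//.
apply: (@le_trans _ _ (slope j * (y / K))%R).
  by apply: ler_wpM2l; [exact: slope_ge0|rewrite gerBl ltW].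
rewrite /slope [leLHS](_ : _ = (2 ^+ j)^-1 * g j * (y / K / t j))%R; last by ring.
by rewrite [leRHS]mulrC; apply: ler_wpM2l.
Qed.

Lemma target_le_layers (K1 K : R) (y : \bar R) : (4 <= K)%R -> (0 < K1)%R -> (K1 <= K)%R -> 0 <= y ->
  at_ereal target (y / K%:E) <= at_ereal B (y / K1%:E) + \sum_(0 <= j <oo) hinge_layers j y.
Proof.
move=> K4 K10 K1K y0; have K0 : (0 < K)%R by exact: lt_le_trans K4.
have S0 : 0 <= \sum_(0 <= j <oo) hinge_layers j y.
  by apply: nneseries_ge0 => j _ _; exact: hinge_layers_ge0.
case: y y0 S0 => [y||] //; last first.
  move=> _ S0; rewrite !divEFin// !gt0_muley ?lte_fin ?invr_gt0//=.
  by rewrite leeDl.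
rewrite lee_fin => y0 S0; rewrite !divEFin// -!EFinM /= ![(_^-1 * y)%R]mulrC.
apply: leeD.
  apply: (young_ndecr yB); first by rewrite divr_ge0// ltW.
  by apply: ler_wpM2l => //; rewrite lef_pV2.
apply: lee_nneseries => [j _ _|j _]; last exact: hinge_le_layers.
by rewrite lee_fin hinge_ge0//; exact: slope_ge0.
Qed.

Variable f : Rn R n -> \bar R.
Hypothesis mf : measurable_fun [set: Rn R n] f.
Hypothesis Af : \int[leb R n]_x at_ereal A `|f x| <= 1.

(** By [Gi_scale], [tau = (2^i)^{be} g j / 2] lies strictly below [Gi (2^i t j)], so
    [G tau <= 2^i t j]. Then [weak_frac_max] applies with [lam = 2 (2^i t j)]. *)
Lemma weak_hinge i j :
  leb R n [set x | (4 * (2 ^+ i * t j))%:E < frac_max gamma f x] <=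
  (2 * 3 ^+ n / ((2 ^+ i) `^ be * g j))%:E.
Proof.
have p2 : (0 < 2 ^+ i :> R)%R by rewrite exprn_gt0.
have pb : (0 < (2 ^+ i) `^ be)%R by rewrite powR_gt0.
pose tau := ((2 ^+ i) `^ be * g j / 2)%R.
have tau0 : (0 < tau)%R by rewrite divr_gt0// mulr_gt0.
have lam0 : (0 < 2 ^+ i * t j)%R by rewrite mulr_gt0.
have tauG : tau%:E < Gi (2 ^+ i * t j)%R.
  have i1 : (1 <= 2 ^+ i :> R)%R by rewrite exprn_ege1// ler1n.
  apply: lt_le_trans (Gi_scale gamma_gt0 gamma_lt yA growth i1 (t0 j)).
  rewrite gE -EFinM lte_fin /tau ltr_pdivrMr// ltr_pMr ?ltr1n//.
  exact: mulr_gt0.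
have Gtau := lt_Gi gamma_gt0 gamma_lt yA growth tau0 tauG.
have H s : (0 < s)%R -> (s <= tau)%R -> (psi n gamma A s < 2 * (2 ^+ i * t j))%R.
  move=> s0 st; apply: le_lt_trans (psi_le_G gamma_gt0 gamma_lt yA growth s0 st) _.
  by apply: le_lt_trans Gtau _; rewrite ltr_pMl// ltr1n.
have := weak_frac_max gamma_gt0 gamma_lt yA mf Af tau0 H.
rewrite (_ : 2 * (2 * (2 ^+ i * t j)) = 4 * (2 ^+ i * t j))%R; last by ring.
move/le_trans; apply; rewrite lee_fin.
rewrite (_ : 3 ^+ n / tau = 2 * 3 ^+ n / ((2 ^+ i) `^ be * g j))%R; first exact: lexx.
by rewrite /tau; field; rewrite !gt_eqF.
Qed.

Let q : R := (2 `^ (1 - be))%R.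

Lemma q_ge0_lt1 : (0 <= q < 1)%R.
Proof.
rewrite powR_ge0/= /q -opprB powRN invf_lt1 ?powR_gt0//.
have one : (1 `^ (be - 1) = 1 :> R)%R by rewrite powR1.
rewrite -[ltLHS]one; apply: gt0_ltr_powR; rewrite ?nnegrE ?ltr1n//.
by rewrite subr_gt0; exact: beta_gt1.
Qed.

(** The factor [g j] cancels between weight and measure, leaving [2^i / (2^i)^{be} = q^i]. Since
    [be > 1], the series converges. *)
Lemma integral_hinge_layers j :
  \int[leb R n]_x hinge_layers j (frac_max gamma f x) <=
  ((2 ^+ j)^-1 * (4 * 3 ^+ n / (1 - q)))%:E.
Proof.
rewrite integral_layers; [|by []|exact: measurable_frac_max].
apply: (@le_trans _ _ (\sum_(0 <= i <oo) (((2 ^+ j)^-1 * (4 * 3 ^+ n)) * q ^+ i)%:E)).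
  apply: lee_nneseries => [i _ _|i _]; first by rewrite mule_ge0// lee_fin.
  apply: (le_trans (lee_wpmul2l _ (weak_hinge i j))); first by rewrite lee_fin.
  rewrite -EFinM lee_fin.
  have -> : (q ^+ i = 2 ^+ i / (2 ^+ i) `^ be)%R.
    have p2 : (0 < 2 ^+ i :> R)%R by rewrite exprn_gt0.
    rewrite -{1}(powRr1 (ltW p2)) -powRB ?(gt_eqF p2) ?implybT//.
    by rewrite /q -(powR_mulrn i (powR_ge0 _ _)) powRAC powR_mulrn.
  rewrite le_eqVlt; apply/orP; left; apply/eqP.
  rewrite exprS; field.
  by rewrite expf_neq0//= !gt_eqF// powR_gt0// exprn_gt0.
rewrite [X in _ <= X%:E]mulrA; apply: nneseries_geometric; first exact: q_ge0_lt1.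
by rewrite mulr_ge0// ?invr_ge0 ?mulr_ge0 ?exprn_ge0.
Qed.

Lemma integral_target (K1 K : R) : (4 <= K)%R -> (0 < K1)%R -> (K1 <= K)%R ->
  \int[leb R n]_x at_ereal B (frac_max gamma f x / K1%:E) <= 1 ->
  \int[leb R n]_x at_ereal target (frac_max gamma f x / K%:E) <=
  (1 + 2 * (4 * 3 ^+ n / (1 - q)))%:E.
Proof.
move=> K4 K10 K1K HB; have K0 : (0 < K)%R by exact: lt_le_trans K4.
have mM := measurable_frac_max gamma f.
have dM0 k x : (0 < k)%R -> 0 <= frac_max gamma f x / k%:E.
  by move=> k0; rewrite mule_ge0 ?frac_max_ge0// inve_ge0 lee_fin ltW.
have mB : measurable_fun [set: Rn R n] (fun x => at_ereal B (frac_max gamma f x / K1%:E)).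
  apply: measurable_at_ereal; first exact: young_ndecr.
    by move=> x; exact: dM0.
  rewrite (_ : (fun x => _) = (fun x => (K1^-1)%:E * frac_max gamma f x)).
    exact: measurable_funeM.
  by apply/funext => x; rewrite divEFin.
have mh j : measurable_fun [set: Rn R n] (fun x => hinge_layers j (frac_max gamma f x)).
  exact: measurable_layers.
have mS : measurable_fun [set: Rn R n]
    (fun x => \sum_(0 <= j <oo) hinge_layers j (frac_max gamma f x)).
  apply: (ge0_emeasurable_sum (P := xpredT)) => [j x _ _|j _]; last exact: mh.
  exact: hinge_layers_ge0.
apply: (@le_trans _ _ (\int[leb R n]_x (at_ereal B (frac_max gamma f x / K1%:E) +
   \sum_(0 <= j <oo) hinge_layers j (frac_max gamma f x)))).
  apply: nneg_le_integral => x _; last first.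
    by apply: target_le_layers => //; exact: frac_max_ge0.
  by apply: at_ereal_ge0; [exact: young_nneg young_target|exact: dM0].
rewrite ge0_integralD; last 5 first.
- exact: measurableT.
- by move=> x _; apply: at_ereal_ge0; [exact: young_nneg|exact: dM0].
- exact: mB.
- by move=> x _; apply: nneseries_ge0 => j _ _; exact: hinge_layers_ge0.
- exact: mS.
rewrite EFinD; apply: leeD; first exact: HB.
rewrite integral_nneseries; last 3 first.
- exact: measurableT.
- exact: mh.
- by move=> j x _; exact: hinge_layers_ge0.
have q1 : (0 <= 4 * 3 ^+ n / (1 - q))%R.
  have /andP[_ ?] := q_ge0_lt1.
  by rewrite divr_ge0// ?subr_ge0 ?mulr_ge0 ?exprn_ge0// ltW.
apply: le_trans (nneseries_halves q1).
apply: lee_nneseries => [j _ _|j _]; last exact: integral_hinge_layers.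
by apply: integral_ge0 => x _; exact: hinge_layers_ge0.
Qed.

End smaller_target.

Lemma modular_bounded_target {R : realType} (n : nat) (gamma : R) (A B : R -> \bar R)
    (t g : nat -> R) (K1 : R) :
  (0 < gamma)%R -> (gamma < n%:R)%R -> young A -> growth_cond n gamma A -> young B ->
  (forall j, 0 < t j)%R -> (forall j, 0 < g j)%R ->
  (forall j, Gi n gamma A (t j) = (g j)%:E) ->
  (0 < K1)%R -> modular_bounded n gamma A B K1 ->
  frac_max_bounded n gamma A (target B t g).
Proof.
move=> gamma_gt0 gamma_lt yA growth yB t0 g0 gE K10 HB.
have yT := young_target gamma_gt0 gamma_lt yA growth yB t0 g0 gE.
pose K := (4 + K1)%R; have K4 : (4 <= K)%R by rewrite /K; lra.
have K1K : (K1 <= K)%R by rewrite /K; lra.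
have K0 : (0 < K)%R by exact: lt_le_trans K4.
pose q : R := (2 `^ (1 - beta n gamma))%R.
have /andP[q0 q1] : (0 <= q < 1)%R by exact: q_ge0_lt1.
(* The bound of [integral_target]. Convexity gives [target (u / D) <= target u / D], so enlarging
   the scale by [D] brings the modular below 1. *)
pose D := (1 + 2 * (4 * 3 ^+ n / (1 - q)))%R.
have E0 : (0 <= 4 * 3 ^+ n / (1 - q))%R.
  by rewrite divr_ge0// ?subr_ge0 ?mulr_ge0 ?exprn_ge0// ltW.
have D1 : (1 <= D)%R by rewrite /D; lra.
have D0 : (0 < D)%R by exact: lt_le_trans D1.
apply: (@modular_bounded_frac_max _ _ _ A (target B t g) (K * D)%R).
- exact: young_nneg.
- exact: young_ndecr.
- exact: mulr_gt0.
move=> f mf Af.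
have dM0 k x : (0 < k)%R -> 0 <= frac_max gamma f x / k%:E.
  by move=> k0; rewrite mule_ge0 ?frac_max_ge0// inve_ge0 lee_fin ltW.
have mT : measurable_fun [set: Rn R n] (fun x => at_ereal (target B t g) (frac_max gamma f x / K%:E)).
  apply: measurable_at_ereal; first exact: young_ndecr.
    by move=> x; exact: dM0.
  rewrite (_ : (fun x => _) = (fun x => (K^-1)%:E * frac_max gamma f x)).
    by apply: measurable_funeM; exact: measurable_frac_max.
  by apply/funext => x; rewrite divEFin.
apply: (@le_trans _ _ (\int[leb R n]_x (D^-1%:E * at_ereal (target B t g) (frac_max gamma f x / K%:E)))).
  apply: nneg_le_integral => x _.
    by apply: at_ereal_ge0; [exact: young_nneg|apply: dM0; exact: mulr_gt0].
  have -> : frac_max gamma f x / (K * D)%:E = D^-1%:E * (frac_max gamma f x / K%:E).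
    by rewrite !divEFin ?mulr_gt0// muleA -EFinM -invfM mulrC.
  have := dM0 K x K0; case: (_ / K%:E) => [r||] //.
    rewrite lee_fin -EFinM /= => r0; apply: (young_scale yT) => //.
    by rewrite invr_ge0 (ltW D0) invf_le1.
  by rewrite !gt0_muley ?lte_fin ?invr_gt0.
rewrite ge0_integralZl; last 4 first.
- exact: measurableT.
- exact: mT.
- by move=> x _; apply: at_ereal_ge0; [exact: young_nneg|exact: dM0].
- by rewrite lee_fin invr_ge0 ltW.
rewrite lee_pdivrMl// mule1.
exact: (integral_target gamma_gt0 gamma_lt yA growth yB t0 g0 gE mf Af K4 K10 K1K (HB f mf Af)).
Qed.

(** * A function separating the two Orlicz spaces *)

Section strict_inclusion.
Context {R : realType} (n : nat) (A B : R -> \bar R).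
Hypothesis n0 : (0 < n)%N.
Hypothesis yB : young B.
Variables (t g : nat -> R).
Hypothesis t0 : forall j, (0 < t j)%R.
Hypothesis g0 : forall j, (0 < g j)%R.
Hypothesis small : forall j, B (2 * j.+1%:R * t j)%R <= ((4 ^+ j)^-1 * g j)%:E.

(* Nested cubes with volumes [vol j]; the function equal to [2 * j.+1 * t j] on the
   j-th shell, of volume 2^j / g j, separates the two Orlicz spaces. *)
Definition vol (j : nat) : R := (1 + \sum_(0 <= i < j) 2 ^+ i / g i)%R.

Definition shell (j : nat) : set (Rn R n) := vcube (vol j.+1) `\` vcube (vol j).

Definition shell_height (j : nat) : R := (2 * j.+1%:R * t j)%R.

Definition shell_fun (x : Rn R n) : \bar R :=
  \sum_(0 <= j <oo) ((cst (shell_height j)%:E) \_ (shell j)) x.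

Lemma volS j : vol j.+1 = (vol j + 2 ^+ j / g j)%R.
Proof. by rewrite /vol big_nat_recr//= addrA. Qed.

Lemma shell_vol_gt0 j : (0 < 2 ^+ j / g j)%R.
Proof. by rewrite divr_gt0// exprn_gt0. Qed.

Lemma vol_gt0 j : (0 < vol j)%R.
Proof.
elim: j => [|j IH]; first by rewrite /vol big_geq// addr0.
by rewrite volS addr_gt0// shell_vol_gt0.
Qed.

Lemma vol_le i j : (i <= j)%N -> (vol i <= vol j)%R.
Proof.
elim: j => [|j IH]; first by rewrite leqn0 => /eqP->.
rewrite leq_eqVlt => /orP[/eqP->//|]; rewrite ltnS => /IH/le_trans; apply.
by rewrite volS lerDl ltW// shell_vol_gt0.
Qed.

Lemma measurable_shell j : measurable (shell j).
Proof. by apply: measurableD; exact: measurable_vcube. Qed.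

Lemma leb_shell j : leb R n (shell j) = (2 ^+ j / g j)%:E.
Proof.
rewrite leb_vcubeD//; first by rewrite volS addrAC subrr add0r.
  exact: vol_gt0.
exact: vol_le.
Qed.

Lemma shell_inj i j x : shell i x -> shell j x -> i = j.
Proof.
have h k l : (k < l)%N -> shell k x -> shell l x -> False.
  move=> kl [xk _] [_]; apply; move: xk; apply: vcube_sub; first exact: vol_gt0.
  exact: vol_le.
move=> si sj; have [ij|ji|] := ltngtP i j => //.
  by case: (h _ _ ij si sj).
by case: (h _ _ ji sj si).
Qed.

Lemma nneseries_single (u : nat -> \bar R) k : (forall j, 0 <= u j) ->
  (forall j, j != k -> u j = 0) -> \sum_(0 <= j <oo) u j = u k.
Proof.
move=> u0 uk; apply/eqP; rewrite eq_le; apply/andP; split; last exact: nneseries_term.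
apply: nneseries_ub => // N; elim: N => [|N IH]; first by rewrite big_geq.
rewrite big_nat_recr /=; last by [].
have [Nk|Nk] := eqVneq N k; last by move: IH; rewrite (uk N Nk) addr0.
rewrite Nk big_nat big1 ?add0r// => i /andP[_ ik]; apply: uk.
by rewrite ltn_eqF.
Qed.

Lemma shell_series (c : nat -> \bar R) j x : (forall i, 0 <= c i) -> shell j x ->
  \sum_(0 <= i <oo) ((cst (c i)) \_ (shell i)) x = c j.
Proof.
move=> c0 xj; rewrite (nneseries_single (k := j)).
- by rewrite /patch mem_set.
- by move=> i; rewrite /patch; case: ifPn => _ /=.
- move=> i ij; rewrite /patch; case: ifPn => // /set_mem xi.
  by move: ij; rewrite (shell_inj xi xj) eqxx.
Qed.

Lemma shell_series_out (c : nat -> \bar R) x : (forall j, ~ shell j x) ->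
  \sum_(0 <= i <oo) ((cst (c i)) \_ (shell i)) x = 0.
Proof.
move=> H; apply: eseries0 => j _ _; rewrite /patch; case: ifPn => // /set_mem.
by move/H.
Qed.

Lemma integral_shell_series (c : nat -> \bar R) : (forall i, 0 <= c i) ->
  \int[leb R n]_x (\sum_(0 <= i <oo) ((cst (c i)) \_ (shell i)) x) =
  \sum_(0 <= i <oo) (c i * (2 ^+ i / g i)%:E).
Proof.
move=> c0; rewrite integral_nneseries; last 3 first.
- exact: measurableT.
- by move=> i; apply/(measurable_restrictT _ (measurable_shell i)).1.
- by move=> i x _; rewrite /patch; case: ifPn => _ /=.
apply: eq_eseriesr => i _; rewrite -leb_shell -integral_leb_cst; last exact: measurable_shell.
by rewrite [RHS]integral_mkcond.
Qed.

Lemma shell_height_gt0 j : (0 < shell_height j)%R.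
Proof. by rewrite !mulr_gt0// ltr0n. Qed.

Lemma measurable_shell_fun : measurable_fun [set: Rn R n] shell_fun.
Proof.
apply: (ge0_emeasurable_sum (P := xpredT)) => [i x _ _|i _].
  by rewrite /patch; case: ifPn; rewrite // lee_fin ltW// shell_height_gt0.
by apply/(measurable_restrictT _ (measurable_shell i)).1.
Qed.

Lemma shell_fun_in j x : shell j x -> shell_fun x = (shell_height j)%:E.
Proof.
by move=> xj; rewrite /shell_fun (shell_series _ xj)// => i; rewrite lee_fin ltW// shell_height_gt0.
Qed.

(** The [j]-th shell contributes at most [4^{-j} g j * 2^j / g j = 2^{-j}] to the modular of [B] at
    scale 1. *)
Lemma shell_fun_orlicz : orlicz n B shell_fun.
Proof.
split; first exact: measurable_shell_fun.
exists 1%R; split => //.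
have Bh0 i : 0 <= B (shell_height i) by apply: (young_nneg yB); rewrite ltW// shell_height_gt0.
apply: (@le_lt_trans _ _ (\int[leb R n]_x
   (\sum_(0 <= i <oo) ((cst (B (shell_height i))) \_ (shell i)) x))).
  apply: nneg_le_integral => x _.
    by apply: at_ereal_ge0; [exact: young_nneg|exact: abse_div_ge0].
  rewrite divEFin// invr1 mul1e.
  have [[j xj]|H] := pselect (exists j, shell j x).
    by rewrite (shell_series _ xj)// (shell_fun_in xj) gee0_abs//= lee_fin ltW// shell_height_gt0.
  have H' j : ~ shell j x by move=> xj; apply: H; exists j.
  by rewrite /shell_fun !shell_series_out// abse0/= young0.
rewrite integral_shell_series//.
apply: (@le_lt_trans _ _ (2 * 1)%:E); last exact: ltry.
apply: le_trans (nneseries_halves ler01).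
apply: lee_nneseries => [i _ _|i _].
  by rewrite mule_ge0// lee_fin ltW// shell_vol_gt0.
apply: (@le_trans _ _ (((4 ^+ i)^-1 * g i)%:E * (2 ^+ i / g i)%:E)).
  by apply: lee_wpmul2r; [rewrite lee_fin ltW// shell_vol_gt0|exact: small].
rewrite -EFinM lee_fin mulr1.
have -> : (4 ^+ i = 2 ^+ i * 2 ^+ i :> R)%R by rewrite -exprMn -natrM.
rewrite [leLHS](_ : _ = (2 ^+ i)^-1)%R ?lexx//.
by field; rewrite expf_neq0//= gt_eqF.
Qed.

(** Once [j] exceeds [lam], the height divided by [lam] is at least [2 * t j], where the [j]-th
    hinge equals [2^{-j} g j]. Each such shell therefore contributes at least 1 to the modular. *)
Lemma shell_fun_not_target : ~ orlicz n (target B t g) shell_fun.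
Proof.
move=> [_ [lam [lam0]]]; apply/negP; rewrite -leNgt.
have T0 u : (0 <= u)%R -> 0 <= target B t g u.
  move=> u0; rewrite adde_ge0 ?(young_nneg yB)// hinges_ge0// => j; exact: slope_ge0.
pose N0 := (Num.truncn lam).+1.
have lamN : (lam <= N0%:R)%R by apply: ltW; exact: truncnS_gt.
pose c i : \bar R := if (N0 <= i)%N then ((2 ^+ i)^-1 * g i)%:E else 0.
have c0 i : 0 <= c i.
  by rewrite /c; case: ifPn => // _; rewrite lee_fin mulr_ge0 ?invr_ge0 ?exprn_ge0// ltW.
apply: (@le_trans _ _ (\int[leb R n]_x (\sum_(0 <= i <oo) ((cst (c i)) \_ (shell i)) x))).
  rewrite integral_shell_series//.
  rewrite leye_eq; apply/eqP/eqyP => M M0.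
  pose N1 := (Num.truncn M).+1.
  apply: le_trans (nneseries_lim_ge (N0 + N1) _); last first.
    by move=> i _ _; rewrite mule_ge0// lee_fin ltW// shell_vol_gt0.
  apply: (@le_trans _ _ (\sum_(N0 <= i < N0 + N1) (1 : R)%:E)).
    by rewrite sumEFin sumr_const_nat addKn lee_fin ltW// truncnS_gt.
  rewrite (@big_cat_nat _ _ _ N0 0 (N0 + N1))//= ?leq_addr//.
  apply: (@le_trans _ _ (\sum_(N0 <= i < N0 + N1) c i * (2 ^+ i / g i)%:E)); last first.
    by rewrite leeDr// sume_ge0// => i _; rewrite mule_ge0// lee_fin ltW// shell_vol_gt0.
  rewrite big_nat [leRHS]big_nat; apply: lee_sum => i /andP[iN _].
  rewrite /c iN -EFinM lee_fin.
  rewrite (_ : (2 ^+ i)^-1 * g i * (2 ^+ i / g i) = 1)%R ?lexx//.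
  by field; rewrite expf_neq0//= gt_eqF.
apply: nneg_le_integral => x _.
  by apply: nneseries_ge0 => i _ _; rewrite /patch; case: ifPn => _ /=.
have [[j xj]|H] := pselect (exists j, shell j x); last first.
  have H' j : ~ shell j x by move=> xj; apply: H; exists j.
  by rewrite shell_series_out// at_ereal_ge0// abse_div_ge0.
rewrite (shell_series _ xj)// (shell_fun_in xj).
rewrite gee0_abs ?lee_fin ?(ltW (shell_height_gt0 j))// divEFin// -EFinM /=.
have h0 : (0 <= lam^-1 * shell_height j)%R by rewrite mulr_ge0 ?invr_ge0 ?ltW// shell_height_gt0.
rewrite /c; case: ifPn => jN; last exact: T0.
have s0 i : (0 <= slope t g i)%R by exact: slope_ge0.
apply: (@le_trans _ _ (hinges (slope t g) t (lam^-1 * shell_height j))); last first.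
  by rewrite /target leeDr//; exact: (young_nneg yB).
apply: (@le_trans _ _ (hinge (slope t g) t j (2 * t j))%:E).
  rewrite lee_fin /hinge max_r; last by rewrite mulr_natl mulr2n addrK ltW.
  rewrite /slope [leRHS](_ : _ = (2 ^+ j)^-1 * g j)%R ?lexx//.
  by field; apply/andP; split; [rewrite expf_neq0|rewrite gt_eqF].
apply: le_trans (nneseries_term j _); last by move=> i; rewrite lee_fin hinge_ge0.
rewrite lee_fin; apply: hinge_nd => //.
rewrite ler_pdivlMl// /shell_height mulrA (mulrC lam).
rewrite ler_pM2r// ler_pM2l//; apply: le_trans lamN _.
by rewrite ler_nat ltnW.
Qed.

Lemma orlicz_target_proper : orlicz n (target B t g) `<` orlicz n B.
Proof.
split; last by move=> /(_ _ shell_fun_orlicz); exact: shell_fun_not_target.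
move=> f [mf [lam [lam0 fl]]]; split => //; exists lam; split => //.
apply: le_lt_trans fl; apply: nneg_le_integral => x _.
  by apply: at_ereal_ge0; [exact: young_nneg|exact: abse_div_ge0].
case: (_ / _) => [r||] //=; apply: target_ge => //.
Qed.

End strict_inclusion.

Lemma no_optimal_target {R : realType} (n : nat) (gamma : R) (A B : R -> \bar R) :
  (0 < gamma)%R -> (gamma < n%:R)%R -> young A -> growth_cond n gamma A ->
  ~ dilation_gain (1 - gamma / n%:R) (Gr n gamma A) ->
  young B -> frac_max_bounded n gamma A B ->
  exists B1 : R -> \bar R,
    [/\ young B1, orlicz n B1 `<` orlicz n B & frac_max_bounded n gamma A B1].
Proof.
move=> gamma_gt0 gamma_lt yA growth ng yB bdd.
have [K K0 HB] := frac_max_bounded_modular (young_nneg yB) (young_ndecr yB) bdd.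
(* The factor [2 * j.+1] defeats every scale [lam] in [shell_fun_not_target]; the factor [4^{-j}]
   outweighs the shell volumes [2^j / g j] in [shell_fun_orlicz]. *)
have /choice[t tP] : forall j : nat, exists t : R, [/\ (0 < t)%R, 0 < Gi n gamma A t,
    Gi n gamma A t < +oo & B (2 * j.+1%:R * t)%R <= ((4 ^+ j)^-1)%:E * Gi n gamma A t].
  move=> j; apply: (small_ratio gamma_gt0 gamma_lt yA growth yB K0 HB ng) => //.
pose g j := fine (Gi n gamma A (t j)).
have gE j : Gi n gamma A (t j) = (g j)%:E.
  by have [_ h1 h2 _] := tP j; rewrite fineK// ge0_fin_numE// ltW.
have t0 j : (0 < t j)%R by case: (tP j).
have g0 j : (0 < g j)%R by have [_ + _ _] := tP j; rewrite gE lte_fin.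
have small j : B (2 * j.+1%:R * t j)%R <= ((4 ^+ j)^-1 * g j)%:E.
  by have [_ _ _] := tP j; rewrite gE.
exists (target B t g); split.
- exact: (young_target gamma_gt0 gamma_lt yA growth yB t0 g0 gE).
- apply: orlicz_target_proper => //; exact: n_gt0 gamma_gt0 gamma_lt.
- exact: (modular_bounded_target gamma_gt0 gamma_lt yA growth yB t0 g0 gE K0 HB).
Qed.

(** * Boyd indices *)

Section boyd_indices.
Context {R : realType} (F : R -> \bar R) (phi : R -> R).
Hypothesis phiE : forall s, (0 < s)%R -> ginv F s = (phi s)%:E.
Hypothesis phi_gt0 : forall s, (0 < s)%R -> (0 < phi s)%R.
Hypothesis phi_nd : forall s t, (0 < s)%R -> (s <= t)%R -> (phi s <= phi t)%R.

Lemma boyd_hE t : (0 < t)%R ->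
  boyd_h F t = ereal_sup [set (phi (s * t) / phi s)%:E | s in `]0%R, +oo[].
Proof.
move=> t0; congr ereal_sup; apply: eq_imagel => s /=.
rewrite in_itv/= andbT => s0.
by rewrite !phiE ?mulr_gt0// divEFin ?phi_gt0// -EFinM mulrC.
Qed.

Lemma boyd_h_ge s t : (0 < s)%R -> (0 < t)%R -> (phi (s * t) / phi s)%:E <= boyd_h F t.
Proof.
move=> s0 t0; rewrite boyd_hE//; apply: ereal_sup_ubound; exists s => //.
by rewrite /= in_itv/= s0.
Qed.

Lemma boyd_h_le t th : (0 < t)%R ->
  (forall s, (0 < s)%R -> (phi (s * t) <= th * phi s)%R) -> boyd_h F t <= th%:E.
Proof.
move=> t0 H; rewrite boyd_hE//; apply: ge_ereal_sup => y [s /=].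
rewrite in_itv/= andbT => s0 <-.
by rewrite lee_fin ler_pdivrMr ?phi_gt0// H.
Qed.

Lemma boyd_h_real t r s : (0 < t)%R -> boyd_h F t = r%:E -> (0 < s)%R ->
  (phi (s * t) <= r * phi s)%R.
Proof.
by move=> t0 hr s0; rewrite -ler_pdivrMr ?phi_gt0// -lee_fin -hr; exact: boyd_h_ge.
Qed.

Lemma boyd_h_ge1 t : (1 < t)%R -> 1 <= boyd_h F t.
Proof.
move=> t1; have t0 : (0 < t)%R by exact: lt_trans t1.
apply: le_trans (boyd_h_ge ltr01 t0).
by rewrite lee_fin ler_pdivlMr ?phi_gt0// mul1r phi_nd// mul1r ltW.
Qed.

Lemma lt_powR_ln (r t e : R) : (0 < r)%R -> (0 < t)%R ->
  (r < t `^ e)%R = (ln r < e * ln t)%R.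
Proof.
by move=> r0 t0; rewrite -ln_powR ltr_ln ?posrE// powR_gt0.
Qed.

(** For [t > 1] one has [boyd_h F t >= 1], and the quotient exceeds [1/e] exactly when
    [boyd_h F t < t^e]; the convention for [boyd_h F t = 1] agrees with this. *)
Lemma boyd_lowerP e : (0 < e)%R ->
  (e^-1)%:E < boyd_lower F <-> dilation_gain e phi.
Proof.
move=> e0; split.
  move=> /ereal_sup_gt[y [t /=]]; rewrite in_itv/= andbT => t1 <-.
  have t0 : (0 < t)%R by exact: lt_trans t1.
  have h1 := boyd_h_ge1 t1.
  have lt0 : (0 < ln t)%R by rewrite ln_gt0.
  rewrite /boyd_quot; case: eqP => [hE _|hE].
    exists t, 1%R; split => //.
      by rewrite lt_powR_ln// ln1 mulr_gt0.
    by move=> s s0; rewrite mulrC; exact: boyd_h_real.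
  (* An infinite [boyd_h F t] yields the quotient 0, which does not exceed [e^-1]. *)
  case E : (boyd_h F t) h1 hE => [r||] h1 hE //; last first.
    by rewrite /= invey mule0 lte_fin ltNge ltW// invr_gt0.
  have r1 : (1 < r)%R.
    by rewrite lt_neqAle -lee_fin h1 andbT eq_sym; apply/eqP => r1; apply: hE; rewrite r1.
  have r0 : (0 < r)%R by exact: lt_trans r1.
  have lr0 : (0 < ln r)%R by rewrite ln_gt0.
  rewrite lne_EFin// divEFin// -EFinM lte_fin => h.
  exists t, r; split => //.
    rewrite lt_powR_ln//; move: h.
    by rewrite ltr_pdivlMl// ltr_pdivrMr// mulrC.
  by move=> s s0; rewrite mulrC; exact: boyd_h_real.
move=> [k [th [k1 thk H]]]; have k0 : (0 < k)%R by exact: lt_trans k1.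
have lk0 : (0 < ln k)%R by rewrite ln_gt0.
have hth : boyd_h F k <= th%:E.
  by apply: boyd_h_le => // s s0; rewrite mulrC H.
apply: (@lt_le_trans _ _ (boyd_quot F k)); last first.
  by apply: ereal_sup_ubound; exists k => //; rewrite /= in_itv/= k1.
have h1 := boyd_h_ge1 k1.
rewrite /boyd_quot; case: eqP => [_|hE]; first exact: ltry.
case E : (boyd_h F k) h1 hE hth => [r||] h1 hE //.
rewrite lee_fin => rth.
have r1 : (1 < r)%R.
  by rewrite lt_neqAle -lee_fin h1 andbT eq_sym; apply/eqP => r1; apply: hE; rewrite r1.
have r0 : (0 < r)%R by exact: lt_trans r1.
have lr0 : (0 < ln r)%R by rewrite ln_gt0.
rewrite lne_EFin// divEFin// -EFinM lte_fin.
rewrite ltr_pdivlMl// ltr_pdivrMr// [ltRHS]mulrC -lt_powR_ln//.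
exact: le_lt_trans thk.
Qed.

(* The ln of [boyd_h] is negative here, so the quotient inequality reverses. *)
Lemma boyd_upper_lt e : (0 < e)%R -> boyd_upper F < (e^-1)%:E ->
  exists t th : R, [/\ (0 < t)%R, (t < 1)%R, (th < t `^ e)%R &
    forall s, (0 < s)%R -> (phi (s * t) <= th * phi s)%R].
Proof.
move=> e0 /ereal_inf_lt[y [t /=]]; rewrite in_itv/= => /andP[t0 t1] <-.
rewrite /boyd_quot; case: eqP => [//|hE].
have h1 : boyd_h F t <= 1%:E.
  apply: boyd_h_le => // s s0; rewrite mul1r; apply: phi_nd; first exact: mulr_gt0.
  by rewrite ger_pMr// ltW.
have hge := boyd_h_ge ltr01 t0.
have p0 : (0 < phi (1 * t) / phi 1)%R by rewrite divr_gt0 ?phi_gt0// mul1r.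
case E : (boyd_h F t) h1 hE hge => [r||] h1 hE hge //.
have r0 : (0 < r)%R by rewrite (lt_le_trans p0)// -lee_fin.
have r1 : (r < 1)%R.
  rewrite lt_neqAle -lee_fin h1 andbT; apply/eqP => r1; apply: hE; by rewrite r1.
have lr0 : (ln r < 0)%R by rewrite ln_lt0// r0.
rewrite lne_EFin// inver lt_eqF// -EFinM lte_fin => h.
exists t, r; split => //; last by move=> s s0; exact: boyd_h_real.
rewrite lt_powR_ln//.
move: h; rewrite ltr_ndivrMr// ltr_pdivrMl//.
Qed.

End boyd_indices.

(** The comparison of [F1] with [F2 s * s^{-a}] loses the factor [c2 / c1] only once, while [M]
    iterations of the gain improve the exponent bound by [(k^e / th)^M], which is arbitrarily
    large. *)
Lemma dilation_gain_transfer {R : realType} (F1 F2 : R -> R) (e a c1 c2 : R) :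
  (0 < c1)%R -> (0 < c2)%R -> (forall s, 0 < s -> 0 < F2 s)%R ->
  (forall s, 0 < s -> c1 * (F2 s * s `^ (- a)) <= F1 s)%R ->
  (forall s, 0 < s -> F1 s <= c2 * (F2 s * s `^ (- a)))%R ->
  dilation_gain e F2 -> dilation_gain (e - a) F1.
Proof.
move=> c10 c20 F20 lo up [k [th [k1 thk H]]].
have k0 : (0 < k)%R by exact: lt_trans k1.
have th0 : (0 < th)%R.
  have := lt_le_trans (F20 _ (mulr_gt0 k0 ltr01)) (H 1%R ltr01).
  by rewrite pmulr_lgt0// F20.
have ke0 : (0 < k `^ e)%R by rewrite powR_gt0.
have x1 : (1 < k `^ e / th)%R by rewrite ltr_pdivlMr// mul1r.
have [N HN] := exp_unbounded (c2 / c1)%R x1.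
(* The successor keeps [k ^+ M > 1] when [N = 0]. *)
pose M := N.+1.
have HM : (c2 / c1 < (k `^ e / th) ^+ M)%R.
  apply: lt_le_trans HN _; rewrite exprS ler_peMl ?exprn_ge0 ?ltW//.
  exact: lt_trans x1.
have kM0 : (0 < k ^+ M)%R by rewrite exprn_gt0.
have HX j s : (0 < s)%R -> (F2 (k ^+ j * s) <= th ^+ j * F2 s)%R.
  move=> s0; elim: j => [|j IH]; first by rewrite !expr0 !mul1r.
  rewrite !exprS -!mulrA; apply: le_trans (H _ _) _; first by rewrite mulr_gt0// exprn_gt0.
  by rewrite ler_pM2l.
exists (k ^+ M)%R, (c2 / c1 * th ^+ M * (k ^+ M) `^ (- a))%R; split.
- by rewrite exprn_egt1.
- rewrite powRD ?(gt_eqF kM0) ?implybT// ltr_pM2r ?powR_gt0//.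
  have -> : ((k ^+ M) `^ e = (k `^ e) ^+ M)%R.
    by rewrite -(powR_mulrn M (ltW k0)) powRAC powR_mulrn// ltW.
  by move: HM; rewrite expr_div_n ltr_pdivlMr ?exprn_gt0.
- move=> s s0; have Ms0 : (0 < k ^+ M * s)%R by rewrite mulr_gt0.
  apply: le_trans (up _ Ms0) _.
  have h1 := lo _ s0.
  apply: (@le_trans _ _ (c2 * ((th ^+ M * F2 s) * (k ^+ M * s) `^ (- a)))%R).
    by rewrite ler_pM2l// ler_pM2r ?powR_gt0//; exact: HX.
  rewrite (powRM _ (ltW kM0) (ltW s0)).
  rewrite [leLHS](_ : _ = c2 / c1 * th ^+ M * (k ^+ M) `^ (- a) * (c1 * (F2 s * s `^ (- a))))%R.
    by rewrite ler_pM2l// !mulr_gt0 ?invr_gt0 ?powR_gt0 ?exprn_gt0.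
  by field; rewrite gt_eqF.
Qed.

(** * Equivalent forms of the index condition *)

Section equivalent_conditions.
Context {R : realType} (n : nat) (gamma : R) (A : R -> \bar R).
Hypothesis gamma_gt0 : (0 < gamma)%R.
Hypothesis gamma_lt : (gamma < n%:R)%R.
Hypothesis yA : young A.
Hypothesis growth : growth_cond n gamma A.
Let al := (gamma / n%:R)%R.
Local Notation G := (Gr n gamma A).
Local Notation An := (sobolev_young n gamma A).
Let GP := G_gt0 gamma_gt0 gamma_lt yA growth.
Let phi (s : R) := fine (ginv An s).

Lemma ginv_AnE s : (0 < s)%R -> ginv An s = (phi s)%:E.
Proof.
move=> s0; rewrite /phi fineK// ge0_fin_numE ?ginv_ge0//.
apply: le_lt_trans (ginv_An_le_G gamma_gt0 gamma_lt yA growth s0) _; exact: ltry.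
Qed.

Lemma G_le_phi s : (0 < s)%R -> (G s <= phi s)%R.
Proof.
by move=> s0; rewrite -lee_fin -ginv_AnE//; exact: G_le_ginv_An.
Qed.

Lemma phi_le_G s : (0 < s)%R -> (phi s <= 4 * G s)%R.
Proof.
by move=> s0; rewrite -lee_fin -ginv_AnE//; exact: ginv_An_le_G.
Qed.

Lemma phi_gt0 s : (0 < s)%R -> (0 < phi s)%R.
Proof. by move=> s0; apply: lt_le_trans (G_le_phi s0); exact: GP. Qed.

(** The inverse of [An] lies between [G] and [4 G], so the gain transfers with [a = 0], and
    [n / (n - gamma) = 1 / (1 - al)]. *)
Lemma condP : (n%:R / (n%:R - gamma))%:E < boyd_lower An <-> dilation_gain (1 - al) G.
Proof.
have ng0 : (0 < n%:R - gamma)%R by rewrite subr_gt0.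
have n0 : (0 < n%:R :> R)%R by exact: lt_trans gamma_lt.
have -> : (n%:R / (n%:R - gamma) = (1 - al)^-1)%R.
  by rewrite /al; field; rewrite !gt_eqF.
have e0 : (0 < 1 - al)%R by exact: al1_gt0.
have nd s t : (0 < s)%R -> (s <= t)%R -> (phi s <= phi t)%R.
  move=> s0 st; rewrite -lee_fin -!ginv_AnE//; first exact: ginv_nd.
  exact: lt_le_trans st.
rewrite (boyd_lowerP ginv_AnE phi_gt0 nd e0).
have r0 (s : R) : (s `^ (- 0) = 1)%R by rewrite oppr0 powRr0.
split => H; rewrite -[X in dilation_gain X]subr0.
  have q : (0 < 4^-1 :> R)%R by rewrite invr_gt0.
  apply: (dilation_gain_transfer q ltr01 phi_gt0 _ _ H) => s s0; rewrite r0 mulr1.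
    by rewrite ler_pdivrMl//; exact: phi_le_G.
  by rewrite mul1r; exact: G_le_phi.
apply: (dilation_gain_transfer ltr01 (ltr0n R 4) GP _ _ H) => s s0; rewrite r0 mulr1.
  by rewrite mul1r; exact: G_le_phi.
exact: phi_le_G.
Qed.

Section small_upper_index.
Variables (sig th : R).
Hypothesis sig0 : (0 < sig)%R.
Hypothesis sig1 : (sig < 1)%R.
Hypothesis th_lt : (th < sig `^ al)%R.
Hypothesis H : forall s, (0 < s)%R -> (yinv A (s * sig) <= th * yinv A s)%R.
Local Notation psi := (psi n gamma A).

(** Since [th < sig^{al}], dividing the argument by [sig] does not decrease [psi]. Repeating this
    brings [r] within a factor [sig] of [s]; there [A^{-1}] is monotone and the power costs at most
    [sig^{-al}]. *)
Lemma psi_quasi_increasing r s : (0 < r)%R -> (r <= s)%R ->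
  (psi r <= sig `^ (- al) * psi s)%R.
Proof.
move=> r0 rs; have s0 := lt_le_trans r0 rs.
have al0 : (0 < al)%R by exact: al_gt0.
have near q : (0 < q)%R -> (s * sig < q)%R -> (q <= s)%R -> (psi q <= sig `^ (- al) * psi s)%R.
  move=> q0 sq qs; have ss0 : (0 < s * sig)%R by rewrite mulr_gt0.
  rewrite /psi -/al mulrCA -(powRM _ (ltW sig0) (ltW s0)) (mulrC sig).
  apply: ler_pM; rewrite ?powR_ge0//; first exact/ltW/yinv_gt0.
    exact: yinv_nd.
  rewrite !powRN lef_pV2 ?posrE ?powR_gt0//.
  by apply: ge0_ler_powR; rewrite ?nnegrE; exact: ltW.
have is1 : (1 < sig^-1)%R by rewrite invf_gt1.
have [k] := exp_unbounded (s / r)%R is1.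
elim: k r r0 rs => [|k IH] r r0 rs.
  by rewrite expr0 ltr_pdivrMr// mul1r ltNge rs.
move=> hk; have [sr|rs'] := ltP (s * sig)%R r; first exact: near.
have rsig0 : (0 < r / sig)%R by rewrite divr_gt0.
apply: (@le_trans _ _ (psi (r / sig))).
  have -> : psi r = (yinv A (r / sig * sig) * ((r / sig) * sig) `^ (- al))%R.
    by rewrite divfK// gt_eqF.
  rewrite (powRM _ (ltW rsig0) (ltW sig0)) /psi -/al.
  apply: (@le_trans _ _ (th * yinv A (r / sig) * ((r / sig) `^ (- al) * sig `^ (- al)))%R).
    by rewrite ler_pM2r ?H// mulr_gt0 ?powR_gt0.
  rewrite [leLHS](_ : _ = (th * sig `^ (- al)) * (yinv A (r / sig) * (r / sig) `^ (- al)))%R; last by ring.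
  rewrite ger_pMl; last by rewrite mulr_gt0 ?powR_gt0// yinv_gt0.
  by rewrite powRN ler_pdivrMr ?powR_gt0// mul1r ltW.
apply: IH => //; first by rewrite ler_pdivrMr.
have -> : (s / (r / sig) = sig * (s / r))%R by field; rewrite !gt_eqF.
rewrite -ltr_pdivlMl//.
by move: hk; rewrite exprS.
Qed.

Lemma G_le_psi s : (0 < s)%R -> (G s <= sig `^ (- al) * psi s)%R.
Proof. by move=> s0; apply: (G_le gamma_gt0) => // r r0 rs; exact: psi_quasi_increasing. Qed.

(** Here [psi <= G <= sig^{-al} psi], so the dilation gain passes between [A^{-1}] with exponent 1
    and [G] with exponent [1 - al]. The bound [G <= phi <= 4 G] then yields the equivalence for the
    inverse of [An]. *)
Lemma small_index_equiv :
  (dilation_gain (1 - al) G <-> 1 < boyd_lower A) /\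
  simeq_pos (ginv An) (fun t => ginv A t * (t `^ (- al))%:E).
Proof.
have sp : (0 < sig `^ (- al))%R by rewrite powR_gt0.
have pG s : (0 < s)%R -> (psi s <= G s)%R by move=> s0; apply: (psi_le_G gamma_gt0).
have yP s : (0 < s)%R -> (0 < yinv A s)%R by exact: yinv_gt0.
split.
  have -> : (1 : \bar R) = (1^-1)%:E by rewrite invr1.
  rewrite (boyd_lowerP (fun s _ => yinvE yA s) yP (fun s t _ st => yinv_nd yA st) ltr01).
  split => D.
    (* Recovering [A^{-1}] from [psi] multiplies by [s^{al}], that is, a transfer with
       [a = - al]. *)
    have -> : (1 = 1 - al - - al)%R by ring.
    have q : (0 < (sig `^ (- al))^-1)%R by rewrite invr_gt0.
    apply: (dilation_gain_transfer q ltr01 GP _ _ D) => s s0; rewrite opprK.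
      rewrite ler_pdivrMl// -ler_pdivlMr ?powR_gt0//.
      by rewrite -mulrA -powRN; exact: G_le_psi.
    rewrite mul1r -ler_pdivrMr ?powR_gt0// -powRN; exact: pG.
  apply: (dilation_gain_transfer ltr01 sp yP _ _ D) => s s0.
    by rewrite mul1r; exact: pG.
  exact: G_le_psi.
exists 1%R, (4 * sig `^ (- al))%R; split => //; first by rewrite mulr_gt0.
move=> s s0; rewrite mul1e yinvE// -EFinM ginv_AnE// -EFinM !lee_fin; split.
  by apply: le_trans (G_le_phi s0); exact: pG.
apply: le_trans (phi_le_G s0) _; rewrite -mulrA ler_pM2l//; exact: G_le_psi.
Qed.

End small_upper_index.

End equivalent_conditions.

(** * Assembly of the four claims *)

Unset Implicit Arguments.

Theorem theorem3p4 (R : realType) (n : nat) (gamma : R) (A : R -> \bar R)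
    (gamma_gt0 : (0 < gamma)%R) (gamma_lt : (gamma < n%:R)%R)
    (youngA : young A) :
  let An := sobolev_young n gamma A in
  let cond := (n%:R / (n%:R - gamma))%:E < boyd_lower An in
  (growth_cond n gamma A ->
    [/\
      cond ->
        frac_max_bounded n gamma A An /\
        (forall B : R -> \bar R, young B -> frac_max_bounded n gamma A B ->
           orlicz_embeds n An B),
      ~ cond ->
        forall B : R -> \bar R, young B -> frac_max_bounded n gamma A B ->
          exists B1 : R -> \bar R,
            [/\ young B1, orlicz n B1 `<` orlicz n B &
                frac_max_bounded n gamma A B1] &
      boyd_upper A < (n%:R / gamma)%:E ->
        (cond <-> 1 < boyd_lower A) /\
        simeq_pos (ginv An)
          (fun t => ginv A t * (t `^ (- (gamma / n%:R)))%:E)]) /\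
  (~ growth_cond n gamma A ->
    ~ exists B : R -> \bar R, young B /\ frac_max_bounded n gamma A B).
Proof.
move=> An cond; split => [growth|ng [B [yB bdd]]]; last first.
  have [K K0 HB] := frac_max_bounded_modular (young_nneg yB) (young_ndecr yB) bdd.
  exact: (no_growth_no_target gamma_gt0 gamma_lt youngA yB K0 HB ng).
(* From here on the index condition is used as the strict dilation inequality for [G]. *)
have cP := condP gamma_gt0 gamma_lt youngA growth.
split.
- move=> /cP dg; split; first exact: dilation_gain_bounded.
  by move=> B yB; exact: bounded_embeds.
- move=> nc B yB; apply: no_optimal_target => // dg; apply: nc; exact/cP.
- have -> : (n%:R / gamma = (gamma / n%:R)^-1)%R by rewrite invf_div.
  have al0 := al_gt0 gamma_gt0 gamma_lt.
  move=> /(boyd_upper_lt (fun s _ => yinvE youngA s) (@yinv_gt0 _ _ youngA)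
    (fun s t _ st => yinv_nd youngA st) al0)[sig [th [sig0 sig1 thl H]]].
  have [h1 h2] := small_index_equiv gamma_gt0 gamma_lt youngA growth sig0 sig1 thl H.
  by split; [split => [/cP/h1|/h1/cP]|exact: h2].
Qed.
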